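(* A general pencil $\mathcal P$ of plane cubics over $\mathbb C$ has exactly $12$ common flex lines. That is, there is a nonempty Zariski open subset $U$ of the Grassmannian $\mathrm{Gr}(2,V)$, where $V=H^0(\mathbb P^2,\mathcal O_{\mathbb P^2}(3))$, such that for every two-dimensional subspace $W\in U$ the pencil $\mathcal P=\mathbb P(W)$ has exactly $12$ common flex lines.
   Context: All varieties are over $\mathbb C$. Let $V=H^0(\mathbb P^2,\mathcal O_{\mathbb P^2}(3))$, so that $\dim V=10$ and $\mathbb P(V)$ parametrizes plane cubic curves. A two-dimensional subspace $W\subset V$ determines the pencil of plane cubics $\mathcal P=\mathbb P(W)=\{C_t: t\in\mathbb P(W)\}$; the curves $C_t$ are its members. A property holds for a general pencil if it holds for all $W$ in a nonempty Zariski open subset of $\mathrm{Gr}(2,V)$. A flex tangent line of a plane curve $C$ at a smooth point $p\in C$ is a line $L\subset\mathbb P^2$ whose local intersection multiplicity with $C$ at $p$ satisfies $I_p(L,C)\ge 3$. A common flex line of a pencil $\mathcal P$ is a line $L\subset\mathbb P^2$ for which there exist two distinct members $C_1\ne C_2$ of $\mathcal P$ such that, for each $i\in\{1,2\}$, $L$ is a flex tangent line of $C_i$ at some smooth point of $C_i$. *)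

(* Defs.v *)
From HB Require Import structures.
From mathcomp Require Import all_boot all_order all_algebra.
From mathcomp Require Import reals complex mpoly.

Set Implicit Arguments.
Unset Strict Implicit.
Unset Printing Implicit Defensive.

Import GRing.Theory.
Local Open Scope ring_scope.

Section PlaneCubics.

Variable K : fieldType.

(* V = H^0(P^2, O(3)): ternary cubic forms. *)
Definition cubic_form := dhomog 3 K 3.

(* A point of P^2 is given by a nonzero vector of K^3, a line of P^2 by a
   two-dimensional subspace of K^3; the notions below do not depend on the
   vector representing a point. *)
Notation vec3 := 'rV[K]_3.

Definition smooth_point (F : {mpoly K[3]}) (p : vec3) : Prop :=
  F.@[p 0] = 0 /\ exists i : 'I_3, (F^`M(i)).@[p 0] != 0.

(* The univariate polynomial F(p + t q) in t. *)
Definition restrict_line (F : {mpoly K[3]}) (p q : vec3) : {poly K} :=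
  mmap polyC (fun i => (p 0 i)%:P + q 0 i *: 'X) F.

(* I_p(L, {F = 0}) >= n, where I_p is the order of vanishing of F|_L at p,
   computed in the local parameter t of L = {p + t q} at p. The order is
   infinite when F vanishes identically on L. *)
Definition intersection_mult_ge (n : nat) (F : {mpoly K[3]})
    (L : {vspace vec3}) (p : vec3) : Prop :=
  exists q : vec3, L = (<[p]> + <[q]>)%VS /\ 'X^n %| restrict_line F p q.

Definition flex_tangent_line (F : {mpoly K[3]}) (L : {vspace vec3}) : Prop :=
  \dim L = 2%N /\
  exists p : vec3,
    [/\ p != 0, p \in L, smooth_point F p & intersection_mult_ge 3 F L p].

(* Members of the pencil P(W) are the lines <[F]> with F a nonzero element
   of W. *)
Definition common_flex_line (W : {vspace cubic_form}) (L : {vspace vec3}) :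
    Prop :=
  exists F1 F2 : cubic_form,
    [/\ F1 \in W /\ F1 != 0,
        F2 \in W /\ F2 != 0,
        <[F1]>%VS != <[F2]>%VS,
        flex_tangent_line F1 L
      & flex_tangent_line F2 L].

Definition cubic_monomial := {m : 'X_{1..3 < 4} | mdeg m == 3%N}.

Definition plucker_index := (cubic_monomial * cubic_monomial)%type.

(* Plücker coordinates of a two-dimensional W: the 2 x 2 minors of the
   coefficient matrix of a basis of W. Changing the basis multiplies all of
   them by the same nonzero scalar. *)
Definition plucker (W : {vspace cubic_form}) (k : 'I_#|{: plucker_index}|) :
    K :=
  let F : cubic_form := (vbasis W)`_0 in
  let G : cubic_form := (vbasis W)`_1 in
  let: (m1, m2) := enum_val k in
  F@_(val m1) * G@_(val m2) - F@_(val m2) * G@_(val m1).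

(* U is a Zariski open subset of Gr(2, V), for the Plücker embedding: its
   complement in Gr(2, V) is the common zero locus of a family of homogeneous
   polynomials in the Plücker coordinates. *)
Definition zariski_open_Gr2 (U : {vspace cubic_form} -> Prop) : Prop :=
  exists S : {mpoly K[#|{: plucker_index}|]} -> Prop,
    (forall P, S P -> exists d : nat, P \is d.-homog) /\
    (forall W, U W <->
       \dim W = 2%N /\ exists P, S P /\ P.@[plucker W] != 0).

End PlaneCubics.

(* Main.v *)
(** Write the members of the pencil spanned by F and G as symmetric trilinear forms.
    A line L = ker l is a common flex line, with flex points p1 and p2 on two members, iff
    the symmetric product q of p1 and p2 contracts F and G to multiples alpha l and beta l
    of l, and q l = 0; conversely p1 and p2 are read off from q. For general F and G the
    contraction q |-> (q F, q G) is an isomorphism of 6-dimensional spaces, so q is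
    determined by l and (alpha : beta), and q l = 0 becomes three equations
    alpha r_i(l) + beta q_i(l) = 0 with conics r_i and q_i.

    If the r_i have no common zero, beta is nonzero, and s = alpha / beta is an eigenvalue of
    the multiplication by s on the 12-dimensional space of the functionals on quartics that
    kill the minors r_i q_j - r_j q_i; the eigenvectors are the evaluations at the solutions l.

    All the nondegeneracy conditions needed (the isomorphism, the syzygies of the r_i, simple
    eigenvalues, distinct flex points, distinct members, smoothness) say that rational
    functions of the Plücker coordinates do not vanish, possibly at the roots of the
    characteristic polynomial; so they hold on an open set, which is nonempty because they
    hold for the pencil of x^3 + y^3 - z^3 and x^2 y + y^2 z + z^2 x. *)

Require Import Defs.
From HB Require Import structures.
From mathcomp Require Import all_boot all_order all_algebra all_field.
From mathcomp Require Import reals complex mpoly ring.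

Set Implicit Arguments.
Unset Strict Implicit.
Unset Printing Implicit Defensive.

Import GRing.Theory.
Local Open Scope ring_scope.

(** * Regular functions near a point *)

(** The number 12 is the degree of the system: the alpha r_i + beta q_i are three equations of
    bidegree (1, 2) on P^1 x P^2, and (t + 2 h)^3 = 12 t h^2; it is also 15 - 3, the quartics modulo
    three minors. Passing to eigenvectors replaces an intersection number by the roots of one
    polynomial of degree 12, and multiplicity one by the nonvanishing of its derivative. The
    symmetric product appears because flexes make F1(p1, x, y) and F2(p2, x, y) vanish for x and y
    on L, so that H(p1, p2, x) vanishes there for every H in the pencil: a condition linear in H.
    The obstacle to openness is that the solutions and their flex points are only algebraic over the
    Plücker coordinates. So no root is ever extracted in the conditions: the line is written by
    cofactors in terms of the eigenvalue, the two flex points enter through norms from a quadratic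
    extension, and a condition at all eigenvalues of X becomes the invertibility of a polynomial in
    X. *)

Section Near.
Variables (K : fieldType) (n : nat) (v0 : 'I_n -> K).
Implicit Types (v : 'I_n -> K) (f g : ('I_n -> K) -> {poly K}).

(* [P] holds on a Zariski neighbourhood of [v0]. *)
Definition near (P : ('I_n -> K) -> Prop) :=
  exists2 d : {mpoly K[n]}, d.@[v0] != 0 & forall v, d.@[v] != 0 -> P v.

Lemma near_and P Q : near P -> near Q -> near (fun v => P v /\ Q v).
Proof.
move=> [d d0 dP] [e e0 eQ]; exists (d * e); first by rewrite mevalM mulf_neq0.
by move=> v; rewrite mevalM mulf_eq0 negb_or => /andP[/dP ? /eQ].
Qed.

Lemma near_sub P Q : (forall v, P v -> Q v) -> near P -> near Q.
Proof. by move=> PQ [d d0 dP]; exists d => // v /dP /PQ. Qed.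

Lemma near_all (P : ('I_n -> K) -> Prop) : (forall v, P v) -> near P.
Proof. by move=> PP; exists 1 => [|v _]; rewrite ?meval1 ?oner_neq0. Qed.

(* The coefficients of [f v] are rational functions of [v], with a common
   denominator that does not vanish at [v0]. *)
Definition regular f :=
  exists2 p : {poly {mpoly K[n]}} * {mpoly K[n]}, p.2.@[v0] != 0 &
    forall v, p.2.@[v] != 0 -> p.2.@[v] *: f v = map_poly (meval v) p.1.

Lemma regular_near f g : near (fun v => f v = g v) -> regular f -> regular g.
Proof.
move=> [d d0 dE] [[p e] /= e0 eE]; exists (d *: p, d * e) => /=.
  by rewrite mevalM mulf_neq0.
move=> v; rewrite mevalM mulf_eq0 negb_or => /andP[dv ev].
by rewrite -(dE _ dv) -scalerA eE // map_polyZ.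
Qed.

Lemma eq_regular f g : f =1 g -> regular f -> regular g.
Proof. by move=> fg; apply/regular_near/near_all. Qed.

Lemma regular_const c : regular (fun=> c).
Proof.
exists (map_poly (@mpolyC n K) c, 1) => /= [|v _]; rewrite ?meval1 ?oner_neq0 //.
by rewrite scale1r -map_poly_comp map_poly_id //= => x _; rewrite mevalC.
Qed.

Lemma regular_coord i : regular (fun v => (v i)%:P).
Proof.
exists (('X_i)%:P, 1) => /= [|v _]; rewrite ?meval1 ?oner_neq0 //.
by rewrite scale1r map_polyC /= mevalXU.
Qed.

Lemma regularD f g : regular f -> regular g -> regular (fun v => f v + g v).
Proof.
move=> [[p d] /= d0 dE] [[q e] /= e0 eE].
exists (e *: p + d *: q, d * e) => /=; first by rewrite mevalM mulf_neq0.
move=> v; rewrite mevalM mulf_eq0 negb_or => /andP[/dE dv /eE ev].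
by rewrite rmorphD /= !map_polyZ /= -dv -ev scalerDr !scalerA [X in X *: f v]mulrC.
Qed.

Lemma regularM f g : regular f -> regular g -> regular (fun v => f v * g v).
Proof.
move=> [[p d] /= d0 dE] [[q e] /= e0 eE].
exists (p * q, d * e) => /=; first by rewrite mevalM mulf_neq0.
move=> v; rewrite mevalM mulf_eq0 negb_or => /andP[/dE dv /eE ev].
by rewrite rmorphM /= -dv -ev -scalerAl -scalerAr scalerA.
Qed.

Lemma regularN f : regular f -> regular (fun v => - f v).
Proof.
move=> rf; apply: (@eq_regular (fun v => (-1) * f v)) => [v|].
  by rewrite mulN1r.
by apply: regularM => //; apply: regular_const.
Qed.

Lemma regularB f g : regular f -> regular g -> regular (fun v => f v - g v).
Proof. by move=> rf rg; apply/regularD/regularN. Qed.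

Lemma regular_sum (I : Type) (r : seq I) (P : pred I) F :
  (forall i, regular (F i)) -> regular (fun v => \sum_(i <- r | P i) F i v).
Proof.
move=> rF; elim: r => [|i r IHr].
  by apply: (@eq_regular (fun=> 0)) => [v|]; rewrite ?big_nil //; apply: regular_const.
apply: (@eq_regular (fun v => (if P i then F i v else 0) + \sum_(j <- r | P j) F j v)).
  by move=> v; rewrite big_cons; case: (P i); rewrite ?add0r.
by apply: regularD => //; case: (P i) => //; apply: regular_const.
Qed.

Lemma regular_prod (I : Type) (r : seq I) (P : pred I) F :
  (forall i, regular (F i)) -> regular (fun v => \prod_(i <- r | P i) F i v).
Proof.
move=> rF; elim: r => [|i r IHr].
  by apply: (@eq_regular (fun=> 1)) => [v|]; rewrite ?big_nil //; apply: regular_const.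
apply: (@eq_regular (fun v => (if P i then F i v else 1) * \prod_(j <- r | P j) F j v)).
  by move=> v; rewrite big_cons; case: (P i); rewrite ?mul1r.
by apply: regularM => //; case: (P i) => //; apply: regular_const.
Qed.

Lemma regular_deriv f : regular f -> regular (fun v => (f v)^`()).
Proof.
move=> [[p d] /= d0 dE]; exists (p^`(), d) => //= v /dE dv.
by rewrite -deriv_map -dv derivZ.
Qed.

Definition regularC (a : ('I_n -> K) -> K) := regular (fun v => (a v)%:P).

Implicit Types a b : ('I_n -> K) -> K.

Lemma eq_regularC a b : a =1 b -> regularC a -> regularC b.
Proof. by move=> ab; apply: eq_regular => v; rewrite ab. Qed.

Lemma regularC_const c : regularC (fun=> c).
Proof. exact: regular_const. Qed.

Lemma regularC_D a b : regularC a -> regularC b -> regularC (fun v => a v + b v).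
Proof.
by move=> ra rb; apply: eq_regular (regularD ra rb) => v; rewrite polyCD.
Qed.

Lemma regularC_M a b : regularC a -> regularC b -> regularC (fun v => a v * b v).
Proof.
by move=> ra rb; apply: eq_regular (regularM ra rb) => v; rewrite polyCM.
Qed.

Lemma regularC_N a : regularC a -> regularC (fun v => - a v).
Proof.
by move=> ra; apply: eq_regular (regularN ra) => v; rewrite polyCN.
Qed.

Lemma regularC_sum (I : Type) (r : seq I) (P : pred I) F :
  (forall i, regularC (F i)) -> regularC (fun v => \sum_(i <- r | P i) F i v).
Proof.
by move=> rF; apply: eq_regular (regular_sum r P rF) => v; rewrite rmorph_sum.
Qed.

Lemma near_neq0 a : regularC a -> a v0 != 0 -> near (fun v => a v != 0).
Proof.
move=> [[p d] /= d0 dE] a0; exists (d * p`_0).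
  move/(congr1 (coefp 0)): (dE _ d0); rewrite /= coefZ coefC coef_map /= => pE.
  by rewrite mevalM -pE !mulf_neq0.
move=> v; rewrite mevalM mulf_eq0 negb_or => /andP[/dE/(congr1 (coefp 0))].
rewrite /= coefZ coefC coef_map /= => <-; rewrite mulf_eq0 negb_or.
by case/andP.
Qed.

Lemma regularC_V a : regularC a -> a v0 != 0 -> regularC (fun v => (a v)^-1).
Proof.
(* From d a = p_0 one gets 1 / a = d / p_0; both terms are multiplied by [d] so that a nonzero
   denominator gives access to the relation itself. *)
move=> [[p d] /= d0 dE] a0; exists ((d * d)%:P, d * p`_0) => /=.
  move/(congr1 (coefp 0)): (dE _ d0); rewrite /= coefZ coefC coef_map /= => pE.
  by rewrite mevalM -pE !mulf_neq0.
move=> v; rewrite mevalM mulf_eq0 negb_or => /andP[dv].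
move/(congr1 (coefp 0)): (dE _ dv); rewrite /= coefZ coefC coef_map /= => <-.
rewrite mulf_eq0 negb_or => /andP[_ av].
by rewrite map_polyC /= mevalM -mul_polyC -polyCM mulrA mulfK.
Qed.

Definition regular_mx m p (A : ('I_n -> K) -> 'M[{poly K}]_(m, p)) :=
  forall i j, regular (fun v => A v i j).

Definition regularC_mx m p (A : ('I_n -> K) -> 'M[K]_(m, p)) :=
  forall i j, regularC (fun v => A v i j).

Lemma regular_det m (A : ('I_n -> K) -> 'M[{poly K}]_m) :
  regular_mx A -> regular (fun v => \det (A v)).
Proof.
move=> rA; apply: regular_sum => s; apply: regularM; first exact: regular_const.
exact: regular_prod.
Qed.

Lemma regular_adj m (A : ('I_n -> K) -> 'M[{poly K}]_m) :
  regular_mx A -> regular_mx (fun v => \adj (A v)).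
Proof.
move=> rA i j; apply: (@eq_regular (fun v => cofactor (A v) j i)).
  by move=> v; rewrite mxE.
apply: regularM; first exact: regular_const.
by apply: regular_det => k l; apply: (@eq_regular (fun v => A v (lift j k) (lift i l))) => [v|//];
    rewrite !mxE.
Qed.

Lemma regular_mulmx m p q (A : ('I_n -> K) -> 'M[{poly K}]_(m, p))
    (B : ('I_n -> K) -> 'M[{poly K}]_(p, q)) :
  regular_mx A -> regular_mx B -> regular_mx (fun v => A v *m B v).
Proof.
move=> rA rB i j; apply: (@eq_regular (fun v => \sum_k A v i k * B v k j)).
  by move=> v; rewrite mxE.
by apply: regular_sum => k; apply: regularM.
Qed.

Lemma regularC_mxE m p (A : ('I_n -> K) -> 'M[K]_(m, p)) :
  regularC_mx A -> regular_mx (fun v => map_mx polyC (A v)).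
Proof. by move=> rA i j; apply: eq_regular (rA i j) => v; rewrite mxE. Qed.

Lemma regularC_mx_const m p (A : 'M[K]_(m, p)) : regularC_mx (fun=> A).
Proof. by move=> i j; apply: regularC_const. Qed.

Lemma regularC_mulmx m p q (A : ('I_n -> K) -> 'M[K]_(m, p))
    (B : ('I_n -> K) -> 'M[K]_(p, q)) :
  regularC_mx A -> regularC_mx B -> regularC_mx (fun v => A v *m B v).
Proof.
move=> rA rB i j; apply: (@eq_regularC (fun v => \sum_k A v i k * B v k j)).
  by move=> v; rewrite mxE.
by apply: regularC_sum => k; apply: regularC_M.
Qed.

Lemma regularC_det m (A : ('I_n -> K) -> 'M[K]_m) :
  regularC_mx A -> regularC (fun v => \det (A v)).
Proof.
move=> rA; apply: eq_regular (regular_det (regularC_mxE rA)) => v.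
by rewrite det_map_mx.
Qed.

Lemma near_unitmx m (A : ('I_n -> K) -> 'M[K]_m) :
  regularC_mx A -> A v0 \in unitmx -> near (fun v => A v \in unitmx).
Proof.
move=> rA uA; apply: near_sub (near_neq0 (regularC_det rA) _) => [v|].
  by rewrite unitmxE unitfE.
by rewrite -unitfE -unitmxE.
Qed.

Lemma regularC_invmx m (A : ('I_n -> K) -> 'M[K]_m) :
  regularC_mx A -> A v0 \in unitmx -> regularC_mx (fun v => invmx (A v)).
Proof.
move=> rA uA i j.
apply: (@regular_near (fun v => ((\det (A v))^-1)%:P * \adj (map_mx polyC (A v)) i j)).
  apply: near_sub (near_unitmx rA uA) => v uv.
  by rewrite /invmx uv -map_mx_adj !mxE polyCM.
apply: regularM; last exact/regular_adj/regularC_mxE.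
by apply: regularC_V (regularC_det rA) _; rewrite -unitfE -unitmxE.
Qed.

Lemma regular_char_poly m (A : ('I_n -> K) -> 'M[K]_m) :
  regularC_mx A -> regular (fun v => char_poly (A v)).
Proof.
move=> rA; apply: regular_det => i j.
apply: (@eq_regular (fun v => 'X *+ (i == j) - (A v i j)%:P)) => [v|].
  by rewrite !mxE.
by apply: regularB (rA i j); apply: regular_const.
Qed.

End Near.

(** * Open conditions at the roots of a characteristic polynomial *)

Lemma mulmx_horner_eigen (F : fieldType) m (A : 'M[F]_m.+1) (u : 'rV_m.+1) a h :
  u *m A = a *: u -> u *m horner_mx A h = h.[a] *: u.
Proof.
move=> uA; elim/poly_ind: h => [|h c IHh]; first by rewrite rmorph0 mulmx0 horner0 scale0r.
rewrite rmorphD rmorphM /= horner_mx_X horner_mx_C mulmxDr -mulmxE mulmxA IHh.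
by rewrite -scalemxAl uA scalerA mul_mx_scalar !hornerE scalerDl.
Qed.

Section NearRoots.
Variables (K : closedFieldType) (n : nat) (v0 : 'I_n -> K).

(* [h] has no root in common with the characteristic polynomial of [X] iff
   [h(X)] is invertible, which is an open condition. *)
Lemma near_root_horner_neq0 m (X : ('I_n -> K) -> 'M[K]_m.+1)
    (h : ('I_n -> K) -> {poly K}) :
    regularC_mx v0 X -> regular v0 h ->
    (forall a, root (char_poly (X v0)) a -> (h v0).[a] != 0) ->
  near v0 (fun v => forall a, root (char_poly (X v)) a -> (h v).[a] != 0).
Proof.
move=> rX [[p d] /= d0 dE] h0.
(* Where [d] does not vanish, the degree of [h v] is bounded by that of [p], so h(X) is a sum of a
   fixed number of terms, each of them regular. *)
have hE v : d.@[v] != 0 -> h v = \sum_(i < size p) (h v)`_i *: 'X^i.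
  move=> dv; rewrite -poly_def; apply/polyP => i; rewrite coef_poly.
  case: ltnP => // lepi; apply: (mulfI dv); rewrite mulr0 -coefZ dE // coef_map /=.
  by rewrite nth_default // meval0.
pose A v := \sum_(i < size p) (h v)`_i *: X v ^+ i.
have AE v : d.@[v] != 0 -> horner_mx (X v) (h v) = A v.
  move=> dv; rewrite {1}(hE _ dv) rmorph_sum; apply: eq_bigr => i _ /=.
  by rewrite linearZ /= rmorphXn /= horner_mx_X.
have rh i : regularC v0 (fun v => (h v)`_i).
  exists ((p`_i)%:P, d) => //= v dv.
  rewrite map_polyC /=; move/(congr1 (coefp i)): (dE _ dv).
  by rewrite /= coefZ coef_map /= => <-; rewrite polyCM mul_polyC.
have rXi i : regularC_mx v0 (fun v => X v ^+ i).
  elim: i => [|i IHi]; first exact: regularC_mx_const.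
  move=> j k; have := regularC_mulmx rX IHi j k.
  by apply: eq_regularC => v; rewrite exprS.
have rA : regularC_mx v0 A.
  move=> j k.
  apply: (@eq_regularC _ _ _ (fun v => \sum_(i < size p) (h v)`_i * (X v ^+ i) j k)).
    by move=> v; rewrite summxE; apply: eq_bigr => i _; rewrite mxE.
  by apply: regularC_sum => i; apply: regularC_M (rh i) (rXi i j k).
(* In the Bezout relation u chi + w h = 1 evaluated at the matrix, Cayley-Hamilton kills the first
   term, so w(X) inverts h(X). *)
have uA : A v0 \in unitmx.
  have /Bezout_eq1_coprimepP [[u w] /= uw1] : coprimep (char_poly (X v0)) (h v0).
    apply/negPn/negP => /closed_rootP[a]; rewrite root_gcd => /andP[/h0].
    by rewrite rootE => /negbTE->.
  have /mulmx1_unit[//] : A v0 *m horner_mx (X v0) w = 1%:M.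
  rewrite -AE // mulmxE -rmorphM /= mulrC.
  by rewrite -[RHS](rmorph1 (horner_mx (X v0))) -uw1 rmorphD !rmorphM /=
             Cayley_Hamilton mulr0 add0r.
have nd : near v0 (fun v => d.@[v] != 0) by exists d.
apply: near_sub (near_and (near_unitmx rA uA) nd) => v [uv dv] a.
rewrite -eigenvalue_root_char => /eigenvalueP[u uX u0].
apply: contra_neq u0 => h0'; have uA0 : u *m A v = 0.
  by rewrite -AE // (mulmx_horner_eigen _ uX) h0' scale0r.
by rewrite -[u](mulmxK uv) uA0 mul0mx.
Qed.

End NearRoots.

(** * Conics and functionals on forms *)

Notation i0 := (@Ordinal 3 0 isT).
Notation i1 := (@Ordinal 3 1 isT).
Notation i2 := (@Ordinal 3 2 isT).

Lemma ord3_ind (P : 'I_3 -> Prop) : P i0 -> P i1 -> P i2 -> forall i, P i.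
Proof.
move=> P0 P1 P2 [[|[|[|//]]] lti].
- by rewrite (_ : Ordinal lti = i0) //; apply: val_inj.
- by rewrite (_ : Ordinal lti = i1) //; apply: val_inj.
- by rewrite (_ : Ordinal lti = i2) //; apply: val_inj.
Qed.

Lemma sum3 (V : nmodType) (F : 'I_3 -> V) : \sum_i F i = F i0 + F i1 + F i2.
Proof.
rewrite !big_ord_recl big_ord0 addr0 addrA.
by congr (_ + _ + _); congr F; apply: val_inj.
Qed.

(* The monomial x^(d - s - t) y^s z^t of degree d is the (s + t)(s + t + 1)/2 + t -th one. *)
Definition mon_rank (s t : nat) : nat := ((s + t) * (s + t).+1)./2 + t.

Definition rank_of (w : seq 'I_3) : nat := mon_rank (count_mem i1 w) (count_mem i2 w).

(** Forms and functionals of degree 2, 3 and 4 are stored by their 6, 10 and 15 monomials. A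
    monomial is entered as a word in the variables, and its index is symmetric in the letters by
    construction. *)
Definition ix2 (i j : 'I_3) : 'I_6 := inord (rank_of [:: i; j]).
Definition ix3 (i j k : 'I_3) : 'I_10 := inord (rank_of [:: i; j; k]).
Definition ix4 (i j k l : 'I_3) : 'I_15 := inord (rank_of [:: i; j; k; l]).

Lemma rank_of_perm w w' : perm_eq w w' -> rank_of w = rank_of w'.
Proof. by move=> /permP eqw; rewrite /rank_of !eqw. Qed.

Lemma ix2C i j : ix2 i j = ix2 j i.
Proof. by congr inord; apply: rank_of_perm; apply/permP => a /=; rewrite addnCA. Qed.

Lemma val_ix2 i j : ix2 i j = rank_of [:: i; j] :> nat.
Proof. by rewrite inordK //; elim/ord3_ind: i; elim/ord3_ind: j. Qed.

Lemma val_ix3 i j k : ix3 i j k = rank_of [:: i; j; k] :> nat.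
Proof. by rewrite inordK //; elim/ord3_ind: i; elim/ord3_ind: j; elim/ord3_ind: k. Qed.

Lemma val_ix4 i j k l : ix4 i j k l = rank_of [:: i; j; k; l] :> nat.
Proof.
by rewrite inordK //; elim/ord3_ind: i; elim/ord3_ind: j; elim/ord3_ind: k; elim/ord3_ind: l.
Qed.

(** Inverts [mon_rank]: the pairs (s, t) with s + t <= d, in the order of their ranks. *)
Definition exps (d : nat) : seq (nat * nat) :=
  flatten [seq [seq (e - t, t)%N | t <- iota 0 e.+1] | e <- iota 0 d.+1].

Definition word_of (d : nat) (c : nat) : seq 'I_3 :=
  let: (s, t) := nth (0, 0)%N (exps d) c in nseq (d - (s + t)) i0 ++ nseq s i1 ++ nseq t i2.

Lemma ix4_surj (c : 'I_15) : exists i j k l, c = ix4 i j k l.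
Proof.
exists (nth i0 (word_of 4 c) 0), (nth i0 (word_of 4 c) 1),
       (nth i0 (word_of 4 c) 2), (nth i0 (word_of 4 c) 3).
apply: ord_inj; rewrite val_ix4.
by case: c; do 15?[case=> //].
Qed.

Section Pairing.
Variable K : fieldType.
Implicit Types (phi : 'rV[K]_15) (eta : 'rV[K]_10) (e : 'M[K]_3) (l : 'rV[K]_3).
Implicit Types (r q : 'I_3 -> 'M[K]_3).

Definition cval e l := \sum_i \sum_j e i j * (l 0 i * l 0 j).

(** A row of length 15 is a functional on quartics; here it is applied to the product of the
    quadrics with matrices [e] and [e']. In the same way [pair3] applies a functional on cubics to a
    quadric times the variable x_a. *)
Definition pair4 phi e e' :=
  \sum_i \sum_j \sum_a \sum_b e i j * e' a b * phi 0 (ix4 i j a b).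

Definition pair3 eta e a := \sum_i \sum_j e i j * eta 0 (ix3 i j a).

Definition ev4 l : 'rV[K]_15 := \row_c \prod_(i <- word_of 4 c) l 0 i.
Definition ev3 l : 'rV[K]_10 := \row_c \prod_(i <- word_of 3 c) l 0 i.

Lemma ev4E l i j k m : ev4 l 0 (ix4 i j k m) = l 0 i * l 0 j * l 0 k * l 0 m.
Proof.
rewrite mxE val_ix4; elim/ord3_ind: i; elim/ord3_ind: j; elim/ord3_ind: k; elim/ord3_ind: m;
 rewrite /= !big_cons big_nil; ring.
Qed.

Lemma ev3E l i j k : ev3 l 0 (ix3 i j k) = l 0 i * l 0 j * l 0 k.
Proof.
rewrite mxE val_ix3; elim/ord3_ind: i; elim/ord3_ind: j; elim/ord3_ind: k;
 rewrite /= !big_cons big_nil; ring.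
Qed.

End Pairing.

(** * Solutions as eigenvectors *)

Section Pairing.
Variable K : fieldType.
Implicit Types (phi : 'rV[K]_15) (eta : 'rV[K]_10) (e : 'M[K]_3) (l : 'rV[K]_3).
Implicit Types (r q : 'I_3 -> 'M[K]_3).

Lemma ix4_mid i j a b : ix4 i j a b = ix4 a b i j.
Proof. by congr inord; apply: rank_of_perm; rewrite (perm_catC [:: i; j] [:: a; b]). Qed.

(** The functional u |-> phi(e u) on quadrics, through its values on the x_a x_b. *)
Definition slice phi e a b := \sum_i \sum_j e i j * phi 0 (ix4 i j a b).

Lemma pair4_slice phi e e' : pair4 phi e e' = \sum_a \sum_b e' a b * slice phi e a b.
Proof.
rewrite /pair4; under eq_bigr => i _ do rewrite exchange_big /=.
rewrite exchange_big /=; apply: eq_bigr => a _.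
under eq_bigr => i _ do rewrite exchange_big /=.
rewrite exchange_big /=; apply: eq_bigr => b _.
rewrite /slice big_distrr /=; apply: eq_bigr => i _; rewrite big_distrr /=.
by apply: eq_bigr => j _; rewrite mulrCA mulrA.
Qed.

Lemma pair4C phi e e' : pair4 phi e e' = pair4 phi e' e.
Proof.
rewrite pair4_slice; apply: eq_bigr => a _; apply: eq_bigr => b _.
rewrite /slice big_distrr /=; apply: eq_bigr => i _; rewrite big_distrr /=.
by apply: eq_bigr => j _; rewrite ix4_mid mulrA.
Qed.

Lemma slice_ev l e a b : slice (ev4 l) e a b = cval e l * (l 0 a * l 0 b).
Proof.
rewrite /slice /cval big_distrl; apply: eq_bigr => i _; rewrite big_distrl.
by apply: eq_bigr => j _; rewrite ev4E /= -!mulrA.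
Qed.

Lemma pair4_ev l e e' : pair4 (ev4 l) e e' = cval e l * cval e' l.
Proof.
rewrite pair4_slice /cval big_distrr; apply: eq_bigr => a _; rewrite big_distrr.
by apply: eq_bigr => b _; rewrite slice_ev mulrCA.
Qed.

Lemma slice_linear phi phi' (c : K) e a b :
  slice (c *: phi + phi') e a b = c * slice phi e a b + slice phi' e a b.
Proof.
rewrite /slice big_distrr -big_split; apply: eq_bigr => i _ /=.
rewrite big_distrr -big_split; apply: eq_bigr => j _ /=; rewrite !mxE; ring.
Qed.

Lemma slice_linear_form phi e e' (c : K) a b :
  slice phi (c *: e + e') a b = c * slice phi e a b + slice phi e' a b.
Proof.
rewrite /slice big_distrr -big_split; apply: eq_bigr => i _ /=.
rewrite big_distrr -big_split; apply: eq_bigr => j _ /=; rewrite !mxE; ring.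
Qed.

Definition coef2 e u := \sum_a \sum_b e a b *+ (ix2 a b == u).

Definition fst2 (u : 'I_6) := nth i0 (word_of 2 u) 0.
Definition snd2 (u : 'I_6) := nth i0 (word_of 2 u) 1.

Lemma slice_ix2 phi e a b :
  slice phi e (fst2 (ix2 a b)) (snd2 (ix2 a b)) = slice phi e a b.
Proof.
apply: eq_bigr => i _; apply: eq_bigr => j _; congr (_ * phi 0 _).
congr inord; apply: rank_of_perm; apply/permP => p; rewrite /= /fst2 /snd2 val_ix2.
elim/ord3_ind: a; elim/ord3_ind: b => //=; congr (_ + (_ + _))%N; exact: addnCA.
Qed.

Lemma pair4_coef2 phi e e' :
  pair4 phi e e' = \sum_u coef2 e' u * slice phi e (fst2 u) (snd2 u).
Proof.
rewrite pair4_slice /coef2; under [RHS]eq_bigr => u _ do rewrite big_distrl.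
rewrite [RHS]exchange_big; apply: eq_bigr => a _.
under [RHS]eq_bigr => u _ do rewrite /= big_distrl.
rewrite [RHS]exchange_big; apply: eq_bigr => b _ /=.
rewrite (bigD1 (ix2 a b)) //= eqxx mulr1n slice_ix2 big1 ?addr0 // => u neq.
by rewrite eq_sym (negbTE neq) mul0r.
Qed.

Lemma sum_mxvec m p (A B : 'M[K]_(m, p)) :
  \sum_k mxvec A 0 k * mxvec B 0 k = \sum_i \sum_j A i j * B i j.
Proof.
rewrite pair_big_dep (reindex _ (curry_mxvec_bij _ _)) /=.
by apply: eq_bigr => -[i j] _ /=; rewrite !mxvecE.
Qed.

(** Transpose of the multiplication (u_i) |-> sum r_i u_i from triples of quadrics to quartics. A
    right inverse of this matrix therefore says that every quartic lies in the ideal of the r_i. *)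
Definition slice_mx r : 'M[K]_(15, 3 * 6) :=
  \matrix_c mxvec (\matrix_(i, u) slice (delta_mx 0 c) (r i) (fst2 u) (snd2 u)).

Lemma slice_sum phi e a b :
  slice phi e a b = \sum_c phi 0 c * slice (delta_mx 0 c) e a b.
Proof.
rewrite {1}(row_sum_delta phi).
have -> : slice (\sum_j phi 0 j *: delta_mx 0 j) e a b
  = \sum_j slice (phi 0 j *: delta_mx 0 j) e a b.
  elim/big_rec2: _ => [|j x y _ IH]; last by rewrite -IH -[phi 0 j *: _]scale1r slice_linear mul1r
      scale1r.
  by rewrite /slice big1 // => i _; rewrite big1 // => j _; rewrite mxE mulr0.
apply: eq_bigr => j _; rewrite -[_ *: _]addr0 slice_linear [X in _ + X]big1 ?addr0 // => i _.
by rewrite big1 // => k _; rewrite mxE mulr0.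
Qed.

Lemma mul_slice_mx phi r :
  phi *m slice_mx r = mxvec (\matrix_(i, u) slice phi (r i) (fst2 u) (snd2 u)).
Proof.
apply/rowP => k; case/mxvec_indexP: k => i u; rewrite mxvecE !mxE slice_sum.
by apply: eq_bigr => c _; rewrite !mxE mxvecE mxE.
Qed.

Lemma slice_mx_eq0 phi r : phi *m slice_mx r = 0 ->
  forall i a b, slice phi (r i) a b = 0.
Proof.
rewrite mul_slice_mx => /(canRL mxvecK)/matrixP E i a b.
by have := E i (ix2 a b); rewrite !mxE slice_ix2.
Qed.

Definition fst_pair : 'I_3 -> 'I_3 := tnth [tuple i0; i0; i1].
Definition snd_pair : 'I_3 -> 'I_3 := tnth [tuple i1; i2; i2].

(** The columns are the Koszul syzygies of the r_i, as triples of quadrics: r_j in position i and -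
    r_i in position j, for the pairs i < j. *)
Definition koszul r : 'M[K]_(3 * 6, 3) :=
  \matrix_(x, t) mxvec (\matrix_(i, u) (coef2 (r (snd_pair t)) u *+ (i == fst_pair t)
    - coef2 (r (fst_pair t)) u *+ (i == snd_pair t))) 0 x.

Lemma mul_koszul (A : 'M[K]_(3, 6)) r t :
  (mxvec A *m koszul r) 0 t = \sum_u A (fst_pair t) u * coef2 (r (snd_pair t)) u
    - \sum_u A (snd_pair t) u * coef2 (r (fst_pair t)) u.
Proof.
rewrite mxE; under eq_bigr => x _ do rewrite [koszul _ _ _]mxE.
rewrite sum_mxvec exchange_big -sumrB; apply: eq_bigr => u _ /=.
under eq_bigr => i _ do rewrite mxE mulrBr.
rewrite sumrB; congr (_ - _).
  rewrite (bigD1 (fst_pair t)) //= eqxx mulr1n big1 ?addr0 // => i /negbTE->.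
  by rewrite mulr0n mulr0.
rewrite (bigD1 (snd_pair t)) //= eqxx mulr1n big1 ?addr0 // => i /negbTE->.
by rewrite mulr0n mulr0.
Qed.

Lemma slice_koszul phi q r t :
  (phi *m slice_mx q *m koszul r) 0 t =
  pair4 phi (q (fst_pair t)) (r (snd_pair t)) - pair4 phi (q (snd_pair t)) (r (fst_pair t)).
Proof.
rewrite mul_slice_mx mul_koszul !pair4_coef2.
by congr (_ - _); apply: eq_bigr => u _; rewrite mxE mulrC.
Qed.

Definition minors_mx r q : 'M[K]_(15, 3) := slice_mx q *m koszul r.

Section Operator.
Variables (r q : 'I_3 -> 'M[K]_3) (G : 'M[K]_(3 * 6, 15)).
Hypotheses (rG : slice_mx r *m G = 1%:M) (kr : row_full (koszul r)).

(* Sends [phi] to the functional [phi'] with [phi' (r_i u) = - phi (q_i u)]. It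
   exists when [phi] kills the minors [r_i q_j - r_j q_i], because the Koszul
   syzygies are the only ones between the [r_i]. *)
Definition shift_mx := - (slice_mx q *m G).

Lemma shift_slice phi : phi *m minors_mx r q = 0 ->
  phi *m shift_mx *m slice_mx r = - (phi *m slice_mx q).
Proof.
move=> phi0.
have rK0 : slice_mx r *m koszul r = 0.
  apply/row_matrixP => c; rewrite row0 rowE mulmxA; apply/rowP => t.
  by rewrite slice_koszul pair4C subrr mxE.
(* Exactness by ranks: the kernel has rank 18 - 3 = 15 by [kr], and the image contained in it has
   rank 15 by [rG]. *)
have eqr : (kermx (koszul r) <= slice_mx r)%MS.
  rewrite -(geq_leqif (mxrank_leqif_sup _)); last exact/sub_kermxP.
  rewrite mxrank_ker; move: kr; rewrite /row_full => /eqP->.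
  suff /eqP-> : row_free (slice_mx r) by [].
  by apply/row_freeP; exists G.
have /submxP[phi' E] : (phi *m slice_mx q <= slice_mx r)%MS.
  by apply: submx_trans eqr; apply/sub_kermxP; rewrite -mulmxA.
rewrite /shift_mx mulmxN mulNmx; congr (- _).
by rewrite mulmxA E -[phi' *m _ *m G]mulmxA rG mulmx1.
Qed.

Lemma shift_slicei phi : phi *m minors_mx r q = 0 -> forall i a b,
  slice (phi *m shift_mx) (r i) a b = - slice phi (q i) a b.
Proof.
move=> /shift_slice; rewrite !mul_slice_mx -linearN /= => /(can_inj mxvecK)/matrixP E i a b.
by have := E i (ix2 a b); rewrite !mxE !slice_ix2.
Qed.

Lemma shift_pair phi : phi *m minors_mx r q = 0 -> forall i e,
  pair4 (phi *m shift_mx) (r i) e = - pair4 phi (q i) e.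
Proof.
move=> phi0 i e; rewrite !pair4_slice -sumrN; apply: eq_bigr => a _.
by rewrite -sumrN; apply: eq_bigr => b _; rewrite shift_slicei // mulrN.
Qed.

(** If phi' is the shift of phi, then phi'(q_i r_j - q_j r_i) = - phi(q_i q_j) + phi(q_j q_i) = 0.
    So the shift acts on the functionals that kill the minors. *)
Lemma shift_minors phi : phi *m minors_mx r q = 0 -> phi *m shift_mx *m minors_mx r q = 0.
Proof.
move=> phi0; apply/rowP => t; rewrite mulmxA slice_koszul mxE.
rewrite ![pair4 _ (q _) _]pair4C !shift_pair //.
by rewrite [X in - X - _]pair4C subrr.
Qed.

End Operator.
End Pairing.

(** * Recovering the line from the eigenvalue by cofactors *)

Section CubicMatrix.
Variable R : comNzRingType.
Implicit Types (e : 'I_3 -> 'M[R]_3).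

(* The columns are the cubics [x_a e_i]. If the block of the last nine rows is
   invertible, then [cubic_ker] spans the functionals on cubics that kill them
   (Cramer); evaluation at a common zero [l] of the [e_i] is such a functional, and
   its values on the [x_0^2 x_a] are proportional to [l]. *)
Definition cubic_mx e : 'M[R]_(1 + 9, 3 * 3) :=
  \matrix_c mxvec (\matrix_(i < 3, a < 3) \sum_j \sum_k e i j k *+ (ix3 j k a == c)).

Definition cubic_ker e : 'rV[R]_(1 + 9) :=
  row_mx (\det (dsubmx (cubic_mx e) : 'M_9))%:M
         (- (usubmx (cubic_mx e) *m \adj (dsubmx (cubic_mx e) : 'M_9))).

Lemma cubic_ker00 e : cubic_ker e 0 (ix3 i0 i0 i0) = \det (dsubmx (cubic_mx e) : 'M_9).
Proof.
rewrite (_ : ix3 i0 i0 i0 = lshift 9 (0 : 'I_1)); last by apply: ord_inj; rewrite val_ix3.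
by rewrite [cubic_ker _ _ _]row_mxEl mxE eqxx mulr1n.
Qed.

(** Formed without division, so that it makes sense over a polynomial ring with the eigenvalue as
    variable and commutes with specialisation. *)
Definition line_coord e : 'rV[R]_3 := \row_a cubic_ker e 0 (ix3 i0 i0 a).

End CubicMatrix.

Section Solutions.
Variable K : fieldType.
Implicit Types (phi : 'rV[K]_15) (eta : 'rV[K]_10) (l : 'rV[K]_3).
Implicit Types (e r q : 'I_3 -> 'M[K]_3).

Lemma mul_cubic_mx (eta : 'rV[K]_(1 + 9)) e :
  eta *m cubic_mx e = mxvec (\matrix_(i < 3, a < 3) pair3 eta (e i) a).
Proof.
apply/rowP => x; case/mxvec_indexP: x => i a; rewrite mxvecE !mxE.
under eq_bigr => c _ do rewrite mxE mxvecE mxE mulr_sumr.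
rewrite exchange_big; apply: eq_bigr => j _ /=.
under eq_bigr => c _ do rewrite mulr_sumr.
rewrite exchange_big; apply: eq_bigr => k _ /=.
rewrite (bigD1 (ix3 j k a)) //= eqxx mulr1n mulrC big1 ?addr0 // => c.
by rewrite eq_sym => /negbTE->; rewrite mulr0.
Qed.

(** Splitting off the first coordinate u of y, the relation y M = 0 reads y' N = - u w, with N the
    lower block and w the first row; multiplying by the adjugate of N gives (det N) y'. *)
Lemma cubic_ker_unique e (y : 'rV[K]_(1 + 9)) : (forall i a, pair3 y (e i) a = 0) ->
  \det (dsubmx (cubic_mx e) : 'M_9) *: y = y 0 (ix3 i0 i0 i0) *: cubic_ker e.
Proof.
move=> ye0; have : y *m cubic_mx e = 0.
  rewrite mul_cubic_mx (_ : (\matrix_(i, a) _) = 0) ?linear0 //.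
  by apply/matrixP => i a; rewrite !mxE ye0.
rewrite -[y]hsubmxK -{1}[cubic_mx e]vsubmxK mul_row_col.
set u := lsubmx _; set y' := rsubmx _; set N := dsubmx _; set w := usubmx _ => E.
have E' : y' *m N = - (u *m w) by apply/eqP; rewrite -addr_eq0 addrC E.
have -> : row_mx u y' 0 (ix3 i0 i0 i0) = u 0 0.
  rewrite (_ : ix3 i0 i0 i0 = lshift 9 (0 : 'I_1)); first by rewrite row_mxEl.
  by apply: ord_inj; rewrite val_ix3.
rewrite /cubic_ker -/N -/w !scale_row_mx; congr row_mx.
  by rewrite scale_scalar_mx {1}[u]mx11_scalar scale_scalar_mx mulrC.
have /(congr1 (fun A => A *m \adj N)) := E'.
rewrite -mulmxA mul_mx_adj mul_mx_scalar => ->.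
by rewrite scalerN [in LHS](mx11_scalar u) mulNmx -mulmxA mul_scalar_mx.
Qed.

Lemma pair3_ev l (e : 'M[K]_3) a : pair3 (ev3 l) e a = cval e l * l 0 a.
Proof.
rewrite /pair3 /cval big_distrl; apply: eq_bigr => i _ /=; rewrite big_distrl.
by apply: eq_bigr => j _ /=; rewrite ev3E -!mulrA.
Qed.

Lemma solution_line_coord e l : l != 0 -> (forall i, cval (e i) l = 0) ->
    \det (dsubmx (cubic_mx e) : 'M_9) != 0 ->
  l 0 i0 != 0 /\ line_coord e = (\det (dsubmx (cubic_mx e) : 'M_9) / l 0 i0) *: l.
Proof.
move=> l0 le0 d0.
have /cubic_ker_unique/rowP E : forall i a, pair3 (ev3 l) (e i) a = 0.
  by move=> i a; rewrite pair3_ev le0 mul0r.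
have Eijk i j k := E (ix3 i j k).
(* If l_0 were zero, uniqueness would give d l_i^3 = 0 for every i, with d the nonzero
   determinant. *)
have l00 : l 0 i0 != 0.
  apply: contra_neq l0 => l00; apply/rowP => i; rewrite mxE.
  have := Eijk i i i; rewrite [LHS]mxE [RHS]mxE !ev3E l00 !mul0r => /eqP.
  by rewrite !mulf_eq0 (negbTE d0) !orbb => /eqP.
split=> //; apply/rowP => a; rewrite [LHS]mxE [RHS]mxE.
have := Eijk i0 i0 a; rewrite [LHS]mxE [RHS]mxE !ev3E => E'.
apply: (mulfI (mulf_neq0 (mulf_neq0 l00 l00) l00)); rewrite -E'.
by field.
Qed.

Lemma ix4_perm i j k m i' j' k' m' :
  perm_eq [:: i; j; k; m] [:: i'; j'; k'; m'] -> ix4 i j k m = ix4 i' j' k' m'.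
Proof. by move=> p; congr inord; apply: rank_of_perm. Qed.

(** For each a the functional u |-> phi(u x_a) on cubics kills the x_b e_i, hence is a multiple of
    [cubic_ker e]: d phi(x_i x_j x_k x_a) = w_a c_ijk with w_a = phi(x_0^3 x_a). The left side is
    symmetric in all four indices, which forces w_0^3 phi to be the evaluation at w, and w is
    proportional to the line coordinates. Then phi(e_i x_0^2) = 0 says that e_i vanishes at w. *)
Lemma slice0_line_coord e phi : phi != 0 ->
    (forall i a b, slice phi (e i) a b = 0) -> \det (dsubmx (cubic_mx e) : 'M_9) != 0 ->
  forall i, cval (e i) (line_coord e) = 0.
Proof.
move=> phi0 Ee; set d := \det _ => d0.
pose w : 'rV_3 := \row_a phi 0 (ix4 i0 i0 i0 a).
pose y a : 'rV_10 := \row_c phi 0 (ix4 (nth i0 (word_of 3 c) 0)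
   (nth i0 (word_of 3 c) 1) (nth i0 (word_of 3 c) 2) a).
have yE a i j k : y a 0 (ix3 i j k) = phi 0 (ix4 i j k a).
  rewrite mxE val_ix3; congr (phi 0 _); apply: ix4_perm; apply/permP => p.
  by elim/ord3_ind: i; elim/ord3_ind: j; elim/ord3_ind: k => //=; ring.
have H a i j k : d * phi 0 (ix4 i j k a) = w 0 a * cubic_ker e 0 (ix3 i j k).
  have /cubic_ker_unique/rowP/(_ (ix3 i j k)) : forall i a', pair3 (y a) (e i) a' = 0.
    move=> i' a'; rewrite -[RHS](Ee i' a' a); apply: eq_bigr => j' _.
    by apply: eq_bigr => k' _; rewrite yE.
  by rewrite [LHS]mxE [RHS]mxE !yE !mxE.
set c := cubic_ker e in H; have c0 : c 0 (ix3 i0 i0 i0) = d by rewrite cubic_ker00.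
have phiC i j k m i' j' k' m' : perm_eq [:: i; j; k; m] [:: i'; j'; k'; m'] ->
    w 0 m * c 0 (ix3 i j k) = w 0 m' * c 0 (ix3 i' j' k').
  by move=> p; rewrite -!H (ix4_perm p).
have cs i j k : w 0 i0 * c 0 (ix3 i j k) = w 0 k * c 0 (ix3 i j i0).
  apply: phiC; apply/permP => p /=; ring.
have ci j : w 0 i0 * c 0 (ix3 j i0 i0) = w 0 j * d.
  by rewrite -c0; apply: phiC; apply/permP => p /=; ring.
have cij i j : w 0 i0 * c 0 (ix3 i j i0) = w 0 j * c 0 (ix3 i i0 i0).
  by apply: phiC; apply/permP => p /=; ring.
(* By [ci], w_0 = 0 would make all w_j vanish, and [H] would then give phi = 0. *)
have w0 : w 0 i0 != 0.
  apply: contra_neq phi0 => w0; apply/rowP => x.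
  have wj j : w 0 j = 0.
    by have := ci j; rewrite w0 mul0r => /esym/eqP; rewrite mulf_eq0 (negbTE d0) orbF => /eqP.
  have [i [j [k [m ->]]]] := ix4_surj x.
  by apply: (mulfI d0); rewrite H wj mul0r mxE mulr0.
have wL : w = (w 0 i0 / d) *: line_coord e.
  apply/rowP => a; rewrite [RHS]mxE [line_coord _ _ _]mxE -/c.
  by apply: (mulIf d0); rewrite mulrAC mulrVK ?unitfE // -c0; apply: phiC; apply/permP => p /=;
      ring.
have phiE i j k m : w 0 i0 ^+ 3 * phi 0 (ix4 i j k m) = w 0 i * w 0 j * w 0 k * w 0 m.
  apply: (mulfI d0); rewrite mulrCA H.
  rewrite (_ : _ ^+ 3 * _ = w 0 m * (w 0 i0 * (w 0 i0 * (w 0 i0 * c 0 (ix3 i j k))))); last by ring.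
  rewrite cs [w 0 i0 * (w 0 k * _)]mulrCA cij.
  rewrite (_ : w 0 m * _ = w 0 m * w 0 k * w 0 j * (w 0 i0 * c 0 (ix3 i i0 i0))); last by ring.
  by rewrite ci; ring.
move=> i.
have : cval (e i) w = 0.
  apply: (mulIf (mulf_neq0 w0 w0)); rewrite mul0r.
  have -> : cval (e i) w * (w 0 i0 * w 0 i0) = w 0 i0 ^+ 3 * slice phi (e i) i0 i0.
    rewrite -slice_ev /slice mulr_sumr; apply: eq_bigr => j _; rewrite mulr_sumr.
    by apply: eq_bigr => k _; rewrite mulrCA phiE ev4E.
  by rewrite Ee mulr0.
rewrite wL => /eqP; rewrite (_ : cval _ _ = (w 0 i0 / d) ^+ 2 * cval (e i) (line_coord e)).
  by rewrite mulf_eq0 expf_eq0 /= mulf_eq0 invr_eq0 (negbTE w0) (negbTE d0) => /eqP.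
rewrite /cval mulr_sumr; apply: eq_bigr => j _; rewrite mulr_sumr.
by apply: eq_bigr => k _ /=; rewrite [X in _ * (X * _)]mxE [X in _ * (_ * X)]mxE; ring.
Qed.

Section Eigen.
Variables (r q : 'I_3 -> 'M[K]_3) (G : 'M[K]_(3 * 6, 15)) (J : 'M[K]_(15, 12)).

(** [J] completes the three minors to a basis of the quartics; the last twelve rows of the inverse
    are the basis, dual to [J], of the functionals that kill the minors. In this form the basis is
    rational in the data, and [shift12] is the matrix of the shift in it. *)
Definition minors_basis : 'M[K]_(12, 15) :=
  dsubmx (invmx (row_mx (minors_mx r q) J : 'M_(3 + 12)) : 'M_(3 + 12, 15)).

Definition shift12 : 'M[K]_12 := minors_basis *m shift_mx q G *m J.

Hypotheses (rG : slice_mx r *m G = 1%:M) (kr : row_full (koszul r)).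
Hypothesis (uJ : (row_mx (minors_mx r q) J : 'M_(3 + 12)) \in unitmx).

Let basis_block : block_mx (usubmx (invmx (row_mx (minors_mx r q) J : 'M_(3 + 12)))
    *m minors_mx r q) (usubmx (invmx (row_mx (minors_mx r q) J : 'M_(3 + 12))) *m J)
    (minors_basis *m minors_mx r q) (minors_basis *m J) = block_mx 1%:M 0 0 1%:M.
Proof. by rewrite -mul_col_row vsubmxK mulVmx // -scalar_mx_block. Qed.

Lemma minors_basis0 : minors_basis *m minors_mx r q = 0.
Proof. by have [_ _ -> _] := eq_block_mx basis_block. Qed.

Lemma minors_basisK : minors_basis *m J = 1%:M.
Proof. by have [_ _ _ ->] := eq_block_mx basis_block. Qed.

Lemma minors_coordK phi : phi *m minors_mx r q = 0 -> phi *m J *m minors_basis = phi.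
Proof.
move=> phi0; rewrite -[RHS](mulmxK uJ phi) mul_mx_row phi0 /minors_basis.
by rewrite -[X in _ = _ *m X]vsubmxK mul_row_col mul0mx add0r.
Qed.

(** At a solution q_i(l) = - a r_i(l). Hence evaluation at l kills the minors, and its shift, which
    takes the value - q_i(l) u(l) on r_i u, is a times the evaluation. *)
Lemma solution_root a l : l != 0 ->
    (forall i, a * cval (r i) l + cval (q i) l = 0) -> root (char_poly shift12) a.
Proof.
move=> l0 le0.
have qE i : cval (q i) l = - a * cval (r i) l.
  by apply/eqP; rewrite mulNr -addr_eq0 addrC le0.
have ev0 : ev4 l != 0.
  apply: contra_neq l0 => /rowP E; apply/rowP => i.
  by have := E (ix4 i i i i); rewrite ev4E !mxE => /eqP; rewrite !mulf_eq0 !orbb => /eqP.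
have evm : ev4 l *m minors_mx r q = 0.
  apply/rowP => t; rewrite mulmxA slice_koszul !pair4_ev !qE mxE; ring.
have evX : ev4 l *m shift_mx q G = a *: ev4 l.
  rewrite /shift_mx mulmxN mulmxA -[in RHS](mulmx1 (ev4 l)) -rG mulmxA scalemxAl -mulNmx.
  congr (_ *m _); rewrite !mul_slice_mx -linearZ -linearN /=; congr mxvec.
  by apply/matrixP => i u; rewrite !mxE !slice_ev qE; ring.
rewrite -eigenvalue_root_char; apply/eigenvalueP; exists (ev4 l *m J).
  by rewrite /shift12 !mulmxA minors_coordK // evX -scalemxAl.
by apply: contra_neq ev0 => E; rewrite -(minors_coordK evm) E mul0mx.
Qed.

(** An eigenvector is a nonzero functional phi on quartics with a phi(r_i u) = - phi(q_i u), that
    is, one that kills all multiples of the a r_i + q_i; the previous analysis shows that it is an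
    evaluation up to a scalar. *)
Lemma root_solution a (e := fun i => a *: r i + q i) : root (char_poly shift12) a ->
    \det (dsubmx (cubic_mx e) : 'M_9) != 0 ->
  forall i, cval (e i) (line_coord e) = 0.
Proof.
rewrite -eigenvalue_root_char => /eigenvalueP[u uX u0] d0.
have phim : u *m minors_basis *m minors_mx r q = 0 by rewrite -mulmxA minors_basis0 mulmx0.
have phi0 : u *m minors_basis != 0.
  by apply: contra_neq u0 => E; rewrite -[u]mulmx1 -minors_basisK mulmxA E mul0mx.
apply: slice0_line_coord phi0 _ d0 => i b c.
have phiX : u *m minors_basis *m shift_mx q G = a *: (u *m minors_basis).
  rewrite -(minors_coordK (shift_minors rG kr phim)) -!mulmxA.
  by rewrite [minors_basis *m (_ *m (_ *m _))]mulmxA mulmxA mulmxA -/shift12 scalemxAl -uX /shift12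
      !mulmxA.
have := shift_slicei rG kr phim i b c; rewrite phiX.
rewrite -[a *: _]addr0 slice_linear /e slice_linear_form => E.
rewrite -[X in X + _]addr0 -[X in _ + X + _](_ : slice 0 (r i) b c = 0) ?E ?addNr //.
by rewrite /slice big1 // => j _; rewrite big1 // => k _; rewrite mxE mulr0.
Qed.

End Eigen.
End Solutions.

(** * Polar forms and lines *)

Section Polar.
Variable K : numFieldType.
Implicit Types (F G : {mpoly K[3]}) (p q r : 'rV[K]_3).

(** One over the number of distinct orderings of the word i j k, so that each monomial coefficient
    is spread evenly over a symmetric tensor. *)
Definition polar_weight (i j k : 'I_3) : K :=
  if (i == j) && (j == k) then 1
  else if [|| i == j, j == k | i == k] then 3^-1 else 6^-1.

(* The symmetric tensor with [F(p) = \sum_(i, j, k) (tensor F) i j k * p_i * p_j * p_k]. *)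
Definition tensor F i j k : K := polar_weight i j k * F@_(U_(i) + U_(j) + U_(k)).

Definition polar F p q r := \sum_i \sum_j \sum_k tensor F i j k * (p 0 i * q 0 j * r 0 k).

Lemma mnm3P (m m' : 'X_{1..3}) :
  (m == m') = [&& m i0 == m' i0, m i1 == m' i1 & m i2 == m' i2].
Proof.
apply/eqP/and3P => [->|[/eqP m0 /eqP m1 /eqP m2]]; first by split.
by apply/mnmP; elim/ord3_ind.
Qed.

Lemma sum_polar_weight (m : 'X_{1..3}) : mdeg m = 3 ->
  \sum_i \sum_j \sum_k polar_weight i j k * (m == U_(i) + U_(j) + U_(k))%MM%:R = 1 :> K.
Proof.
have n6 : (6 : K) != 0 by rewrite (Num.Theory.pnatr_eq0 _ 6).
have n3 : (3 : K) != 0 by rewrite (Num.Theory.pnatr_eq0 _ 3).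
rewrite mdegE !sum3 /polar_weight !mnm3P !mnmDE !mnm1E /=.
case: (m i0) => [|[|[|[|?]]]]; case: (m i1) => [|[|[|[|?]]]];
  case: (m i2) => [|[|[|[|?]]]] //= _; rewrite ?(mulr0, mulr1, addr0, add0r) //; by field.
Qed.

Lemma tensor_expand F : F \is 3.-homog ->
  F = \sum_i \sum_j \sum_k (tensor F i j k)%:MP * ('X_i * 'X_j * 'X_k).
Proof.
move=> homF; apply/mpolyP => m.
have -> : (\sum_i \sum_j \sum_k (tensor F i j k)%:MP * ('X_i * 'X_j * 'X_k))@_m =
   F@_m * \sum_i \sum_j \sum_k polar_weight i j k * (m == U_(i) + U_(j) + U_(k))%MM%:R.
  rewrite mulr_sumr linear_sum; apply: eq_bigr => i _; rewrite mulr_sumr linear_sum /=.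
  apply: eq_bigr => j _; rewrite mulr_sumr linear_sum /=; apply: eq_bigr => k _.
  rewrite mcoeffCM -!mpolyXD mcoeffX eq_sym /tensor.
  by case: eqP => [->|_]; rewrite ?mulr0 // !mulr1 mulrC.
have [m3|m3] := eqVneq (mdeg m) 3%N; first by rewrite sum_polar_weight ?mulr1.
by rewrite (dhomog_nemf_coeff homF m3) mul0r.
Qed.

End Polar.

Section Polar.
Variable K : numFieldType.
Implicit Types (F G : {mpoly K[3]}) (p q r : 'rV[K]_3).

Let sum3D (V : nmodType) (f g : 'I_3 -> 'I_3 -> 'I_3 -> V) :
  \sum_i \sum_j \sum_k f i j k + \sum_i \sum_j \sum_k g i j k =
  \sum_i \sum_j \sum_k (f i j k + g i j k).
Proof.
rewrite -big_split; apply: eq_bigr => i _; rewrite -big_split; apply: eq_bigr => j _.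
by rewrite -big_split.
Qed.

Lemma tensorC12 F i j k : tensor F i j k = tensor F j i k.
Proof.
rewrite /tensor [(U_(i) + U_(j))%MM]addmC; congr (_ * _).
by elim/ord3_ind: i; elim/ord3_ind: j; elim/ord3_ind: k.
Qed.

Lemma tensorC23 F i j k : tensor F i j k = tensor F i k j.
Proof.
rewrite /tensor -!addmA [(U_(j) + U_(k))%MM]addmC; congr (_ * _).
by elim/ord3_ind: i; elim/ord3_ind: j; elim/ord3_ind: k.
Qed.

Lemma tensor_linear F G c i j k : tensor (c *: F + G) i j k = c * tensor F i j k + tensor G i j k.
Proof. by rewrite /tensor mcoeffD mcoeffZ; ring. Qed.

Lemma polarC12 F p q r : polar F p q r = polar F q p r.
Proof.
rewrite /polar exchange_big; do 3!(apply: eq_bigr => ? _) => /=.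
by rewrite tensorC12 [p 0 _ * q 0 _]mulrC.
Qed.

Lemma polarC23 F p q r : polar F p q r = polar F p r q.
Proof.
rewrite /polar; apply: eq_bigr => i _; rewrite exchange_big /=.
apply: eq_bigr => j _; apply: eq_bigr => k _; rewrite tensorC23; ring.
Qed.

Lemma polar_linear F p q r r' c :
  polar F p q (c *: r + r') = c * polar F p q r + polar F p q r'.
Proof.
rewrite /polar mulr_sumr -big_split /=; apply: eq_bigr => i _.
rewrite mulr_sumr -big_split /=; apply: eq_bigr => j _.
rewrite mulr_sumr -big_split /=; apply: eq_bigr => k _.
rewrite !mxE; ring.
Qed.

Lemma polar_linear_form F G p q r c :
  polar (c *: F + G) p q r = c * polar F p q r + polar G p q r.
Proof.
rewrite /polar mulr_sumr -big_split /=; apply: eq_bigr => i _.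
rewrite mulr_sumr -big_split /=; apply: eq_bigr => j _.
rewrite mulr_sumr -big_split /=; apply: eq_bigr => k _.
rewrite tensor_linear; ring.
Qed.

Lemma polarZ F p q r c : polar F p q (c *: r) = c * polar F p q r.
Proof.
rewrite -[c *: r]addr0 polar_linear [X in _ + X](_ : _ = 0) ?addr0 //.
by rewrite /polar; do 3!(rewrite big1 // => ? _); rewrite mxE !mulr0.
Qed.

Lemma polar0 F p q : polar F p q 0 = 0.
Proof. by rewrite -(scale0r 0) polarZ mul0r. Qed.

Lemma polar0_form p q r : polar 0 p q r = 0.
Proof.
by rewrite /polar; do 3!(rewrite big1 // => ? _); rewrite /tensor mcoeff0 mulr0 mul0r.
Qed.

Lemma polarZ_form F p q r c : polar (c *: F) p q r = c * polar F p q r.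
Proof. by rewrite -[c *: F]addr0 polar_linear_form polar0_form addr0. Qed.

Lemma meval_polar F p : F \is 3.-homog -> F.@[p 0] = polar F p p p.
Proof.
move=> /tensor_expand {1}->; rewrite /polar.
do 3!(rewrite raddf_sum /=; apply: eq_bigr => ? _).
by rewrite !mevalM mevalC !mevalXU.
Qed.

Lemma mderiv_polar F p i : F \is 3.-homog ->
  (F^`M(i)).@[p 0] = 3 * polar F p p (delta_mx 0 i).
Proof.
move=> homF; rewrite {1}(tensor_expand homF).
have dX j : ('X_j : {mpoly K[3]})^`M(i) = (i == j)%:R%:MP.
  rewrite mderivX mnm1E eq_sym; case: eqP => [->|_]; last by rewrite scale0r mpolyC0.
  rewrite scale1r (_ : (U_(j) - U_(j))%MM = 0%MM) ?mpolyX0 ?mpolyC1 //.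
  by apply/mnmP => k; rewrite mnmBE subnn mnm0E.
transitivity (polar F p p (delta_mx 0 i) + polar F p (delta_mx 0 i) p + polar F (delta_mx 0 i) p
    p); last first.
  by rewrite [polar F _ p p]polarC12 ![polar F p (delta_mx 0 i) p]polarC23; ring.
rewrite /polar -!big_split (raddf_sum (mderiv i)) raddf_sum /=; apply: eq_bigr => j _.
rewrite -!big_split (raddf_sum (mderiv i)) raddf_sum /=; apply: eq_bigr => k _.
rewrite -!big_split (raddf_sum (mderiv i)) raddf_sum /=; apply: eq_bigr => m _.
rewrite !mderivM mderivC !dX !(mevalM, mevalD, mevalC, mevalXU, meval0).
rewrite !mxE !eqxx /= ![i == _]eq_sym; ring.
Qed.

Lemma restrict_line_polar F p q : F \is 3.-homog ->
  restrict_line F p q = (polar F p p p)%:P + (3 * polar F p p q) *: 'X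
     + (3 * polar F p q q) *: 'X^2 + (polar F q q q) *: 'X^3.
Proof.
move=> homF; rewrite /restrict_line {1}(tensor_expand homF).
transitivity ((polar F p p p)%:P + (polar F p p q + polar F p q p + polar F q p p)%:P * 'X
     + (polar F p q q + polar F q p q + polar F q q p)%:P * 'X^2 + (polar F q q q)%:P * 'X^3); last
         first.
  rewrite -!mul_polyC [polar F q p p]polarC12 ![polar F p q p]polarC23.
  rewrite [polar F q q p]polarC23 [polar F q p q]polarC12.
  by congr (_ + _%:P * _ + _%:P * _ + _); ring.
have pull (f : 'I_3 -> 'I_3 -> 'I_3 -> K) x :
    (\sum_i \sum_j \sum_k f i j k)%:P * x = \sum_i \sum_j \sum_k (f i j k)%:P * x.
  rewrite rmorph_sum mulr_suml; apply: eq_bigr => i _ /=.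
  rewrite rmorph_sum mulr_suml; apply: eq_bigr => j _ /=.
  by rewrite rmorph_sum mulr_suml.
rewrite -[(polar F p p p)%:P]mulr1 /polar !sum3D !pull !sum3D raddf_sum /=.
apply: eq_bigr => i _; rewrite raddf_sum; apply: eq_bigr => j _.
rewrite raddf_sum; apply: eq_bigr => k _ /=.
move: (tensor F i j k) => c; rewrite !(rmorphM (mmap _ _)) /= mmapC !mmapX !mmap1U -!mul_polyC.
rewrite !(polyCM, polyCD) mulr1; ring.
Qed.

End Polar.

(** * Lines as kernels of linear forms *)

Section Lines.
Variable K : fieldType.
Implicit Types (l p q x : 'rV[K]_3) (L : {vspace 'rV[K]_3}).

Definition dot l x := \sum_i l 0 i * x 0 i.

Definition line_of l : {vspace 'rV[K]_3} := lker (linfun (mulmxr l^T : 'rV_3 -> 'rV_1)).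

Lemma mem_line_of l x : (x \in line_of l) = (dot l x == 0).
Proof.
rewrite memv_ker lfunE /=; apply/eqP/eqP => [/rowP/(_ 0)|E].
  by rewrite !mxE => <-; apply: eq_bigr => i _; rewrite mxE mulrC.
apply/rowP => i; rewrite ord1 !mxE -[RHS]E; apply: eq_bigr => j _.
by rewrite mxE mulrC.
Qed.

Lemma dotC l x : dot l x = dot x l.
Proof. by apply: eq_bigr => i _; rewrite mulrC. Qed.

Lemma dotZ c l x : dot (c *: l) x = c * dot l x.
Proof. by rewrite /dot mulr_sumr; apply: eq_bigr => i _; rewrite mxE mulrA. Qed.

Lemma line_ofZ c l : c != 0 -> line_of (c *: l) = line_of l.
Proof.
move=> c0; apply/vspaceP => x; rewrite !mem_line_of dotZ.
by rewrite mulf_eq0 (negbTE c0).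
Qed.

Lemma dim_line_of l : l != 0 -> \dim (line_of l) = 2%N.
Proof.
move=> l0; pose f : 'Hom('rV[K]_3, 'rV[K]_1) := linfun (mulmxr l^T).
suff f1 : \dim (limg f) = 1%N.
  have := limg_ker_dim f fullv; rewrite capfv f1 dimvf addn1.
  by move=> E; apply/succn_inj; rewrite E.
apply/eqP; rewrite eqn_leq; apply/andP; split.
  by apply: leq_trans (dimvS (subvf _)) _; rewrite dimvf.
rewrite lt0n dimv_eq0; apply: contra_neq l0 => E; apply/rowP => i.
have : f (delta_mx 0 i) \in limg f by exact/memv_img/memvf.
rewrite E memv0 lfunE /= => /eqP/rowP/(_ 0); rewrite -rowE !mxE => ->.
by [].
Qed.

(** Indices are added modulo 3. *)
Definition cross p q : 'rV[K]_3 :=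
  \row_i (p 0 (i + 1) * q 0 (i + 2) - p 0 (i + 2) * q 0 (i + 1)).

Lemma dot_cross p q x : dot (cross p q) x =
  p 0 i1 * q 0 i2 * x 0 i0 - p 0 i2 * q 0 i1 * x 0 i0 + p 0 i2 * q 0 i0 * x 0 i1
  - p 0 i0 * q 0 i2 * x 0 i1 + p 0 i0 * q 0 i1 * x 0 i2 - p 0 i1 * q 0 i0 * x 0 i2.
Proof.
rewrite /dot sum3 !mxE.
have -> : i0 + 1 = i1 :> 'I_3 by apply: ord_inj.
have -> : i1 + 1 = i2 :> 'I_3 by apply: ord_inj.
have -> : i2 + 1 = i0 :> 'I_3 by apply: ord_inj.
have -> : i0 + 2 = i2 :> 'I_3 by apply: ord_inj.
have -> : i1 + 2 = i0 :> 'I_3 by apply: ord_inj.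
have -> : i2 + 2 = i1 :> 'I_3 by apply: ord_inj.
ring.
Qed.

Lemma cross_eq0 p q : cross p q = 0 -> p != 0 -> exists c, q = c *: p.
Proof.
move=> E p0.
have [i pi0] : exists i, p 0 i != 0.
  apply/existsP; apply: contra_neqT p0 => /existsPn E'; apply/rowP => i.
  by apply/eqP; rewrite mxE -[_ == _]negbK E'.
have pq (j k : 'I_3) : p 0 j * q 0 k = p 0 k * q 0 j.
  have dE x : dot (cross p q) x = 0 by rewrite E /dot big1 // => m _; rewrite mxE mul0r.
  have := dE (delta_mx 0 i0); have := dE (delta_mx 0 i1); have := dE (delta_mx 0 i2).
  rewrite !dot_cross !mxE /= !(oppr0, mulr0, mulr1, subr0, add0r, addr0) => /eqP E2 /eqP E1 /eqP E0.
  move: E0 E1 E2; rewrite !subr_eq0 => /eqP E0 /eqP E1 /eqP E2.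
  by elim/ord3_ind: j; elim/ord3_ind: k; rewrite ?E0 ?E1 ?E2.
exists (q 0 i / p 0 i); apply/rowP => k; rewrite mxE.
by apply: (mulfI pi0); rewrite pq mulrA mulrCA mulfV // mulr1 mulrC.
Qed.

Lemma line_of_span p q : \dim (<[p]> + <[q]>) = 2%N ->
  (<[p]> + <[q]>)%VS = line_of (cross p q) /\ cross p q != 0.
Proof.
move=> d2.
have l0 : cross p q != 0.
  have [p0|p0] := eqVneq p 0.
    have z : <[0]>%VS = 0%VS :> {vspace 'rV[K]_3}.
      by apply/eqP; rewrite -subv0 -memvE memv0.
    by move: d2; rewrite p0 z add0v dim_vline; case: eqP.
  apply/eqP => /cross_eq0 /(_ p0)[c qE].
  have : (<[p]> + <[q]> <= <[p]>)%VS.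
    by rewrite subv_add subvv qE -memvE memvZ ?memv_line.
  by move/dimvS; rewrite d2 dim_vline; case: eqP.
split=> //; apply/eqP; rewrite eqEdim d2 dim_line_of // leqnn andbT subv_add -!memvE !mem_line_of.
by apply/andP; split; rewrite dot_cross; apply/eqP; ring.
Qed.

(** For every x the vector l x x (cross product) lies on the first line, hence on the second; and l'
    . (l x x) = - (l x l') . x, so the cross product of l and l' is zero. *)
Lemma line_of_inj l l' : l != 0 -> l' != 0 -> line_of l = line_of l' ->
  exists2 c, c != 0 & l' = c *: l.
Proof.
move=> l0 l0' E.
have [|c l'E] := @cross_eq0 l l' _ l0; last first.
  by exists c => //; apply: contra_neq l0' => c0; rewrite l'E c0 scale0r.
have dl' x : dot (cross l x) l = 0 by rewrite dot_cross; ring.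
have H x : dot l' (cross l x) = 0.
  by apply/eqP; rewrite -mem_line_of -E mem_line_of dotC dl'.
apply/rowP => i; rewrite [RHS]mxE; have := H (delta_mx 0 i).
have -> : dot l' (cross l (delta_mx 0 i)) = - dot (cross l l') (delta_mx 0 i).
  by rewrite dotC !dot_cross; ring.
move/eqP; rewrite oppr_eq0 /dot (bigD1 i) //= [delta_mx _ _ _ _]mxE !eqxx mulr1 big1 ?addr0.
  by move/eqP.
by move=> j /negbTE ji; rewrite [delta_mx _ _ _ _]mxE ji andbF mulr0.
Qed.

End Lines.

(** * Common flex lines as solutions *)

Section Contraction.
Variable R : comNzRingType.

Definition contraction (T : 'I_3 -> 'I_3 -> 'I_3 -> R) : 'M[R]_(6, 3) :=
  \matrix_(n, k) \sum_i \sum_j T i j k *+ (ix2 i j == n).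

Definition contraction2 T T' : 'M[R]_(3 + 3) := row_mx (contraction T) (contraction T').

(** For q = l D, a symmetric tensor linear in l, the i-th coordinate of q l is a quadratic form in
    l. This is a matrix of that form, not symmetric in general. *)
Definition conic_of (D : 'M[R]_(3, 6)) (i : 'I_3) : 'M[R]_3 := \matrix_(j, k) D k (ix2 i j).

Lemma mul_contraction (y : 'rV[R]_6) T k :
  (y *m contraction T) 0 k = \sum_i \sum_j y 0 (ix2 i j) * T i j k.
Proof.
rewrite mxE; under eq_bigr => n _ do rewrite mxE mulr_sumr.
rewrite exchange_big; apply: eq_bigr => i _ /=.
under eq_bigr => n _ do rewrite mulr_sumr.
rewrite exchange_big; apply: eq_bigr => j _ /=.
rewrite (bigD1 (ix2 i j)) //= eqxx mulr1n big1 ?addr0 // => n.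
by rewrite eq_sym => /negbTE->; rewrite mulr0.
Qed.

End Contraction.

Section Geometry.
Variable K : numFieldType.
Implicit Types (l p q x : 'rV[K]_3) (L : {vspace 'rV[K]_3}) (F G : cubic_form K).

Lemma cubic_homog F : (F : {mpoly K[3]}) \is 3.-homog.
Proof. exact: dhomog_is_dhomog. Qed.

Definition sym_vec p q : 'rV[K]_6 :=
  \row_n (p 0 (fst2 n) * q 0 (snd2 n) + p 0 (snd2 n) * q 0 (fst2 n)).

Lemma sym_vecE p q i j : sym_vec p q 0 (ix2 i j) = p 0 i * q 0 j + p 0 j * q 0 i.
Proof.
rewrite mxE /fst2 /snd2 val_ix2.
by elim/ord3_ind: i; elim/ord3_ind: j => //=; rewrite addrC.
Qed.

Lemma sym_vec_contraction (F : {mpoly K[3]}) p q k :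
  (sym_vec p q *m contraction (tensor F)) 0 k = 2 * polar F p q (delta_mx 0 k).
Proof.
rewrite mul_contraction.
transitivity (polar F p q (delta_mx 0 k) + polar F q p (delta_mx 0 k)); last first.
  by rewrite [polar F q p _]polarC12; ring.
have E p' q' : polar F p' q' (delta_mx 0 k) = \sum_i \sum_j p' 0 i * q' 0 j * tensor F i j k.
  apply: eq_bigr => i _; apply: eq_bigr => j _; rewrite (bigD1 k) //= mxE !eqxx /=.
  by rewrite big1 ?addr0 ?mulr1 1?mulrC // => m /negbTE mk; rewrite mxE mk !mulr0.
rewrite !E -big_split; apply: eq_bigr => i _; rewrite -big_split; apply: eq_bigr => j _.
by rewrite sym_vecE /=; ring.
Qed.

Lemma sym_vec_neq0 p q : p != 0 -> q != 0 -> sym_vec p q != 0.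
Proof.
move=> p0 q0; apply: contraNneq p0 => E; apply/eqP.
have H i j : p 0 i * q 0 j + p 0 j * q 0 i = 0 by rewrite -sym_vecE E mxE.
have [i qi0] : exists i, q 0 i != 0.
  apply/existsP; apply: contra_neqT q0 => /existsPn E'; apply/rowP => i.
  by apply/eqP; rewrite mxE -[_ == _]negbK E'.
have pi0 : p 0 i = 0.
  apply/eqP; have /eqP := H i i; rewrite -mulr2n -mulr_natl mulf_eq0 Num.Theory.pnatr_eq0 /=.
  by rewrite mulf_eq0 (negbTE qi0) orbF.
apply/rowP => j; apply: (mulIf qi0); have := H j i.
by rewrite pi0 !mul0r addr0 mxE mul0r.
Qed.

Lemma polar_line (F : {mpoly K[3]}) p q l :
    l != 0 -> (forall x, x \in line_of l -> polar F p q x = 0) ->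
  exists a, forall k, polar F p q (delta_mx 0 k) = a * l 0 k.
Proof.
move=> l0 H.
have [i li0] : exists i, l 0 i != 0.
  apply/existsP; apply: contra_neqT l0 => /existsPn E'; apply/rowP => i.
  by apply/eqP; rewrite mxE -[_ == _]negbK E'.
exists (polar F p q (delta_mx 0 i) / l 0 i) => k.
(* The vector l_i e_k - l_k e_i lies on the line; evaluating there compares the k-th coordinate with
   the i-th. *)
have := H (- l 0 k *: delta_mx 0 i + l 0 i *: delta_mx 0 k).
rewrite polar_linear polarZ mem_line_of => E.
set P := polar F p q _ in E *.
apply: (mulfI li0); have -> : l 0 i * (P / l 0 i * l 0 k) = P * l 0 k by field.
have dl j : dot l (delta_mx 0 j) = l 0 j.
  rewrite /dot (bigD1 j) //= mxE !eqxx mulr1 big1 ?addr0 // => m /negbTE mj.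
  by rewrite mxE mj andbF mulr0.
have {}E : - l 0 k * P + l 0 i * polar F p q (delta_mx 0 k) = 0.
  apply: E; have -> : dot l (- l 0 k *: delta_mx 0 i + l 0 i *: delta_mx 0 k)
      = - l 0 k * dot l (delta_mx 0 i) + l 0 i * dot l (delta_mx 0 k).
    rewrite /dot !mulr_sumr -big_split; apply: eq_bigr => j _ /=.
    by rewrite [X in _ * X]mxE [X in _ * (X + _)]mxE [X in _ * (_ + X)]mxE; ring.
  by rewrite !dl; apply/eqP; ring.
apply/eqP; rewrite -subr_eq0; apply/eqP; rewrite -[RHS]E; ring.
Qed.

(** The coefficients of 1, t and t^2 in F(p + t q) are F(p, p, p), 3 F(p, p, q) and 3 F(p, q, q).
    Their vanishing says that the polar conic of p contains the whole line. *)
Lemma flex_polar F L : flex_tangent_line F L -> exists p,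
  [/\ p != 0, exists q, L = (<[p]> + <[q]>)%VS & forall x y, x \in L -> y \in L -> polar F p x y =
      0].
Proof.
move=> [_ [p [p0 _ _ [q [LE /dvdpP[h hE]]]]]]; exists p; split; [by []|by exists q|].
move: hE; rewrite restrict_line_polar ?cubic_homog // => hE.
have n3 : (3 : K) != 0 by rewrite (Num.Theory.pnatr_eq0 _ 3).
have E0 : polar F p p p = 0.
  by have := congr1 (coefp 0) hE; rewrite /= coefMXn !(coefD, coefC, coefZ, coefX, coefXn) /=
      !mulr0 !addr0.
have E1 : polar F p p q = 0.
  have := congr1 (coefp 1) hE; rewrite /= coefMXn !(coefD, coefC, coefZ, coefX, coefXn) /=.
  by rewrite !mulr0 !addr0 add0r mulr1 => /eqP; rewrite mulf_eq0 (negbTE n3) => /eqP.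
have E2 : polar F p q q = 0.
  have := congr1 (coefp 2) hE; rewrite /= coefMXn !(coefD, coefC, coefZ, coefX, coefXn) /=.
  by rewrite !mulr0 !addr0 !add0r mulr1 => /eqP; rewrite mulf_eq0 (negbTE n3) => /eqP.
move=> x y; rewrite LE => /memv_addP[_ /vlineP[a ->] [_ /vlineP[b ->] ->]].
move=> /memv_addP[_ /vlineP[c ->] [_ /vlineP[d ->] ->]].
rewrite polar_linear polarZ ![polar _ _ (_ + _) _]polarC23 !polar_linear !polarZ.
by rewrite [polar F p q p]polarC23 E0 E1 E2 !mulr0 addr0 !mulr0 addr0.
Qed.

Lemma pencil_span (W : {vspace cubic_form K}) (F1 F2 : cubic_form K) : \dim W = 2%N ->
    F1 \in W -> F1 != 0 -> F2 \in W -> F2 != 0 -> <[F1]>%VS != <[F2]>%VS ->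
  forall F, F \in W -> exists a b, F = a *: F1 + b *: F2.
Proof.
move=> dW W1 F10 W2 F20 neq.
have sub : (<[F1]> + <[F2]> <= W)%VS by rewrite subv_add -!memvE W1.
have WE : W = (<[F1]> + <[F2]>)%VS.
  apply/esym/eqP; rewrite eqEdim sub dW ltnNge; apply: contraNN neq => d1.
  rewrite eqEdim !dim_vline F10 F20 andbT.
  have : (<[F2]> == <[F1]> + <[F2]>)%VS by rewrite eqEdim addvSr dim_vline F20.
  by move/eqP => ->; rewrite addvSl.
move=> F; rewrite WE => /memv_addP[_ /vlineP[a ->] [_ /vlineP[b ->] ->]].
by exists a, b.
Qed.

(** The polar conic of p1 for F1 and that of p2 for F2 both contain L, so H(p1, p2, x) = 0 on L for
    every combination H of F1 and F2. Thus F and G contract the product of p1 and p2 to multiples of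
    l, and inverting the contraction gives q. *)
Lemma common_flex_conics (W : {vspace cubic_form K}) F G L
    (D := invmx (contraction2 (tensor F) (tensor G)) : 'M_(3 + 3, 6)) :
    \dim W = 2%N -> F \in W -> G \in W ->
    contraction2 (tensor F) (tensor G) \in unitmx -> common_flex_line W L ->
  exists l a b, [/\ l != 0, (a, b) != (0, 0), L = line_of l & forall i,
    a * cval (conic_of (usubmx D) i) l + b * cval (conic_of (dsubmx D) i) l = 0].
Proof.
move=> dW FW GW uC [F1 [F2 [[W1 F10] [W2 F20] neq fl1 fl2]]].
have [dL _] := fl1.
have [p1 [p10 [q LE] H1]] := flex_polar fl1; have [p2 [p20 [q2 LE2] H2]] := flex_polar fl2.
have [LE' l0] := line_of_span (etrans (congr1 (fun V : {vspace _} => \dim V) (esym LE)) dL).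
set l := cross p1 q in LE' l0; rewrite -LE in LE'.
have p1L : p1 \in L by rewrite LE memvE addvSl.
have p2L : p2 \in L by rewrite LE2 memvE addvSl.
have van (H : cubic_form K) : H \in W -> exists a, forall k, polar H p1 p2 (delta_mx 0 k) = a * l 0
    k.
  move=> /(pencil_span dW W1 F10 W2 F20 neq)[a [b ->]]; apply: polar_line => // x.
  rewrite -LE' => xL; rewrite /= polar_linear_form H1 // mulr0 add0r.
  by rewrite polarZ_form [polar F2 _ _ _]polarC12 H2 // mulr0.
have [a aE] := van F FW; have [b bE] := van G GW.
have yE : sym_vec p1 p2 = row_mx (2 * a *: l) (2 * b *: l) *m D.
  rewrite -[LHS](mulmxK uC) -/D; congr (_ *m _); rewrite /contraction2 mul_mx_row.
  by congr row_mx; apply/rowP => k; rewrite sym_vec_contraction mxE ?aE ?bE mulrA.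
exists l, a, b; split=> //.
  apply: contraNneq (sym_vec_neq0 p10 p20) => -[a0 b0].
  by rewrite yE a0 b0 !mulr0 !scale0r row_mx0 mul0mx.
move=> i.
have n2 : (2 : K) != 0 by rewrite (Num.Theory.pnatr_eq0 _ 2).
apply: (mulfI n2); rewrite mulr0.
have dl p : p \in L -> \sum_j p 0 j * l 0 j = 0.
  by rewrite LE' mem_line_of dotC => /eqP.
(* The i-th coordinate of q l vanishes because both points lie on the line; the factor 2 cancelled
   above is the one in [sym_vec_contraction]. *)
transitivity (\sum_j sym_vec p1 p2 0 (ix2 i j) * l 0 j); last first.
  transitivity (p1 0 i * (\sum_j p2 0 j * l 0 j) + p2 0 i * (\sum_j p1 0 j * l 0 j)).
    rewrite !mulr_sumr -big_split; apply: eq_bigr => j _.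
    by rewrite sym_vecE /=; ring.
  by rewrite !dl // !mulr0 addr0.
rewrite yE -[X in _ *m X]vsubmxK mul_row_col !mulrDr /cval.
under [RHS]eq_bigr => j _ do rewrite mxE mulrDl.
rewrite big_split /=; congr (_ + _); rewrite mulrA mulr_sumr; apply: eq_bigr => j _;
  rewrite [in RHS]mxE mulr_suml mulr_sumr; apply: eq_bigr => k _;
  by rewrite [in RHS]mxE [in LHS]mxE; ring.
Qed.

End Geometry.

(** * The two flex points over a quadratic extension *)

Section Quad.
Variable R : comNzRingType.
Implicit Types (b n nu : R) (u v : R * R).

(* [u] stands for [u.1 + u.2 * nu], where [nu] is a root of [X^2 - 2 b X + n]. *)
Definition quad_val nu u := u.1 + u.2 * nu.
Definition quad_mul b n u v :=
  (u.1 * v.1 - n * (u.2 * v.2), u.1 * v.2 + u.2 * v.1 + 2 * b * (u.2 * v.2)).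
Definition quad_norm b n u := u.1 ^+ 2 + 2 * b * (u.1 * u.2) + n * u.2 ^+ 2.

Lemma quad_val_mul b n nu u v : nu ^+ 2 = 2 * b * nu - n ->
  quad_val nu (quad_mul b n u v) = quad_val nu u * quad_val nu v.
Proof.
move=> E; rewrite /quad_val /quad_mul /=.
transitivity (u.1 * v.1 + (u.1 * v.2 + u.2 * v.1) * nu + u.2 * v.2 * nu ^+ 2); last by ring.
by rewrite E; ring.
Qed.

Lemma quad_normE b n nu nu' u : 2 * b = nu + nu' -> n = nu * nu' ->
  quad_norm b n u = quad_val nu u * quad_val nu' u.
Proof. by rewrite /quad_norm /quad_val => -> ->; ring. Qed.

Definition trilinear (T : 'I_3 -> 'I_3 -> 'I_3 -> R) (p q r : 'rV[R]_3) :=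
  \sum_i \sum_j \sum_k T i j k * (p 0 i * q 0 j * r 0 k).

Section Discriminants.
Variables (T T' : 'I_3 -> 'I_3 -> 'I_3 -> R) (P1 P2 d : 'rV[R]_3) (a b c : R).

(** T(p, p, p) at p = nu P1 + c P2 by Horner's rule in nu, the pair (0, 1) being nu itself;
    [quad_deriv] is T(p, p, d) in the same way. *)
Definition quad_cubic T : R * R :=
  quad_mul b (a * c) (quad_mul b (a * c) (3 * (trilinear T P1 P1 P2 * c), trilinear T P1 P1 P1) (0,
      1)
                      + (3 * (trilinear T P1 P2 P2 * c ^+ 2), 0)) (0, 1)
    + (trilinear T P2 P2 P2 * c ^+ 3, 0).

Definition quad_deriv T : R * R :=
  quad_mul b (a * c) (2 * (trilinear T P1 P2 d * c), trilinear T P1 P1 d) (0, 1)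
    + (trilinear T P2 P2 d * c ^+ 2, 0).

(** The member through p is T'(p, p, p) T - T(p, p, p) T'. The norm multiplies its derivatives along
    d at the two points. At a flex the derivatives along the line vanish, so any direction off the
    line tests smoothness; e_0 is one when l_0 is nonzero. *)
Definition flex_smooth := quad_norm b (a * c)
  (quad_mul b (a * c) (quad_cubic T') (quad_deriv T)
   - quad_mul b (a * c) (quad_cubic T) (quad_deriv T')).

(** The third transvectant of the binary cubics that the two forms cut on the line. *)
Definition flex_transvectant :=
  trilinear T P1 P1 P1 * trilinear T' P2 P2 P2 - 3 * (trilinear T P1 P1 P2 * trilinear T' P1 P2 P2)
  + 3 * (trilinear T P1 P2 P2 * trilinear T' P1 P1 P2) - trilinear T P2 P2 P2 * trilinear T' P1 P1
      P1.

End Discriminants.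

Definition row3 (x y z : R) : 'rV[R]_3 := \row_i [:: x; y; z]`_i.

Lemma row3E x y z : ((row3 x y z 0 i0 = x) * (row3 x y z 0 i1 = y) * (row3 x y z 0 i2 = z))%type.
Proof. by rewrite !mxE. Qed.

Section FlexDisc.
Variables (T T' : 'I_3 -> 'I_3 -> 'I_3 -> R) (D D' : 'M[R]_(3, 6)) (s : R).

Definition pencil_conic i := s *: conic_of D i + conic_of D' i.
Let l := line_coord pencil_conic.
(** When [D] and [D'] are the two blocks of the inverse contraction, this is the dual conic that T
    and T' contract to s l and l. *)
Definition apolar_conic := s *: (l *m D) + l *m D'.
Let P1 := row3 (- l 0 i1) (l 0 i0) 0.
Let P2 := row3 (- l 0 i2) 0 (l 0 i0).
Let a := apolar_conic 0 (ix2 i1 i1).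
Let b := apolar_conic 0 (ix2 i1 i2).
Let c := apolar_conic 0 (ix2 i2 i2).

(* The line [l] is spanned by [P1] and [P2], and the degenerate dual conic is
   the pair of points [nu P1 + c P2] with [nu^2 - 2 b nu + a c = 0]. The factors
   ensure, in this order, that the construction makes sense, that the two points
   are distinct, that the members through them are distinct, and that they are
   smooth there. *)
Definition flex_disc := l 0 i0 * c * (b ^+ 2 - a * c) * flex_transvectant T T' P1 P2
  * flex_smooth T T' P1 P2 (delta_mx 0 i0) a b c.

End FlexDisc.
End Quad.

(** * From a solution back to a common flex line *)

Section Honest.
Import Num.Theory.
Variable K : numClosedFieldType.
Implicit Types (l p q x : 'rV[K]_3) (L : {vspace 'rV[K]_3}) (F G : cubic_form K).

Section Point.
Variables (F G : cubic_form K) (P1 P2 : 'rV[K]_3) (i : 'I_3) (a b c : K).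
Hypothesis P12 : \dim (<[P1]> + <[P2]>) = 2%N.
Let d : 'rV[K]_3 := delta_mx 0 i.
(** [H] contracts the dual conic a P1^2 + 2 b P1 P2 + c P2^2 to a linear form that vanishes at P1
    and P2, hence on the line. *)
Let rel (H : {mpoly K[3]}) :=
  a * polar H P1 P1 P1 + 2 * b * polar H P1 P1 P2 + c * polar H P1 P2 P2 = 0 /\
  a * polar H P1 P1 P2 + 2 * b * polar H P1 P2 P2 + c * polar H P2 P2 P2 = 0.
Hypotheses (relF : rel F) (relG : rel G) (c0 : c != 0).

Let pt nu := nu *: P1 + c *: P2.

Let polar_pt (H : {mpoly K[3]}) x y nu :
  polar H x y (pt nu) = nu * polar H x y P1 + c * polar H x y P2.
Proof. by rewrite polar_linear polarZ. Qed.

Let polar_PPP H nu : polar H (pt nu) (pt nu) (pt nu) = nu ^+ 3 * polar H P1 P1 P1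
   + 3 * (nu ^+ 2 * c) * polar H P1 P1 P2 + 3 * (nu * c ^+ 2) * polar H P1 P2 P2
   + c ^+ 3 * polar H P2 P2 P2.
Proof.
rewrite !polar_pt ![polar _ _ (pt nu) _]polarC23 !polar_pt.
rewrite ![polar _ (pt nu) _ _]polarC12 ![polar _ _ (pt nu) _]polarC23 !polar_pt.
rewrite [polar H P2 P1 P1]polarC12 [polar H P1 P2 P1]polarC23 [polar H P2 P1 P2]polarC12.
rewrite [polar H P2 P2 P1]polarC23 [polar H P2 P1 P2]polarC12; ring.
Qed.

Let polar_PPd H nu : polar H (pt nu) (pt nu) d = nu ^+ 2 * polar H P1 P1 d
   + 2 * (nu * c) * polar H P1 P2 d + c ^+ 2 * polar H P2 P2 d.
Proof.
rewrite polarC23 polar_pt ![polar _ (pt nu) _ _]polarC12 ![polar _ _ (pt nu) _]polarC23 !polar_pt.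
rewrite ![polar H d _ _]polarC12 ![polar H _ d _]polarC23 [polar H P2 P1 _]polarC12; ring.
Qed.

(** The product of the points at nu and nu' is c times the dual conic of [rel], so H(p, p', x) = 0
    for x on the line; here x = p. *)
Let polar_PPQ H nu nu' : rel H -> 2 * b = nu + nu' -> a * c = nu * nu' ->
  polar H (pt nu) (pt nu) (pt nu') = 0.
Proof.
move=> [r1 r2] tr nm.
transitivity (c * nu * (a * polar H P1 P1 P1 + 2 * b * polar H P1 P1 P2 + c * polar H P1 P2 P2)
  + c ^+ 2 * (a * polar H P1 P1 P2 + 2 * b * polar H P1 P2 P2 + c * polar H P2 P2 P2)); last first.
  by rewrite r1 r2 !mulr0 addr0.
transitivity (nu * (a * c) * polar H P1 P1 P1 + c * (nu * (2 * b) + a * c) * polar H P1 P1 P2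
   + c ^+ 2 * (nu + 2 * b) * polar H P1 P2 P2 + c ^+ 3 * polar H P2 P2 P2); last by ring.
rewrite tr nm polar_pt ![polar _ _ (pt nu) _]polarC23 !polar_pt.
rewrite ![polar _ (pt nu) _ _]polarC12 ![polar _ _ (pt nu) _]polarC23 !polar_pt.
rewrite [polar H P2 P1 P1]polarC12 [polar H P1 P2 P1]polarC23 [polar H P2 P1 P2]polarC12.
rewrite [polar H P2 P2 P1]polarC23 [polar H P2 P1 P2]polarC12; ring.
Qed.

(** The combination that vanishes at the point, written without division. It is zero at a base point
    of the pencil; the smoothness factor excludes this. *)
Definition member nu : cubic_form K :=
  polar G (pt nu) (pt nu) (pt nu) *: F + - polar F (pt nu) (pt nu) (pt nu) *: G.

Let polar_member nu x y z : polar (member nu) x y z =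
  polar G (pt nu) (pt nu) (pt nu) * polar F x y z - polar F (pt nu) (pt nu) (pt nu) * polar G x y z.
Proof.
by rewrite /member /= polar_linear_form polarZ_form mulNr.
Qed.

Let span_pt nu nu' : nu != nu' -> (<[P1]> + <[P2]> = <[pt nu]> + <[pt nu']>)%VS.
Proof.
move=> nn; rewrite -subr_eq0 in nn; apply: subv_anti; rewrite !subv_add -!memvE.
have PM (x y : K) : x *: P1 + y *: P2 \in (<[P1]> + <[P2]>)%VS.
  by rewrite memv_add // memvZ // memv_line.
have PM' (x y : K) : x *: pt nu + y *: pt nu' \in (<[pt nu]> + <[pt nu']>)%VS.
  by rewrite memv_add // memvZ // memv_line.
rewrite !PM // !andbT; apply/andP; split.
  rewrite (_ : P1 = (nu - nu')^-1 *: pt nu + - (nu - nu')^-1 *: pt nu') //.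
  by apply/rowP => j; rewrite !mxE; field.
rewrite (_ : P2 = - (nu' / (nu - nu') / c) *: pt nu + (nu / (nu - nu') / c) *: pt nu') //.
by apply/rowP => j; rewrite !mxE; field; rewrite ?nn ?c0.
Qed.

(** In the parameter of the line through p and p', the first coefficient vanishes since the member
    passes through p, and the next two by apolarity; only the multiple of t^3 remains. *)
Lemma member_flex nu nu' : nu != nu' -> 2 * b = nu + nu' -> a * c = nu * nu' ->
    polar (member nu) (pt nu) (pt nu) d != 0 ->
  flex_tangent_line (member nu) (<[P1]> + <[P2]>)%VS.
Proof.
move=> nn tr nm sm; split=> //; exists (pt nu).
have tr' : 2 * b = nu' + nu by rewrite addrC.
have nm' : a * c = nu' * nu by rewrite nm mulrC.
have p000 : polar (member nu) (pt nu) (pt nu) (pt nu) = 0.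
  by rewrite polar_member mulrC subrr.
split.
- by apply: contraNneq sm => p0; rewrite p0 polarC23 polar0.
- by rewrite (span_pt nn) memvE addvSl.
- split; first by rewrite meval_polar ?cubic_homog.
  exists i; rewrite mderiv_polar ?cubic_homog // mulf_neq0 //.
  by rewrite (Num.Theory.pnatr_eq0 _ 3).
exists (pt nu'); split; first exact: span_pt.
rewrite restrict_line_polar ?cubic_homog // p000.
have -> : polar (member nu) (pt nu) (pt nu) (pt nu') = 0.
  by rewrite polar_member !(polar_PPQ _ tr nm) // !mulr0 subr0.
have -> : polar (member nu) (pt nu) (pt nu') (pt nu') = 0.
  rewrite polar_member ![polar _ (pt nu) (pt nu') _]polarC12.
  by rewrite ![polar _ (pt nu') (pt nu) _]polarC23 !(polar_PPQ _ tr' nm') // !mulr0 subr0.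
by rewrite mulr0 !scale0r !addr0 add0r -mul_polyC dvdp_mull.
Qed.

(** The left side vanishes if one member contains both points. The apolarity relations express the
    polars at (P1, P2, P2) and (P2, P2, P2) through the other two, and an identity of rational
    functions remains. *)
Lemma polar_pt_det nu nu' : 2 * b = nu + nu' -> a * c = nu * nu' ->
  polar F (pt nu) (pt nu) (pt nu) * polar G (pt nu') (pt nu') (pt nu')
   - polar F (pt nu') (pt nu') (pt nu') * polar G (pt nu) (pt nu) (pt nu)
  = c ^+ 3 * (nu - nu') ^+ 3 * flex_transvectant (tensor F) (tensor G) P1 P2.
Proof.
move=> tr nm; rewrite /flex_transvectant -![trilinear (tensor _) _ _ _]/(polar _ _ _ _).
rewrite !polar_PPP; have aE : a = nu * nu' / c by rewrite -nm mulfK.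
have relE H : rel H -> polar H P1 P2 P2 = - (a * polar H P1 P1 P1 + (nu + nu') * polar H P1 P1 P2)
    / c /\
   polar H P2 P2 P2 = - (a * polar H P1 P1 P2 + (nu + nu') * polar H P1 P2 P2) / c.
  move=> [r1 r2]; split; apply: (mulIf c0); rewrite mulfVK // -tr.
    by rewrite -[RHS]addr0 -r1; ring.
  by rewrite -[RHS]addr0 -r2; ring.
have [F2 F3] := relE _ relF; have [G2 G3] := relE _ relG.
by rewrite F3 G3 F2 G2 aE; field.
Qed.

Let quad_val_cubic (H : {mpoly K[3]}) nu : nu ^+ 2 = 2 * b * nu - a * c ->
  quad_val nu (quad_cubic P1 P2 a b c (tensor H)) = polar H (pt nu) (pt nu) (pt nu).
Proof.
move=> E; rewrite polar_PPP /quad_cubic.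
have qD u v : quad_val nu (u + v) = quad_val nu u + quad_val nu v.
  by rewrite /quad_val /=; ring.
by rewrite !(qD, quad_val_mul _ _ E) /quad_val /= -![trilinear (tensor _) _ _ _]/(polar _ _ _ _);
    ring.
Qed.

Let quad_val_deriv (H : {mpoly K[3]}) nu : nu ^+ 2 = 2 * b * nu - a * c ->
  quad_val nu (quad_deriv P1 P2 d a b c (tensor H)) = polar H (pt nu) (pt nu) d.
Proof.
move=> E; rewrite polar_PPd /quad_deriv.
have qD u v : quad_val nu (u + v) = quad_val nu u + quad_val nu v.
  by rewrite /quad_val /=; ring.
by rewrite !(qD, quad_val_mul _ _ E) /quad_val /= -![trilinear (tensor _) _ _ _]/(polar _ _ _ _);
    ring.
Qed.

Lemma flex_smoothE nu nu' : 2 * b = nu + nu' -> a * c = nu * nu' ->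
  flex_smooth (tensor F) (tensor G) P1 P2 d a b c =
  polar (member nu) (pt nu) (pt nu) d * polar (member nu') (pt nu') (pt nu') d.
Proof.
move=> tr nm; rewrite /flex_smooth (quad_normE _ tr nm).
have E1 : nu ^+ 2 = 2 * b * nu - a * c by rewrite tr nm; ring.
have E2 : nu' ^+ 2 = 2 * b * nu' - a * c by rewrite tr nm; ring.
have qB (x : K) u v : quad_val x (u - v) = quad_val x u - quad_val x v.
  by rewrite /quad_val /=; ring.
rewrite !qB !(quad_val_mul _ _ E1) !(quad_val_mul _ _ E2) !polar_member.
by rewrite !(quad_val_cubic _ E1) !(quad_val_cubic _ E2) !(quad_val_deriv _ E1) !(quad_val_deriv _
    E2).
Qed.

Lemma flex_conic_common (W : {vspace cubic_form K}) : F \in W -> G \in W ->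
    b ^+ 2 - a * c != 0 -> flex_transvectant (tensor F) (tensor G) P1 P2 != 0 ->
    flex_smooth (tensor F) (tensor G) P1 P2 d a b c != 0 ->
  common_flex_line W (<[P1]> + <[P2]>)%VS.
Proof.
move=> FW GW disc0 tr0.
pose e := sqrtC (b ^+ 2 - a * c); have eE : e ^+ 2 = b ^+ 2 - a * c by rewrite sqrtCK.
have e0 : e != 0 by rewrite sqrtC_eq0.
have n2 : (2 : K) != 0 by rewrite (Num.Theory.pnatr_eq0 _ 2).
have tr : 2 * b = (b + e) + (b - e) by ring.
have nm : a * c = (b + e) * (b - e).
  by transitivity (b ^+ 2 - e ^+ 2); [rewrite eE; ring | ring].
have nn : b + e - (b - e) != 0 by rewrite (_ : _ - _ = 2 * e) ?mulf_neq0 //; ring.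
rewrite (flex_smoothE tr nm) mulf_eq0 negb_or => /andP[sm sm'].
have memW nu : member nu \in W by rewrite memvD // memvZ.
have mem0 nu : polar (member nu) (pt nu) (pt nu) d != 0 -> member nu != 0.
  by apply: contraNneq => ->; rewrite polar0_form.
exists (member (b + e)), (member (b - e)); split; try by split; [apply: memW | apply: mem0].
(* If the members were proportional, the second would also pass through the first point, and the
   determinant of [polar_pt_det] would be zero. *)
- apply: contraNneq tr0 => E; have : member (b - e) \in <[member (b + e)]>%VS.
    by rewrite E memv_line.
  case/vlineP => k /(congr1 (fun H : cubic_form K => polar H (pt (b + e)) (pt (b + e)) (pt (b +
      e)))).
  rewrite /= polarZ_form !polar_member [X in k * (X - _)]mulrC subrr mulr0 => E'.
  have := polar_pt_det tr nm; rewrite [X in X - _]mulrC E' => /esym/eqP.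
  by rewrite mulf_eq0 [X in X || _]mulf_eq0 !expf_eq0 /= (negbTE c0) (negbTE nn).
- by apply: (member_flex _ tr nm sm); rewrite -subr_eq0.
- apply: (member_flex (nu' := b + e) _ _ _ sm'); first by rewrite eq_sym -subr_eq0.
    exact: etrans tr (addrC _ _).
  exact: etrans nm (mulrC _ _).
Qed.

End Point.

Lemma line_of_row3 l : l 0 i0 != 0 ->
  line_of l = (<[(row3 (- l 0 i1) (l 0 i0) 0)%R]> + <[(row3 (- l 0 i2) 0 (l 0 i0))%R]>)%VS.
Proof.
move=> l0; apply/vspaceP => x; rewrite mem_line_of /dot sum3; apply/eqP/memv_addP => [E|].
  have xE : x = (x 0 i1 / l 0 i0) *: row3 (- l 0 i1) (l 0 i0) 0
              + (x 0 i2 / l 0 i0) *: row3 (- l 0 i2) 0 (l 0 i0).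
    apply/rowP; elim/ord3_ind; rewrite !mxE /=; [|by field|by field].
    by apply: (mulfI l0); apply/eqP; rewrite -subr_eq0 -[X in _ == X]E; apply/eqP; field.
  exists ((x 0 i1 / l 0 i0) *: row3 (- l 0 i1) (l 0 i0) 0); first by rewrite memvZ ?memv_line.
  by exists ((x 0 i2 / l 0 i0) *: row3 (- l 0 i2) 0 (l 0 i0)); rewrite ?memvZ ?memv_line.
move=> [_ /vlineP[s ->] [_ /vlineP[t ->] ->]]; rewrite !mxE /=; ring.
Qed.

Lemma flex_disc_common (W : {vspace cubic_form K}) F G s
    (D := invmx (contraction2 (tensor F) (tensor G)) : 'M_(3 + 3, 6))
    (e := pencil_conic (usubmx D) (dsubmx D) s) :
    F \in W -> G \in W -> contraction2 (tensor F) (tensor G) \in unitmx ->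
    (forall i, cval (e i) (line_coord e) = 0) ->
    flex_disc (tensor F) (tensor G) (usubmx D) (dsubmx D) s != 0 ->
  common_flex_line W (line_of (line_coord e)).
Proof.
move=> FW GW uC le0; rewrite /flex_disc -/e; set l := line_coord e in le0 *.
set y := apolar_conic _ _ _; set P1 := row3 (- l 0 i1) _ _; set P2 := row3 (- l 0 i2) _ _.
set a := y 0 (ix2 i1 i1); set b := y 0 (ix2 i1 i2); set c := y 0 (ix2 i2 i2).
rewrite !mulf_eq0 !negb_or -!andbA => /and5P[l0 c0 disc0 tr0 sm0].
have dP : \dim (<[P1]> + <[P2]>) = 2%N.
  rewrite -line_of_row3 // dim_line_of //.
  by apply: contraNneq l0 => ->; rewrite mxE.
rewrite line_of_row3 //.
have yE : y = row_mx (s *: l) l *m D.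
  by rewrite -[X in _ *m X]vsubmxK mul_row_col -scalemxAl.
have yC : y *m contraction2 (tensor F) (tensor G) = row_mx (s *: l) l by rewrite yE mulmxKV.
have [yF yG] : y *m contraction (tensor F) = s *: l /\ y *m contraction (tensor G) = l.
  by move: yC; rewrite /contraction2 mul_mx_row => /eq_row_mx.
have yl i : \sum_j y 0 (ix2 i j) * l 0 j = 0.
  rewrite -[RHS](le0 i) /cval; apply: eq_bigr => j _.
  rewrite yE -[D]vsubmxK mul_row_col -scalemxAl !mxE mulr_sumr -big_split mulr_suml /=.
  by apply: eq_bigr => k _; rewrite !mxE; ring.
(* Since y l = 0 and l_0 is nonzero, y is determined by its block on the indices 1 and 2; P1 and P2
   are chosen so that this block gives the coefficients of P1^2, P1 P2 and P2^2. *)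
have Y i j : l 0 i0 ^+ 2 * y 0 (ix2 i j) = a * (P1 0 i * P1 0 j)
    + b * (P1 0 i * P2 0 j + P2 0 i * P1 0 j) + c * (P2 0 i * P2 0 j).
  have := yl i0; have := yl i1; have := yl i2.
  rewrite !sum3 [ix2 i1 i0]ix2C [ix2 i2 i0]ix2C [ix2 i2 i1]ix2C -/a -/b -/c => E2 E1 E0.
  have Y1 : l 0 i0 * y 0 (ix2 i0 i1) = - (l 0 i1 * a + l 0 i2 * b).
    by rewrite -[RHS]addr0 -E1; ring.
  have Y2 : l 0 i0 * y 0 (ix2 i0 i2) = - (l 0 i1 * b + l 0 i2 * c).
    by rewrite -[RHS]addr0 -E2; ring.
  have Y0 : l 0 i0 ^+ 2 * y 0 (ix2 i0 i0) = l 0 i1 * (l 0 i1 * a + l 0 i2 * b) + l 0 i2 * (l 0 i1 *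
      b + l 0 i2 * c).
    transitivity (- (l 0 i1 * (l 0 i0 * y 0 (ix2 i0 i1)) + l 0 i2 * (l 0 i0 * y 0 (ix2 i0 i2)))).
      by rewrite -[RHS]addr0 -[X in _ = _ + X](mulr0 (l 0 i0)) -E0; ring.
    by rewrite Y1 Y2; ring.
  have Y1' : l 0 i0 ^+ 2 * y 0 (ix2 i0 i1) = - l 0 i0 * (l 0 i1 * a + l 0 i2 * b).
    by rewrite expr2 -mulrA Y1; ring.
  have Y2' : l 0 i0 ^+ 2 * y 0 (ix2 i0 i2) = - l 0 i0 * (l 0 i1 * b + l 0 i2 * c).
    by rewrite expr2 -mulrA Y2; ring.
  elim/ord3_ind: i; elim/ord3_ind: j;
    rewrite ?[ix2 i1 i0]ix2C ?[ix2 i2 i0]ix2C ?[ix2 i2 i1]ix2C -?/a -?/b -?/c ?Y0 ?Y1' ?Y2' !row3E;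
        ring.
have rel (H : cubic_form K) t x : y *m contraction (tensor H) = t *: l -> dot l x = 0 ->
    a * polar H P1 P1 x + 2 * b * polar H P1 P2 x + c * polar H P2 P2 x = 0.
  move=> yH lx.
  transitivity (l 0 i0 ^+ 2 * \sum_i \sum_j \sum_k (y 0 (ix2 i j) * tensor H i j k) * x 0 k); last
      first.
    suff -> : \sum_i \sum_j \sum_k y 0 (ix2 i j) * tensor H i j k * x 0 k = t * dot l x.
      by rewrite lx !mulr0.
    under eq_bigr => i _ do rewrite exchange_big.
    rewrite exchange_big /dot mulr_sumr; apply: eq_bigr => k _ /=.
    under eq_bigr => i _ do rewrite -mulr_suml.
    by rewrite -mulr_suml -mul_contraction yH mxE mulrA.
  rewrite (_ : 2 * b * polar H P1 P2 x = b * polar H P1 P2 x + b * polar H P2 P1 x); last first.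
    by rewrite [polar H P2 P1 x]polarC12; ring.
  rewrite /polar !mulr_sumr -!big_split; apply: eq_bigr => i _ /=.
  rewrite !mulr_sumr -!big_split; apply: eq_bigr => j _ /=.
  rewrite !mulr_sumr -!big_split; apply: eq_bigr => k _ /=.
  transitivity ((l 0 i0 ^+ 2 * y 0 (ix2 i j)) * (tensor H i j k * x 0 k)); last by ring.
  by rewrite Y; ring.
have d1 : dot l P1 = 0 by rewrite /dot sum3 !row3E; ring.
have d2 : dot l P2 = 0 by rewrite /dot sum3 !row3E; ring.
have yG' : y *m contraction (tensor G) = 1 *: l by rewrite scale1r.
have relP (H : cubic_form K) t : y *m contraction (tensor H) = t *: l ->
   a * polar H P1 P1 P1 + 2 * b * polar H P1 P1 P2 + c * polar H P1 P2 P2 = 0 /\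
   a * polar H P1 P1 P2 + 2 * b * polar H P1 P2 P2 + c * polar H P2 P2 P2 = 0.
  move=> yH; split; last exact: rel yH d2.
  by rewrite -[RHS](rel H t P1 yH d1) [polar H P1 P2 P1]polarC23 [polar H P2 P2 P1]polarC23 [polar
      H P2 P1 P2]polarC12.
exact: (flex_conic_common dP (relP _ _ yF) (relP _ _ yG') c0 FW GW disc0 tr0 sm0).
Qed.

End Honest.

(** * Counting the common flex lines of a generic pencil *)

Section Count.
Variable K : numClosedFieldType.

Section Generic.
Variables (T T' : 'I_3 -> 'I_3 -> 'I_3 -> K) (S : 'M[K]_(3 * 6, 15)) (J : 'M[K]_(15, 12)).

Definition pencil_inv : 'M_(3 + 3, 6) := invmx (contraction2 T T').
Definition pencil_conicl := conic_of (usubmx pencil_inv).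
Definition pencil_conicr := conic_of (dsubmx pencil_inv).
Definition pencil_shift := shift12 pencil_conicl pencil_conicr S J.

(** [S] and [J] are the auxiliary choices that make the shift an explicit matrix: a right inverse of
    the transposed multiplication by the r_i, and a complement of the minors. *)
Definition generic_pencil :=
  [/\ contraction2 T T' \in unitmx, slice_mx pencil_conicl *m S = 1%:M,
      row_full (koszul pencil_conicl),
      (row_mx (minors_mx pencil_conicl pencil_conicr) J : 'M_(3 + 12)) \in unitmx
    & forall a, root (char_poly pencil_shift) a -> (char_poly pencil_shift)^`().[a] != 0 /\
        flex_disc T T' (usubmx pencil_inv) (dsubmx pencil_inv) a != 0].

End Generic.

Section Pencil.
Variables (F G : cubic_form K) (S : 'M[K]_(3 * 6, 15)) (J : 'M[K]_(15, 12)).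
Let D := pencil_inv (tensor F) (tensor G).
Let r := conic_of (usubmx D).
Let q := conic_of (dsubmx D).
Let chi := char_poly (shift12 r q S J).

Lemma generic_pencil_count (W : {vspace cubic_form K}) : \dim W = 2%N ->
    F \in W -> G \in W -> generic_pencil (tensor F) (tensor G) S J ->
  exists s : seq {vspace 'rV[K]_3}, [/\ uniq s, size s = 12%N
    & forall L, L \in s <-> common_flex_line W L].
Proof.
move=> dW FW GW [uC rS kr uJ disc].
pose e a := pencil_conic (usubmx D) (dsubmx D) a.
pose L a := line_coord (e a).
(* The first factor of [flex_disc] is l_0, which is this determinant. *)
have det0 a : root chi a -> \det (dsubmx (cubic_mx (e a)) : 'M_9) != 0.
  move=> /disc[_]; rewrite /flex_disc !mulf_eq0 !negb_or -!andbA => /and5P[+ _ _ _ _].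
  by rewrite mxE cubic_ker00.
have L0 a : root chi a -> L a != 0.
  move=> /det0; apply: contraNneq => /rowP/(_ i0).
  by rewrite mxE cubic_ker00 mxE => ->.
have Lsol a : root chi a -> forall i, cval (e a i) (L a) = 0.
  by move=> ra; apply: root_solution ra (det0 a ra).
have cvalE a i l : cval (e a i) l = a * cval (r i) l + cval (q i) l.
  rewrite /cval mulr_sumr -big_split; apply: eq_bigr => j _ /=.
  rewrite mulr_sumr -big_split; apply: eq_bigr => k _ /=.
  by rewrite !mxE; ring.
(* At a common zero of the r_i the evaluation would kill their ideal, which by [rS] contains all
   quartics. *)
have r_reg l : l != 0 -> ~ forall i, cval (r i) l = 0.
  move=> l0 rl0; have : ev4 l *m slice_mx r = 0.
    rewrite mul_slice_mx (_ : (\matrix_(i, u) _) = 0) ?linear0 //.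
    by apply/matrixP => i u; rewrite !mxE slice_ev rl0 mul0r.
  move/(congr1 (mulmx^~ S)); rewrite -mulmxA rS mulmx1 mul0mx => /rowP ev0.
  case/eqP: l0; apply/rowP => i; have := ev0 (ix4 i i i i); rewrite ev4E !mxE.
  by move/eqP; rewrite !mulf_eq0 !orbb => /eqP.
have [rs chiE] := closed_field_poly_normal chi.
have chi_monic : chi \is monic by apply: char_poly_monic.
rewrite (monicP chi_monic) scale1r in chiE.
have rootE a : root chi a = (a \in rs) by rewrite chiE root_prod_XsubC.
have urs : uniq rs.
  rewrite -separable_prod_XsubC -chiE unlock; apply/negPn/negP => /closed_rootP[a].
  rewrite root_gcd => /andP[/disc[d0 _] /rootP d0']; by rewrite d0' eqxx in d0.
have srs : size rs = 12%N.
  by have := size_char_poly (shift12 r q S J); rewrite -/chi chiE size_prod_XsubC => -[].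
(* If one l solved the equations for both a and b, subtraction would give (a - b) r_i(l) = 0. *)
have inj : {in rs &, injective (fun a => line_of (L a))}.
  move=> a b; rewrite -!rootE => ra rb LE.
  have [c c0 Lb] := line_of_inj (L0 a ra) (L0 b rb) LE.
  apply/eqP; rewrite -subr_eq0; apply/negPn/negP => ab0.
  apply: (r_reg (L a) (L0 a ra)) => i.
  have := Lsol a ra i; have := Lsol b rb i; rewrite !cvalE Lb.
  have cZ (M : 'M_3) l : cval M (c *: l) = c ^+ 2 * cval M l.
    rewrite /cval mulr_sumr; apply: eq_bigr => j _; rewrite mulr_sumr.
    by apply: eq_bigr => k _ /=; rewrite !mxE; ring.
  rewrite !cZ; set x := cval (r i) (L a); set y := cval (q i) (L a) => E1 E2.
  apply: (mulfI (mulf_neq0 (expf_neq0 2 c0) ab0)).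
  transitivity (c ^+ 2 * (a * x + y) - (b * (c ^+ 2 * x) + c ^+ 2 * y)); first by ring.
  by rewrite E1 E2 !mulr0 subr0.
exists [seq line_of (L a) | a <- rs]; split.
- by rewrite map_inj_in_uniq.
- by rewrite size_map.
move=> M; split=> [/mapP[a ra ->]|cM].
  rewrite -rootE in ra; have [_ da] := disc _ ra.
  exact: (flex_disc_common FW GW uC (Lsol a ra) da).
have [l [a [b [l0 ab0 -> lE]]]] := common_flex_conics dW FW GW uC cM.
have b0 : b != 0.
  apply: contraNneq ab0 => b0; apply/eqP; congr (_, _) => //; apply/eqP/negPn/negP => a0.
  apply: (r_reg l l0) => i; apply: (mulfI a0).
  by rewrite mulr0 -[RHS](lE i) b0 mul0r addr0.
have sol i : a / b * cval (r i) l + cval (q i) l = 0.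
  by apply: (mulfI b0); rewrite mulr0 -[RHS](lE i) -/r -/q; field.
have ra : root chi (a / b) by exact: (solution_root rS uJ l0 sol).
have [ll LE] : l 0 i0 != 0 /\ L (a / b) = (\det (dsubmx (cubic_mx (e (a / b))) : 'M_9) / l 0 i0) *:
    l.
  by apply: solution_line_coord => // [i|]; [rewrite cvalE | apply: det0].
apply/mapP; exists (a / b); first by rewrite -rootE.
by rewrite LE line_ofZ // mulf_neq0 ?invr_eq0 ?det0.
Qed.

End Pencil.
End Count.

(** * Openness of genericity *)

Section Morphism.
Variables (R R' : comNzRingType) (phi : {rmorphism R -> R'}).

Lemma map_cubic_mx (e : 'I_3 -> 'M[R]_3) (e' : 'I_3 -> 'M[R']_3) :
  (forall i, e' i = map_mx phi (e i)) -> cubic_mx e' = map_mx phi (cubic_mx e).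
Proof.
move=> ee; apply/matrixP => c x; case/mxvec_indexP: x => i a.
rewrite [RHS]mxE [LHS]mxE [in RHS]mxE !mxvecE !mxE rmorph_sum; apply: eq_bigr => j _.
rewrite rmorph_sum; apply: eq_bigr => k _; rewrite ee mxE.
by rewrite /= rmorphMn.
Qed.

Lemma map_line_coord (e : 'I_3 -> 'M[R]_3) (e' : 'I_3 -> 'M[R']_3) :
  (forall i, e' i = map_mx phi (e i)) -> line_coord e' = map_mx phi (line_coord e).
Proof.
move=> /map_cubic_mx E; have Ek : cubic_ker e' = map_mx phi (cubic_ker e).
  rewrite /cubic_ker E map_row_mx map_scalar_mx map_mxN map_mxM.
  by rewrite -map_usubmx -map_dsubmx det_map_mx map_mx_adj.
by apply/rowP => a; rewrite [LHS]mxE Ek [LHS]mxE [RHS]mxE [in RHS]mxE.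
Qed.

Lemma map_trilinear T T' p q r p' q' r' :
    (forall i j k, T' i j k = phi (T i j k)) ->
    p' = map_mx phi p -> q' = map_mx phi q -> r' = map_mx phi r ->
  trilinear T' p' q' r' = phi (trilinear T p q r).
Proof.
move=> TT -> -> ->; rewrite /trilinear; do 3!(rewrite rmorph_sum; apply: eq_bigr => ? _ /=).
by rewrite TT !mxE !rmorphM.
Qed.

Let pmap (u : R * R) : R' * R' := (phi u.1, phi u.2).

Let pmap_mul b n u v : quad_mul (phi b) (phi n) (pmap u) (pmap v) = pmap (quad_mul b n u v).
Proof. by rewrite /quad_mul /pmap /= !(rmorphB, rmorphD, rmorphM, rmorph_nat). Qed.

Let pmapD u v : pmap u + pmap v = pmap (u + v).
Proof. by rewrite /pmap /= !rmorphD. Qed.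

Let pmapB u v : pmap u - pmap v = pmap (u - v).
Proof. by rewrite /pmap /= !rmorphB. Qed.

Let pmap_norm b n u : quad_norm (phi b) (phi n) (pmap u) = phi (quad_norm b n u).
Proof. by rewrite /quad_norm /pmap /=; ring. Qed.

Lemma map_row3 x y z : row3 (phi x) (phi y) (phi z) = map_mx phi (row3 x y z).
Proof. by apply/rowP => i; rewrite !mxE; elim/ord3_ind: i. Qed.

(** Applied to the evaluation of polynomials at a: [flex_disc] formed with the variable in place of
    s specialises to its value at each eigenvalue. *)
Lemma map_flex_disc T1 T2 T1' T2' D D' s :
    (forall i j k, T1' i j k = phi (T1 i j k)) -> (forall i j k, T2' i j k = phi (T2 i j k)) ->
  flex_disc T1' T2' (map_mx phi D) (map_mx phi D') (phi s) = phi (flex_disc T1 T2 D D' s).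
Proof.
move=> E1 E2; rewrite /flex_disc.
have El : line_coord (pencil_conic (map_mx phi D) (map_mx phi D') (phi s))
    = map_mx phi (line_coord (pencil_conic D D' s)).
  apply: map_line_coord => i; apply/matrixP => j k.
  by rewrite !mxE rmorphD rmorphM.
have Ey : apolar_conic (map_mx phi D) (map_mx phi D') (phi s) = map_mx phi (apolar_conic D D' s).
  by rewrite /apolar_conic El map_mxD map_mxZ !map_mxM.
rewrite Ey El; set l := line_coord _; set y := apolar_conic _ _ _.
rewrite ![map_mx phi l 0 _]mxE ![map_mx phi y 0 _]mxE -!rmorphN -(rmorph0 phi) !map_row3.
have Ed : delta_mx 0 i0 = map_mx phi (delta_mx 0 i0) :> 'rV_3 by rewrite map_delta_mx.
set P1 := row3 _ _ _; set P2 := row3 _ _ _.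
set a := y 0 (ix2 i1 i1); set b := y 0 (ix2 i1 i2); set c := y 0 (ix2 i2 i2).
have p0 x : (phi x, 0) = pmap (x, 0) by rewrite /pmap /= rmorph0.
have p01 : (0, 1) = pmap (0, 1) by rewrite /pmap /= rmorph0 rmorph1.
have cubE T T' : (forall i j k, T' i j k = phi (T i j k)) ->
    quad_cubic (map_mx phi P1) (map_mx phi P2) (phi a) (phi b) (phi c) T' = pmap (quad_cubic P1 P2
        a b c T).
  move=> E; have tE := map_trilinear E erefl erefl erefl.
  rewrite /quad_cubic !tE p01 -!rmorphXn -!rmorphM -!(rmorph_nat phi 3) -!rmorphM !p0.
  by rewrite -[(phi _, phi _)]/(pmap (_, _)) !(pmap_mul, pmapD).
have derE T T' : (forall i j k, T' i j k = phi (T i j k)) ->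
    quad_deriv (map_mx phi P1) (map_mx phi P2) (map_mx phi (delta_mx 0 i0)) (phi a) (phi b) (phi c)
        T'
    = pmap (quad_deriv P1 P2 (delta_mx 0 i0) a b c T).
  move=> E; have tE := map_trilinear E erefl erefl erefl.
  rewrite /quad_deriv !tE p01 -!rmorphXn -!rmorphM -!(rmorph_nat phi 2) -!rmorphM !p0.
  by rewrite -[(phi _, phi _)]/(pmap (_, _)) !(pmap_mul, pmapD).
rewrite [in LHS]Ed !rmorphM; congr (_ * _ * _ * _ * _).
- by rewrite rmorphB rmorphXn rmorphM.
- rewrite /flex_transvectant !(map_trilinear E1 erefl erefl erefl) !(map_trilinear E2 erefl erefl
    erefl).
  by ring.
rewrite /flex_smooth (cubE _ _ E1) (cubE _ _ E2) (derE _ _ E1) (derE _ _ E2) -rmorphM !pmap_mul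
    pmapB.
exact: pmap_norm.
Qed.

End Morphism.

Section RegularFlex.
Variables (K : fieldType) (n : nat) (v0 : 'I_n -> K).
Notation regular := (regular v0).
Notation regularC := (regularC v0).

Lemma regularMn f k : regular f -> regular (fun v => f v *+ k).
Proof.
move=> rf; apply: (@eq_regular _ _ _ (fun v => f v * k%:R)) => [v|].
  by rewrite mulr_natr.
by apply: regularM => //; apply: regular_const.
Qed.

Lemma regularX f k : regular f -> regular (fun v => f v ^+ k).
Proof.
move=> rf; elim: k => [|k IHk]; first exact: regular_const.
by apply: (@eq_regular _ _ _ (fun v => f v * f v ^+ k)) => [v|]; [rewrite exprS | apply: regularM].
Qed.

Lemma regularC_Mn (f : ('I_n -> K) -> K) k : regularC f -> regularC (fun v => f v *+ k).
Proof. by move=> /(@regularMn _ k); apply: eq_regular => v; rewrite polyCMn. Qed.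

Section Flex.
Variables (T1 T2 : ('I_n -> K) -> 'I_3 -> 'I_3 -> 'I_3 -> {poly K}).
Variables (D D' : ('I_n -> K) -> 'M[{poly K}]_(3, 6)) (s : ('I_n -> K) -> {poly K}).
Hypotheses (rT1 : forall i j k, regular (fun v => T1 v i j k))
  (rT2 : forall i j k, regular (fun v => T2 v i j k))
  (rD : regular_mx v0 D) (rD' : regular_mx v0 D') (rs : regular s).

Let e v := pencil_conic (D v) (D' v) (s v).

Let regular_cubic_mx : regular_mx v0 (fun v => cubic_mx (e v)).
Proof.
move=> c x; case/mxvec_indexP: x => i a.
apply: (@eq_regular _ _ _ (fun v => \sum_j \sum_k
   (s v * D v k (ix2 i j) + D' v k (ix2 i j)) *+ (ix3 j k a == c))) => [v|].
  rewrite mxE mxvecE mxE; apply: eq_bigr => j _; apply: eq_bigr => k _.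
  by rewrite !mxE.
apply: regular_sum => j; apply: regular_sum => k; apply: regularMn.
by apply: regularD => //; apply: regularM.
Qed.

Let l v := line_coord (e v).

Let regular_l : regular_mx v0 l.
Proof.
move=> z a; pose N v : 'M_9 := dsubmx (cubic_mx (e v)).
have rN : regular_mx v0 N.
  move=> i j; apply: (@eq_regular _ _ _ (fun v => cubic_mx (e v) (rshift 1 i) j)) => [v|//].
  by rewrite [RHS]mxE.
pose x : 'I_(1 + 9) := ix3 i0 i0 a.
apply: (@eq_regular _ _ _ (fun v => cubic_ker (e v) 0 x)) => [v|]; first by rewrite ord1 [RHS]mxE.
case: (split_ordP x) => k ->.
  apply: (@eq_regular _ _ _ (fun v => \det (N v) *+ (0 == k))) => [v|].
    by rewrite row_mxEl mxE.
  by apply/regularMn/regular_det.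
apply: (@eq_regular _ _ _ (fun v => - (usubmx (cubic_mx (e v)) *m \adj (N v)) 0 k)) => [v|].
  by rewrite [RHS]row_mxEr [RHS]mxE.
apply/regularN/regular_mulmx; last exact: regular_adj.
move=> i j; apply: (@eq_regular _ _ _ (fun v => cubic_mx (e v) (lshift 9 i) j)) => [v|//].
by rewrite [RHS]mxE.
Qed.

Let y v := apolar_conic (D v) (D' v) (s v).

Let regular_y : regular_mx v0 y.
Proof.
move=> i j; apply: (@eq_regular _ _ _ (fun v => s v * (l v *m D v) i j + (l v *m D' v) i j)).
  by move=> v; rewrite /y /apolar_conic [in RHS]mxE [X in _ = X + _]mxE.
by apply: regularD; [apply: regularM => //|]; apply: regular_mulmx.
Qed.

Lemma regular_trilinear (T : ('I_n -> K) -> 'I_3 -> 'I_3 -> 'I_3 -> {poly K})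
    (p q r : ('I_n -> K) -> 'rV[{poly K}]_3) :
    (forall i j k, regular (fun v => T v i j k)) ->
    regular_mx v0 p -> regular_mx v0 q -> regular_mx v0 r ->
  regular (fun v => trilinear (T v) (p v) (q v) (r v)).
Proof.
move=> rT rp rq rr; apply: regular_sum => i; apply: regular_sum => j; apply: regular_sum => k.
by apply: regularM => //; apply: regularM => //; apply: regularM.
Qed.

Let reg2 (f : ('I_n -> K) -> {poly K} * {poly K}) :=
  regular (fun v => (f v).1) /\ regular (fun v => (f v).2).

Let reg2D f g : reg2 f -> reg2 g -> reg2 (fun v => f v + g v).
Proof. by move=> [f1 f2] [g1 g2]; split; apply: regularD. Qed.

Let reg2B f g : reg2 f -> reg2 g -> reg2 (fun v => f v - g v).
Proof. by move=> [f1 f2] [g1 g2]; split; apply: regularB. Qed.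

Let reg2M b c f g : regular b -> regular c -> reg2 f -> reg2 g ->
  reg2 (fun v => quad_mul (b v) (c v) (f v) (g v)).
Proof.
move=> rb rc [f1 f2] [g1 g2]; split => /=.
  by apply: regularB; [|apply: regularM => //]; apply: regularM.
apply: regularD; first by apply: regularD; apply: regularM.
by apply: regularM; apply: regularM => //; apply: regular_const.
Qed.

Let reg2C f : regular f -> reg2 (fun v => (f v, 0)).
Proof. by move=> rf; split => //=; apply: regular_const. Qed.

Let regular_row3 x y' z : regular x -> regular y' -> regular z ->
  regular_mx v0 (fun v => row3 (x v) (y' v) (z v)).
Proof.
move=> rx ry rz i j; elim/ord3_ind: j.
- by apply: (@eq_regular _ _ _ x) => // v; rewrite mxE.
- by apply: (@eq_regular _ _ _ y') => // v; rewrite mxE.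
- by apply: (@eq_regular _ _ _ z) => // v; rewrite mxE.
Qed.

Lemma regular_flex_disc : regular (fun v => flex_disc (T1 v) (T2 v) (D v) (D' v) (s v)).
Proof.
have rc k : regular (fun=> k) by apply: regular_const.
have rP1 : regular_mx v0 (fun v => row3 (- l v 0 i1) (l v 0 i0) 0).
  by apply: regular_row3 => //; apply: regularN.
have rP2 : regular_mx v0 (fun v => row3 (- l v 0 i2) 0 (l v 0 i0)).
  by apply: regular_row3 => //; apply: regularN.
have rd : regular_mx v0 (fun=> delta_mx 0 i0 : 'rV[{poly K}]_3).
  by move=> i j; apply: regular_const.
have ra := regular_y 0 (ix2 i1 i1); have rb := regular_y 0 (ix2 i1 i2).
have rcc := regular_y 0 (ix2 i2 i2).
have rac : regular (fun v => y v 0 (ix2 i1 i1) * y v 0 (ix2 i2 i2)) by apply: regularM.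
have rnu : reg2 (fun=> (0, 1)) by split.
have rcub T : (forall i j k, regular (fun v => T v i j k)) -> reg2 (fun v =>
    quad_cubic (row3 (- l v 0 i1) (l v 0 i0) 0) (row3 (- l v 0 i2) 0 (l v 0 i0))
      (y v 0 (ix2 i1 i1)) (y v 0 (ix2 i1 i2)) (y v 0 (ix2 i2 i2)) (T v)).
  move=> rT; apply: reg2D; last by apply/reg2C/regularM/regularX => //; apply: regular_trilinear.
  apply: reg2M => //; apply: reg2D; last first.
    by apply/reg2C/regularM => //; apply/regularM/regularX => //; apply: regular_trilinear.
  apply: reg2M => //; split => /=; last exact: regular_trilinear.
  by apply/regularM => //; apply/regularM => //; apply: regular_trilinear.
have rder T : (forall i j k, regular (fun v => T v i j k)) -> reg2 (fun v =>
    quad_deriv (row3 (- l v 0 i1) (l v 0 i0) 0) (row3 (- l v 0 i2) 0 (l v 0 i0)) (delta_mx 0 i0)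
      (y v 0 (ix2 i1 i1)) (y v 0 (ix2 i1 i2)) (y v 0 (ix2 i2 i2)) (T v)).
  move=> rT; apply: reg2D; last by apply/reg2C/regularM/regularX => //; apply: regular_trilinear.
  apply: reg2M => //; split => /=; last exact: regular_trilinear.
  by apply/regularM => //; apply/regularM => //; apply: regular_trilinear.
rewrite /flex_disc; apply: regularM; last first.
  have [s1 s2] : reg2 (fun v => quad_mul (y v 0 (ix2 i1 i2)) (y v 0 (ix2 i1 i1) * y v 0 (ix2 i2 i2))
      (quad_cubic (row3 (- l v 0 i1) (l v 0 i0) 0) (row3 (- l v 0 i2) 0 (l v 0 i0))
         (y v 0 (ix2 i1 i1)) (y v 0 (ix2 i1 i2)) (y v 0 (ix2 i2 i2)) (T2 v))
      (quad_deriv (row3 (- l v 0 i1) (l v 0 i0) 0) (row3 (- l v 0 i2) 0 (l v 0 i0)) (delta_mx 0 i0)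
         (y v 0 (ix2 i1 i1)) (y v 0 (ix2 i1 i2)) (y v 0 (ix2 i2 i2)) (T1 v))
      - quad_mul (y v 0 (ix2 i1 i2)) (y v 0 (ix2 i1 i1) * y v 0 (ix2 i2 i2))
      (quad_cubic (row3 (- l v 0 i1) (l v 0 i0) 0) (row3 (- l v 0 i2) 0 (l v 0 i0))
         (y v 0 (ix2 i1 i1)) (y v 0 (ix2 i1 i2)) (y v 0 (ix2 i2 i2)) (T1 v))
      (quad_deriv (row3 (- l v 0 i1) (l v 0 i0) 0) (row3 (- l v 0 i2) 0 (l v 0 i0)) (delta_mx 0 i0)
         (y v 0 (ix2 i1 i1)) (y v 0 (ix2 i1 i2)) (y v 0 (ix2 i2 i2)) (T2 v))).
    by apply: reg2B; apply: reg2M => //; [apply: rcub | apply: rder | apply: rcub | apply: rder].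
  apply: regularD; last by apply/regularM/regularX.
  by apply: regularD; [apply: regularX | apply: regularM; apply: regularM].
have tri := regular_trilinear.
apply: regularM; last first.
  apply: regularB; last by apply: regularM; apply: tri.
  apply: regularD; last by apply: regularM => //; apply: regularM; apply: tri.
  apply: regularB; first by apply: regularM; apply: tri.
  by apply: regularM => //; apply: regularM; apply: tri.
apply: regularM; first exact: regularM (regular_l _ _) rcc.
by apply: regularB => //; apply: regularX.
Qed.

End Flex.
End RegularFlex.

(** * Genericity is an open condition *)

Section NearGeneric.
Variables (K : numClosedFieldType) (n : nat) (v0 : 'I_n -> K).
Notation regular := (regular v0).
Notation regularC := (regularC v0).

Lemma regularC_row_mx m p1 p2 (A : ('I_n -> K) -> 'M[K]_(m, p1)) (B : ('I_n -> K) -> 'M[K]_(m, p2))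
    :
  regularC_mx v0 A -> regularC_mx v0 B -> regularC_mx v0 (fun v => row_mx (A v) (B v)).
Proof.
move=> rA rB i j; case: (split_ordP j) => k ->.
  by apply: eq_regularC (rA i k) => v; rewrite row_mxEl.
by apply: eq_regularC (rB i k) => v; rewrite row_mxEr.
Qed.

Lemma regularC_usubmx m1 m2 p (A : ('I_n -> K) -> 'M[K]_(m1 + m2, p)) :
  regularC_mx v0 A -> regularC_mx v0 (fun v => usubmx (A v)).
Proof. by move=> rA i j; apply: eq_regularC (rA (lshift m2 i) j) => v; rewrite [RHS]mxE. Qed.

Lemma regularC_dsubmx m1 m2 p (A : ('I_n -> K) -> 'M[K]_(m1 + m2, p)) :
  regularC_mx v0 A -> regularC_mx v0 (fun v => dsubmx (A v)).
Proof. by move=> rA i j; apply: eq_regularC (rA (rshift m1 i) j) => v; rewrite [RHS]mxE. Qed.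

Lemma regularC_slice_mx (r : ('I_n -> K) -> 'I_3 -> 'M[K]_3) :
  (forall i, regularC_mx v0 (fun v => r v i)) -> regularC_mx v0 (fun v => slice_mx (r v)).
Proof.
move=> rr c x; case/mxvec_indexP: x => i u.
apply: (@eq_regularC _ _ _ (fun v => slice (delta_mx 0 c) (r v i) (fst2 u) (snd2 u))) => [v|].
  by rewrite [RHS]mxE mxvecE [RHS]mxE.
apply: regularC_sum => j; apply: regularC_sum => k.
by apply: regularC_M; [apply: rr | apply: regularC_const].
Qed.

Lemma regularC_koszul (r : ('I_n -> K) -> 'I_3 -> 'M[K]_3) :
  (forall i, regularC_mx v0 (fun v => r v i)) -> regularC_mx v0 (fun v => koszul (r v)).
Proof.
move=> rr x t; case/mxvec_indexP: x => i u.
have rc j : regularC (fun v => coef2 (r v j) u).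
  by apply: regularC_sum => a; apply: regularC_sum => b; apply: regularC_Mn; apply: rr.
apply: (@eq_regularC _ _ _ (fun v => coef2 (r v (snd_pair t)) u *+ (i == fst_pair t)
    - coef2 (r v (fst_pair t)) u *+ (i == snd_pair t))) => [v|].
  by rewrite [RHS]mxE mxvecE [RHS]mxE.
by apply: regularC_D; [|apply: regularC_N]; apply: regularC_Mn.
Qed.

(** A left inverse at [v0], multiplied by the nearby matrix, stays invertible, and so remains a left
    inverse after correction. *)
Lemma near_row_full m p (A : ('I_n -> K) -> 'M[K]_(m, p)) :
  regularC_mx v0 A -> row_full (A v0) -> near v0 (fun v => row_full (A v)).
Proof.
move=> rA /row_fullP[B BA].
have rBA : regularC_mx v0 (fun v => B *m A v).
  by apply: regularC_mulmx => //; apply: regularC_mx_const.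
apply: near_sub (near_unitmx rBA _) => [v /mulVmx E|]; last by rewrite BA unitmx1.
by apply/row_fullP; exists (invmx (B *m A v) *m B); rewrite -mulmxA.
Qed.

Variables (T1 T2 : ('I_n -> K) -> 'I_3 -> 'I_3 -> 'I_3 -> K).
Hypotheses (rT1 : forall i j k, regularC (fun v => T1 v i j k))
  (rT2 : forall i j k, regularC (fun v => T2 v i j k)).

Lemma near_generic_pencil S J : generic_pencil (T1 v0) (T2 v0) S J ->
  near v0 (fun v => exists S', generic_pencil (T1 v) (T2 v) S' J).
Proof.
move=> [uC rS kr uJ disc].
have rcontr T : (forall i j k, regularC (fun v => T v i j k)) ->
    regularC_mx v0 (fun v => contraction (T v)).
  move=> rT m k; apply: (@eq_regularC _ _ _ (fun v => \sum_i \sum_j T v i j k *+ (ix2 i j == m))).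
    by move=> v; rewrite mxE.
  by apply: regularC_sum => i; apply: regularC_sum => j; apply: regularC_Mn.
have rC : regularC_mx v0 (fun v => contraction2 (T1 v) (T2 v)).
  by apply: regularC_row_mx; apply: rcontr.
have rD : regularC_mx v0 (fun v => pencil_inv (T1 v) (T2 v)) by apply: regularC_invmx.
have rconic (D : ('I_n -> K) -> 'M[K]_(3, 6)) i : regularC_mx v0 D ->
    regularC_mx v0 (fun v => conic_of (D v) i).
  by move=> rD' j k; apply: eq_regularC (rD' k (ix2 i j)) => v; rewrite [RHS]mxE.
have rDl : regularC_mx v0 (fun v => usubmx (pencil_inv (T1 v) (T2 v))).
  exact: regularC_usubmx rD.
have rDr : regularC_mx v0 (fun v => dsubmx (pencil_inv (T1 v) (T2 v))).
  exact: regularC_dsubmx rD.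
have rr i : regularC_mx v0 (fun v => pencil_conicl (T1 v) (T2 v) i) by apply: rconic.
have rq i : regularC_mx v0 (fun v => pencil_conicr (T1 v) (T2 v) i) by apply: rconic.
have rR := regularC_slice_mx rr; have rQ := regularC_slice_mx rq.
have rk := regularC_koszul rr.
pose N v := slice_mx (pencil_conicl (T1 v) (T2 v)) *m S.
have rN : regularC_mx v0 N by apply: regularC_mulmx => //; apply: regularC_mx_const.
have uN : N v0 \in unitmx by rewrite /N rS unitmx1.
(* The right inverse at [v0] is corrected so as to be a right inverse nearby, rationally in v; [J]
   stays constant. *)
pose S' v := S *m invmx (N v).
have rS' : regularC_mx v0 S'.
  by apply: regularC_mulmx; [apply: regularC_mx_const | apply: regularC_invmx].
have S'0 : S' v0 = S by rewrite /S' /N rS invmx1 mulmx1.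
pose Mn v := minors_mx (pencil_conicl (T1 v) (T2 v)) (pencil_conicr (T1 v) (T2 v)).
have rM : regularC_mx v0 Mn by apply: regularC_mulmx.
pose MJ v : 'M_(3 + 12) := row_mx (Mn v) J.
have rMJ : regularC_mx v0 MJ by apply: regularC_row_mx rM _; apply: regularC_mx_const.
have rI : regularC_mx v0 (fun v => invmx (MJ v)) by apply: regularC_invmx.
pose X v := pencil_shift (T1 v) (T2 v) (S' v) J.
have rX : regularC_mx v0 X.
  apply: regularC_mulmx; last exact: regularC_mx_const.
  apply: regularC_mulmx; first exact: regularC_dsubmx rI.
  move=> i j; apply: (@eq_regularC _ _ _ (fun v =>
     - (slice_mx (pencil_conicr (T1 v) (T2 v)) *m S' v) i j)) => [v|].
    by rewrite [RHS]mxE.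
  by apply: regularC_N; apply: regularC_mulmx.
(* Both conditions at the eigenvalues are combined into one polynomial in the eigenvalue, with
   regular coefficients. *)
pose h v := (char_poly (X v))^`() * flex_disc (fun i j k => (T1 v i j k)%:P)
  (fun i j k => (T2 v i j k)%:P) (map_mx polyC (usubmx (pencil_inv (T1 v) (T2 v))))
  (map_mx polyC (dsubmx (pencil_inv (T1 v) (T2 v)))) 'X.
have rh : regular h.
  apply: regularM; first exact/regular_deriv/regular_char_poly.
  apply: regular_flex_disc => //; try exact: regularC_mxE.
  exact: regular_const.
have hE v a : (h v).[a] = (char_poly (X v))^`().[a] * flex_disc (T1 v) (T2 v)
    (usubmx (pencil_inv (T1 v) (T2 v))) (dsubmx (pencil_inv (T1 v) (T2 v))) a.
  rewrite /h hornerM; congr (_ * _).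
  have mC (A : 'M[K]_(3, 6)) : map_mx (horner_eval a) (map_mx polyC A) = A.
    by apply/matrixP => i j; rewrite !mxE /horner_eval hornerC.
  rewrite -[LHS]/(horner_eval a _) -(map_flex_disc (phi := horner_eval a)
    (T1' := T1 v) (T2' := T2 v)); first by rewrite !mC /= /horner_eval hornerX.
    by move=> i j k; rewrite /= /horner_eval hornerC.
  by move=> i j k; rewrite /= /horner_eval hornerC.
have h0 a : root (char_poly (X v0)) a -> (h v0).[a] != 0.
  rewrite hE /X S'0 => /disc[d1 d2]; exact: mulf_neq0.
have := near_and (near_unitmx rC uC) (near_and (near_unitmx rN uN) (near_and
  (near_row_full rk kr) (near_and (near_unitmx rMJ uJ) (near_root_horner_neq0 rX rh h0)))).
apply: near_sub => v [uCv [uNv [kv [uMv hv]]]]; exists (S' v).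
have SE : slice_mx (pencil_conicl (T1 v) (T2 v)) *m S' v = 1%:M by rewrite mulmxA mulmxV.
split; [exact: uCv | exact: SE | exact: kv | exact: uMv |].
by move=> a /hv; rewrite hE mulf_eq0 negb_or => /andP.
Qed.

End NearGeneric.

(** * The base pencil *)

Section Values.
Variable K : numClosedFieldType.
Variables (T1 T2 : 'I_3 -> 'I_3 -> 'I_3 -> K).
(** The tensors of 2 (x^3 + y^3 - z^3) and of 3 (x^2 y + y^2 z + z^2 x). *)
Hypothesis T1E : forall i j k,
  T1 i j k = [:: 2; 0; 0; 0; 0; 0; 2; 0; 0; -2]`_(rank_of [:: i; j; k]).
Hypothesis T2E : forall i j k,
  T2 i j k = [:: 0; 1; 0; 0; 0; 1; 0; 1; 0; 0]`_(rank_of [:: i; j; k]).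

Lemma trilinear_T1 p q r : trilinear T1 p q r = 2 * (p 0 i0 * q 0 i0 * r 0 i0
  + p 0 i1 * q 0 i1 * r 0 i1 - p 0 i2 * q 0 i2 * r 0 i2).
Proof. by rewrite /trilinear !sum3 !T1E /=; ring. Qed.

Lemma trilinear_T2 p q r : trilinear T2 p q r =
    p 0 i0 * q 0 i0 * r 0 i1 + p 0 i0 * q 0 i1 * r 0 i0 + p 0 i1 * q 0 i0 * r 0 i0
  + (p 0 i1 * q 0 i1 * r 0 i2 + p 0 i1 * q 0 i2 * r 0 i1 + p 0 i2 * q 0 i1 * r 0 i1)
  + (p 0 i2 * q 0 i2 * r 0 i0 + p 0 i2 * q 0 i0 * r 0 i2 + p 0 i0 * q 0 i2 * r 0 i2).
Proof. by rewrite /trilinear !sum3 !T2E /=; ring. Qed.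

(* At the root [s] of the characteristic polynomial, the base pencil has the solution
   [l = (s^2, - (k^2 - 2k + 2), s (k^2 - k + 2))] with [k] and [s] related as below.
   Values are reduced modulo these two relations; the cofactors [A] and [B] come
   from polynomial division. Large numerals are written in base 1000. *)
Section AtSolution.
Variables (k s t : K).
Hypothesis kE : k ^+ 4 - k ^+ 3 + 2 * k ^+ 2 + 2 = 0.
Hypothesis sE : s ^+ 3 - (k ^+ 3 - 2 * k ^+ 2 + 2 * k) = 0.

Lemma eq_mod_relations (x y A B : K) :
  x - y = A * (k ^+ 4 - k ^+ 3 + 2 * k ^+ 2 + 2) + B * (s ^+ 3 - (k ^+ 3 - 2 * k ^+ 2 + 2 * k)) ->
  x = y.
Proof. by rewrite kE sE !mulr0 addr0 => /eqP; rewrite subr_eq0 => /eqP. Qed.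

(** The line is 4 t times the solution, for a scale t left free; the 4 clears the denominators of a,
    b and c. *)
Let P1 : 'rV[K]_3 := row3 (- (4 * t * (- (k ^+ 2) + 2 * k - 2))) (4 * t * s ^+ 2) 0.
Let P2 : 'rV[K]_3 := row3 (- (4 * t * s * (k ^+ 2 - k + 2))) 0 (4 * t * s ^+ 2).
Let d : 'rV[K]_3 := row3 1 0 0.
Let a := 2 * t * s * (- (k ^+ 2) + 2 * k - 2).
Let b := t * (- (k ^+ 3) + 2 * k - 4).
Let c := 2 * t * s ^+ 2 * (- (k ^+ 2) + k - 2).

(** The [val_f] and [val_g] with an index are the coefficients of the binary cubics cut on the line
    by the two forms, and the [val_fn] and [val_gn] those of their derivatives along d. *)
Lemma val_f0 : trilinear T1 P1 P1 P1 = 2 ^+ 8 * t ^+ 3 * (- (5 * k ^+ 3) + 4 * k ^+ 2 - 4 * k - 10).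
Proof.
  rewrite trilinear_T1 !row3E.
  apply: (eq_mod_relations (A := 2 ^+ 8 * t ^+ 3 * (k ^+ 2 - 4 * k + 7)) (B := 2 ^+ 7 * t ^+ 3 * (k
      ^+ 3 - 2 * k ^+ 2 + 2 * k + s ^+ 3))); ring.
Qed.

Lemma val_f1 : trilinear T1 P1 P1 P2 = 2 ^+ 8 * t ^+ 3 * s * (4 * k ^+ 3 - 5 * k ^+ 2 + 6 * k + 4).
Proof.
  rewrite trilinear_T1 !row3E.
  apply: (eq_mod_relations (A := 2 ^+ 7 * t ^+ 3 * s * (- (k ^+ 2) + 4 * k - 8)) (B := 0)); ring.
Qed.

Lemma val_f2 : trilinear T1 P1 P2 P2 = 2 ^+ 8 * t ^+ 3 * s ^+ 2 * (- (3 * k ^+ 3) + 4 * k ^+ 2 - 5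
    * k - 2).
Proof.
  rewrite trilinear_T1 !row3E.
  apply: (eq_mod_relations (A := 2 ^+ 7 * t ^+ 3 * s ^+ 2 * (k ^+ 2 - 3 * k + 6)) (B := 0)); ring.
Qed.

Lemma val_f3 : trilinear T1 P2 P2 P2 = 2 ^+ 7 * t ^+ 3 * (3 * k ^+ 3 - 12 * k ^+ 2 + 18 * k - 14).
Proof.
  rewrite trilinear_T1 !row3E.
  apply: (eq_mod_relations (A := 2 ^+ 7 * t ^+ 3 * (- (k ^+ 5) + 4 * k ^+ 4 - 11 * k ^+ 3 + 17 * k
      ^+ 2 - 17 * k + 7)) (B := 2 ^+ 7 * t ^+ 3 * (- (k ^+ 6) + 3 * k ^+ 5 - 9 * k ^+ 4 + 12 * k ^+
      3 - 16 * k ^+ 2 + 10 * k - 8 - s ^+ 3))); ring.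
Qed.

Lemma val_fn0 : trilinear T1 P1 P1 d = 2 ^+ 5 * t ^+ 2 * (- (3 * k ^+ 3) + 6 * k ^+ 2 - 8 * k + 2).
Proof.
  rewrite trilinear_T1 !row3E.
  apply: (eq_mod_relations (A := 2 ^+ 5 * t ^+ 2) (B := 0)); ring.
Qed.

Lemma val_fn1 : trilinear T1 P1 P2 d = 2 ^+ 6 * t ^+ 2 * s * (k ^+ 3 - 2 * k ^+ 2 + 3 * k - 1).
Proof.
  rewrite trilinear_T1 !row3E.
  apply: (eq_mod_relations (A := 2 ^+ 5 * t ^+ 2 * s * (- 1)) (B := 0)); ring.
Qed.

Lemma val_fn2 : trilinear T1 P2 P2 d = 2 ^+ 5 * t ^+ 2 * s ^+ 2 * (- (k ^+ 3) + 3 * k ^+ 2 - 4 * k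
    + 2).
Proof.
  rewrite trilinear_T1 !row3E.
  apply: (eq_mod_relations (A := 2 ^+ 5 * t ^+ 2 * s ^+ 2) (B := 0)); ring.
Qed.

Lemma val_g0 : trilinear T2 P1 P1 P1 = 2 ^+ 6 * 3 * t ^+ 3 * s ^+ 2 * (- (3 * k ^+ 3) + 6 * k ^+ 2
    - 8 * k + 2).
Proof.
  rewrite trilinear_T2 !row3E.
  apply: (eq_mod_relations (A := 2 ^+ 6 * 3 * t ^+ 3 * s ^+ 2) (B := 0)); ring.
Qed.

Lemma val_g1 : trilinear T2 P1 P1 P2 = 2 ^+ 6 * t ^+ 3 * (- (3 * k ^+ 3) - 12 * k ^+ 2 + 22 * k -
    38).
Proof.
  rewrite trilinear_T2 !row3E.
  apply: (eq_mod_relations (A := 2 ^+ 6 * t ^+ 3 * (- (2 * k ^+ 3) + 9 * k ^+ 2 - 19 * k + 19)) (B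
      := 2 ^+ 6 * t ^+ 3 * (- (2 * k ^+ 4) + 7 * k ^+ 3 - 14 * k ^+ 2 + 14 * k - 8 + s ^+ 3)));
      ring.
Qed.

Lemma val_g2 : trilinear T2 P1 P2 P2 = 2 ^+ 6 * t ^+ 3 * s * (5 * k ^+ 3 - 2 * k + 18).
Proof.
  rewrite trilinear_T2 !row3E.
  apply: (eq_mod_relations (A := 2 ^+ 6 * t ^+ 3 * s * (k ^+ 3 - 3 * k ^+ 2 + 7 * k - 9)) (B := 2
      ^+ 6 * t ^+ 3 * s * (k ^+ 4 - 2 * k ^+ 3 + 6 * k ^+ 2 - 6 * k + 6))); ring.
Qed.

Lemma val_g3 : trilinear T2 P2 P2 P2 = 2 ^+ 7 * 3 * t ^+ 3 * s ^+ 2 * (- (k ^+ 3) + k ^+ 2 - k - 2).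
Proof.
  rewrite trilinear_T2 !row3E.
  apply: (eq_mod_relations (A := 2 ^+ 6 * 3 * t ^+ 3 * s ^+ 2 * (- k + 2)) (B := 2 ^+ 6 * 3 * t ^+
      3 * s ^+ 2 * (- (k ^+ 2) + k - 2))); ring.
Qed.

Lemma val_gn0 : trilinear T2 P1 P1 d = 2 ^+ 5 * t ^+ 2 * s ^+ 2 * (k ^+ 2 - 2 * k + 2).
Proof.
  rewrite trilinear_T2 !row3E.
  apply: (eq_mod_relations (A := 0) (B := 0)); ring.
Qed.

Lemma val_gn1 : trilinear T2 P1 P2 d = 2 ^+ 5 * t ^+ 2 * (- (k ^+ 3) + k ^+ 2 - k - 2).
Proof.
  rewrite trilinear_T2 !row3E.
  apply: (eq_mod_relations (A := 2 ^+ 4 * t ^+ 2 * (- k + 2)) (B := 2 ^+ 4 * t ^+ 2 * (- (k ^+ 2) +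
      k - 2))); ring.
Qed.

Lemma val_gn2 : trilinear T2 P2 P2 d = 2 ^+ 4 * t ^+ 2 * s * (k ^+ 3 - 2 * k ^+ 2 + 2 * k).
Proof.
  rewrite trilinear_T2 !row3E.
  apply: (eq_mod_relations (A := 0) (B := 2 ^+ 4 * t ^+ 2 * s)); ring.
Qed.

Lemma val_cf : quad_cubic P1 P2 a b c T1 =
  (2 ^+ 12 * t ^+ 6 * (641 * k ^+ 3 - 772 * k ^+ 2 + 926 * k + 670),
   2 ^+ 10 * 3 * t ^+ 5 * (59 * k ^+ 3 - 12 * k ^+ 2 - 14 * k + 194)).
Proof.
rewrite /quad_cubic /quad_mul val_f0 val_f1 val_f2 val_f3 /= /a /b /c.
congr (_, _) => /=.
- apply: (eq_mod_relations (A := 2 ^+ 10 * t ^+ 6 * (21 * k ^+ 11 - 168 * k ^+ 10 + 707 * k ^+ 9 -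
    (1 * 10 ^+ 3 + 930) * k ^+ 8 + (3 * 10 ^+ 3 + 704) * k ^+ 7 - (4 * 10 ^+ 3 + 984) * k ^+ 6 + (4
    * 10 ^+ 3 + 264) * k ^+ 5 - (1 * 10 ^+ 3 + 52) * k ^+ 4 - (2 * 10 ^+ 3 + 820) * k ^+ 3 + (4 *
    10 ^+ 3 + 324) * k ^+ 2 - (2 * 10 ^+ 3 + 172) * k - (1 * 10 ^+ 3 + 340))) (B := 2 ^+ 10 * t ^+
    6 * (21 * k ^+ 12 - 147 * k ^+ 11 + 581 * k ^+ 10 - (1 * 10 ^+ 3 + 517) * k ^+ 9 + 21 * s ^+ 3
    * k ^+ 9 + (2 * 10 ^+ 3 + 894) * k ^+ 8 - 105 * s ^+ 3 * k ^+ 8 - (4 * 10 ^+ 3 + 62) * k ^+ 7 +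
    339 * s ^+ 3 * k ^+ 7 + (4 * 10 ^+ 3 + 158) * k ^+ 6 - 667 * s ^+ 3 * k ^+ 6 - (2 * 10 ^+ 3 +
    704) * k ^+ 5 + 954 * s ^+ 3 * k ^+ 5 + 444 * k ^+ 4 - 816 * s ^+ 3 * k ^+ 4 + (1 * 10 ^+ 3 +
    368) * k ^+ 3 + 358 * s ^+ 3 * k ^+ 3 - (1 * 10 ^+ 3 + 760) * k ^+ 2 + 276 * s ^+ 3 * k ^+ 2 +
    (1 * 10 ^+ 3 + 120) * k - 408 * s ^+ 3 * k - 320 + 304 * s ^+ 3))); ring.
- apply: (eq_mod_relations (A := 2 ^+ 10 * t ^+ 5 * (- (9 * k ^+ 9) + 57 * k ^+ 8 - 189 * k ^+ 7 +
    419 * k ^+ 6 - 683 * k ^+ 5 + 827 * k ^+ 4 - 683 * k ^+ 3 + 253 * k ^+ 2 + 205 * k - 371)) (B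
    := 2 ^+ 10 * t ^+ 5 * (- (9 * k ^+ 10) + 48 * k ^+ 9 - 150 * k ^+ 8 + 326 * k ^+ 7 - 9 * s ^+ 3
    * k ^+ 7 - 541 * k ^+ 6 + 30 * s ^+ 3 * k ^+ 6 + 724 * k ^+ 5 - 84 * s ^+ 3 * k ^+ 5 - 740 * k
    ^+ 4 + 120 * s ^+ 3 * k ^+ 4 + 566 * k ^+ 3 - 147 * s ^+ 3 * k ^+ 3 - 196 * k ^+ 2 + 78 * s ^+
    3 * k ^+ 2 - 44 * k - 36 * s ^+ 3 * k + 136 - 24 * s ^+ 3))); ring.
Qed.

Lemma val_cg : quad_cubic P1 P2 a b c T2 =
  (2 ^+ 10 * 3 * t ^+ 6 * s ^+ 2 * (267 * k ^+ 3 - 532 * k ^+ 2 + 738 * k - 190),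
   2 ^+ 8 * 3 * t ^+ 5 * s ^+ 2 * (173 * k ^+ 3 - 268 * k ^+ 2 + 350 * k + 46)).
Proof.
rewrite /quad_cubic /quad_mul val_g0 val_g1 val_g2 val_g3 /= /a /b /c.
congr (_, _) => /=.
- apply: (eq_mod_relations (A := 2 ^+ 9 * 3 * t ^+ 6 * s ^+ 2 * (2 * k ^+ 11 - 14 * k ^+ 10 + 53 *
    k ^+ 9 - 131 * k ^+ 8 + 223 * k ^+ 7 - 242 * k ^+ 6 + 62 * k ^+ 5 + 374 * k ^+ 4 - 942 * k ^+ 3
    + (1 * 10 ^+ 3 + 270) * k ^+ 2 - (1 * 10 ^+ 3 + 10) * k + 190)) (B := 2 ^+ 9 * 3 * t ^+ 6 * s
    ^+ 2 * (2 * k ^+ 12 - 12 * k ^+ 11 + 43 * k ^+ 10 - 102 * k ^+ 9 + 2 * s ^+ 3 * k ^+ 9 + 174 *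
    k ^+ 8 - 8 * s ^+ 3 * k ^+ 8 - 203 * k ^+ 7 + 26 * s ^+ 3 * k ^+ 7 + 102 * k ^+ 6 - 46 * s ^+ 3
    * k ^+ 6 + 176 * k ^+ 5 + 68 * s ^+ 3 * k ^+ 5 - 598 * k ^+ 4 - 50 * s ^+ 3 * k ^+ 4 + 928 * k
    ^+ 3 + 24 * s ^+ 3 * k ^+ 3 - 988 * k ^+ 2 + 32 * s ^+ 3 * k ^+ 2 + 656 * k - 32 * s ^+ 3 * k -
    272 + 32 * s ^+ 3))); ring.
- apply: (eq_mod_relations (A := 2 ^+ 8 * 3 * t ^+ 5 * s ^+ 2 * (8 * k ^+ 6 - 36 * k ^+ 5 + 84 * k
    ^+ 4 - 111 * k ^+ 3 + 59 * k ^+ 2 + 49 * k - 159)) (B := 2 ^+ 8 * 3 * t ^+ 5 * s ^+ 2 * (8 * k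
    ^+ 7 - 25 * k ^+ 6 + 67 * k ^+ 5 - 78 * k ^+ 4 + 76 * k ^+ 3 + 14 * k ^+ 2 - 36 * k + 64)));
    ring.
Qed.

Lemma val_df : quad_deriv P1 P2 d a b c T1 =
  (2 ^+ 8 * t ^+ 4 * (37 * k ^+ 3 - 16 * k ^+ 2 + 6 * k + 102),
   2 ^+ 6 * t ^+ 3 * (5 * k ^+ 3 + 16 * k ^+ 2 - 30 * k + 54)).
Proof.
rewrite /quad_deriv /quad_mul val_fn0 val_fn1 val_fn2 /= /a /b /c.
congr (_, _) => /=.
- apply: (eq_mod_relations (A := 2 ^+ 7 * t ^+ 4 * (- (k ^+ 9) + 8 * k ^+ 8 - 33 * k ^+ 7 + 91 * k
    ^+ 6 - 182 * k ^+ 5 + 270 * k ^+ 4 - 286 * k ^+ 3 + 186 * k ^+ 2 - 14 * k - 102)) (B := 2 ^+ 7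
    * t ^+ 4 * (- (k ^+ 10) + 7 * k ^+ 9 - 27 * k ^+ 8 + 72 * k ^+ 7 - s ^+ 3 * k ^+ 7 - 143 * k ^+
    6 + 5 * s ^+ 3 * k ^+ 6 + 220 * k ^+ 5 - 15 * s ^+ 3 * k ^+ 5 - 260 * k ^+ 4 + 29 * s ^+ 3 * k
    ^+ 4 + 234 * k ^+ 3 - 40 * s ^+ 3 * k ^+ 3 - 148 * k ^+ 2 + 38 * s ^+ 3 * k ^+ 2 + 60 * k - 24
    * s ^+ 3 * k - 8 + 8 * s ^+ 3))); ring.
- apply: (eq_mod_relations (A := 2 ^+ 6 * t ^+ 3 * (- (4 * k ^+ 4) + 16 * k ^+ 3 - 33 * k ^+ 2 + 41
    * k - 31)) (B := 2 ^+ 8 * t ^+ 3 * (- (k ^+ 5) + 3 * k ^+ 4 - 7 * k ^+ 3 + 8 * k ^+ 2 - 7 * k +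
    2))); ring.
Qed.

Lemma val_dg : quad_deriv P1 P2 d a b c T2 =
  (2 ^+ 8 * t ^+ 4 * s ^+ 2 * (11 * k ^+ 3 - 23 * k ^+ 2 + 32 * k - 10),
   2 ^+ 6 * t ^+ 3 * s ^+ 2 * (5 * k ^+ 3 - 8 * k ^+ 2 + 10 * k + 2)).
Proof.
rewrite /quad_deriv /quad_mul val_gn0 val_gn1 val_gn2 /= /a /b /c.
congr (_, _) => /=.
- apply: (eq_mod_relations (A := 2 ^+ 6 * t ^+ 4 * s ^+ 2 * (k ^+ 6 - 7 * k ^+ 5 + 26 * k ^+ 4 - 60
    * k ^+ 3 + 90 * k ^+ 2 - 80 * k + 20)) (B := 2 ^+ 6 * t ^+ 4 * s ^+ 2 * (k ^+ 7 - 6 * k ^+ 6 +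
    21 * k ^+ 5 - 46 * k ^+ 4 + 70 * k ^+ 3 - 72 * k ^+ 2 + 48 * k - 16))); ring.
- apply: (eq_mod_relations (A := 2 ^+ 6 * t ^+ 3 * s ^+ 2 * (k - 1)) (B := 0)); ring.
Qed.

Lemma val_w1 : quad_mul b (a * c) (quad_cubic P1 P2 a b c T2) (quad_deriv P1 P2 d a b c T1) =
  (2 ^+ 17 * 3 * t ^+ 10 * s ^+ 2 * (- ((5 * 10 ^+ 3 + 177) * k ^+ 3) - (126 * 10 ^+ 3 + 44) * k ^+
      2 + (213 * 10 ^+ 3 + 858) * k - (300 * 10 ^+ 3 + 326)),
   2 ^+ 15 * 3 * t ^+ 9 * s ^+ 2 * ((40 * 10 ^+ 3 + 173) * k ^+ 3 - (108 * 10 ^+ 3 + 84) * k ^+ 2 +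
       (157 * 10 ^+ 3 + 942) * k - (91 * 10 ^+ 3 + 106))).
Proof.
rewrite val_cg val_df /quad_mul /= /a /b /c.
congr (_, _) => /=.
- apply: (eq_mod_relations (A := 2 ^+ 16 * 3 * t ^+ 10 * s ^+ 2 * (- (865 * k ^+ 9) + (2 * 10 ^+ 3
    + 32) * k ^+ 8 + (6 * 10 ^+ 3 + 520) * k ^+ 7 - (58 * 10 ^+ 3 + 628) * k ^+ 6 + (188 * 10 ^+ 3
    + 602) * k ^+ 5 - (370 * 10 ^+ 3 + 30) * k ^+ 4 + (459 * 10 ^+ 3 + 258) * k ^+ 3 - (274 * 10 ^+
    3 + 354) * k ^+ 2 - (75 * 10 ^+ 3 + 522) * k + (261 * 10 ^+ 3 + 566))) (B := 2 ^+ 16 * 3 * t ^+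
    10 * s ^+ 2 * (- (865 * k ^+ 10) + (1 * 10 ^+ 3 + 167) * k ^+ 9 + (6 * 10 ^+ 3 + 822) * k ^+ 8
    - (49 * 10 ^+ 3 + 774) * k ^+ 7 + (145 * 10 ^+ 3 + 348) * k ^+ 6 - (281 * 10 ^+ 3 + 580) * k ^+
    5 + (365 * 10 ^+ 3 + 676) * k ^+ 4 - (335 * 10 ^+ 3 + 932) * k ^+ 3 + (187 * 10 ^+ 3 + 160) * k
    ^+ 2 - (55 * 10 ^+ 3 + 176) * k - (9 * 10 ^+ 3 + 936)))); ring.
- apply: (eq_mod_relations (A := 2 ^+ 15 * 3 * t ^+ 9 * s ^+ 2 * (- (865 * k ^+ 5) - (2 * 10 ^+ 3 +
    293) * k ^+ 4 + (8 * 10 ^+ 3 + 895) * k ^+ 3 + (5 * 10 ^+ 3 + 137) * k ^+ 2 - (29 * 10 ^+ 3 +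
    999) * k + (35 * 10 ^+ 3 + 17))) (B := 0)); ring.
Qed.

Lemma val_w2 : quad_mul b (a * c) (quad_cubic P1 P2 a b c T1) (quad_deriv P1 P2 d a b c T2) =
  (2 ^+ 19 * t ^+ 10 * s ^+ 2 * (- ((25 * 10 ^+ 3 + 843) * k ^+ 3) - (23 * 10 ^+ 3 + 716) * k ^+ 2
      + (54 * 10 ^+ 3 + 422) * k - (149 * 10 ^+ 3 + 282)),
   2 ^+ 17 * 3 * t ^+ 9 * s ^+ 2 * ((2 * 10 ^+ 3 + 625) * k ^+ 3 - (13 * 10 ^+ 3 + 124) * k ^+ 2 +
       (20 * 10 ^+ 3 + 462) * k - (19 * 10 ^+ 3 + 466))).
Proof.
rewrite val_cf val_dg /quad_mul /= /a /b /c.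
congr (_, _) => /=.
- apply: (eq_mod_relations (A := 2 ^+ 18 * t ^+ 10 * s ^+ 2 * (- (885 * k ^+ 9) + (5 * 10 ^+ 3 +
    136) * k ^+ 8 - (15 * 10 ^+ 3 + 312) * k ^+ 7 + (24 * 10 ^+ 3) * k ^+ 6 - (11 * 10 ^+ 3 + 214)
    * k ^+ 5 - (39 * 10 ^+ 3 + 582) * k ^+ 4 + (100 * 10 ^+ 3 + 74) * k ^+ 3 - (79 * 10 ^+ 3 + 586)
    * k ^+ 2 - (34 * 10 ^+ 3 + 718) * k + (135 * 10 ^+ 3 + 882))) (B := 2 ^+ 18 * 3 * t ^+ 10 * s
    ^+ 2 * (- (295 * k ^+ 10) + (1 * 10 ^+ 3 + 417) * k ^+ 9 - (3 * 10 ^+ 3 + 982) * k ^+ 8 + (5 *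
    10 ^+ 3 + 730) * k ^+ 7 - (3 * 10 ^+ 3 + 112) * k ^+ 6 - (7 * 10 ^+ 3 + 716) * k ^+ 5 + (19 *
    10 ^+ 3 + 660) * k ^+ 4 - (24 * 10 ^+ 3 + 924) * k ^+ 3 + (16 * 10 ^+ 3 + 8) * k ^+ 2 - (5 * 10
    ^+ 3 + 320) * k - (1 * 10 ^+ 3 + 552)))); ring.
- apply: (eq_mod_relations (A := 2 ^+ 17 * t ^+ 9 * s ^+ 2 * (- (885 * k ^+ 5) + 711 * k ^+ 4 + (2
    * 10 ^+ 3 + 403) * k ^+ 3 + (1 * 10 ^+ 3 + 313) * k ^+ 2 - (13 * 10 ^+ 3 + 405) * k + (22 * 10
    ^+ 3 + 391))) (B := 0)); ring.
Qed.

Lemma val_smooth : flex_smooth T1 T2 P1 P2 d a b c = 2 ^+ 38 * t ^+ 20 * s * (- ((((1 * 10 ^+ 3 +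
    32) * 10 ^+ 3 + 553) * 10 ^+ 3 + 97) * k ^+ 3) + ((653 * 10 ^+ 3 + 428) * 10 ^+ 3 + 900) * k ^+
    2 - ((504 * 10 ^+ 3 + 459) * 10 ^+ 3 + 518) * k - (((2 * 10 ^+ 3 + 395) * 10 ^+ 3 + 148) * 10
    ^+ 3 + 806)).
Proof.
  rewrite /flex_smooth val_w1 val_w2 /quad_norm /= /a /b /c.
  apply: (eq_mod_relations (A := 2 ^+ 32 * t ^+ 20 * s * ((((7 * 10 ^+ 3 + 924) * 10 ^+ 3 + 382) *
      10 ^+ 3 + 361) * k ^+ 12 - (((77 * 10 ^+ 3 + 236) * 10 ^+ 3 + 623) * 10 ^+ 3 + 198) * k ^+ 11
      + (((389 * 10 ^+ 3 + 233) * 10 ^+ 3 + 959) * 10 ^+ 3 + 102) * k ^+ 10 - ((((1 * 10 ^+ 3 +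
      281) * 10 ^+ 3 + 935) * 10 ^+ 3 + 949) * 10 ^+ 3 + 84) * k ^+ 9 + ((((3 * 10 ^+ 3) * 10 ^+ 3
      + 665) * 10 ^+ 3 + 800) * 10 ^+ 3 + 512) * k ^+ 8 - ((((5 * 10 ^+ 3 + 123) * 10 ^+ 3 + 655) *
      10 ^+ 3 + 947) * 10 ^+ 3 + 424) * k ^+ 7 + ((((6 * 10 ^+ 3 + 338) * 10 ^+ 3 + 949) * 10 ^+ 3
      + 137) * 10 ^+ 3 + 232) * k ^+ 6 - ((((5 * 10 ^+ 3 + 401) * 10 ^+ 3 + 26) * 10 ^+ 3 + 924) *
      10 ^+ 3 + 296) * k ^+ 5 + ((((2 * 10 ^+ 3 + 693) * 10 ^+ 3 + 516) * 10 ^+ 3 + 581) * 10 ^+ 3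
      + 576) * k ^+ 4 - (((185 * 10 ^+ 3 + 1) * 10 ^+ 3 + 486) * 10 ^+ 3 + 24) * k ^+ 3 - (((650 *
      10 ^+ 3 + 139) * 10 ^+ 3 + 436) * 10 ^+ 3 + 96) * k ^+ 2 + (((288 * 10 ^+ 3 + 876) * 10 ^+ 3
      + 33) * 10 ^+ 3 + 776) * k + (((76 * 10 ^+ 3 + 644) * 10 ^+ 3 + 761) * 10 ^+ 3 + 792))) (B :=
      2 ^+ 32 * t ^+ 20 * s * ((((7 * 10 ^+ 3 + 924) * 10 ^+ 3 + 382) * 10 ^+ 3 + 361) * k ^+ 13 -
      (((69 * 10 ^+ 3 + 312) * 10 ^+ 3 + 240) * 10 ^+ 3 + 837) * k ^+ 12 + (((327 * 10 ^+ 3 + 846)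
      * 10 ^+ 3 + 100) * 10 ^+ 3 + 626) * k ^+ 11 - ((((1 * 10 ^+ 3 + 31) * 10 ^+ 3 + 326) * 10 ^+
      3 + 471) * 10 ^+ 3 + 656) * k ^+ 10 + (((7 * 10 ^+ 3 + 924) * 10 ^+ 3 + 382) * 10 ^+ 3 + 361)
      * s ^+ 3 * k ^+ 10 + ((((2 * 10 ^+ 3 + 358) * 10 ^+ 3 + 573) * 10 ^+ 3 + 287) * 10 ^+ 3 +
      958) * k ^+ 9 - (((53 * 10 ^+ 3 + 463) * 10 ^+ 3 + 476) * 10 ^+ 3 + 115) * s ^+ 3 * k ^+ 9 -
      ((((4 * 10 ^+ 3 + 62) * 10 ^+ 3 + 867) * 10 ^+ 3 + 373) * 10 ^+ 3 + 272) * k ^+ 8 + (((205 *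
      10 ^+ 3 + 70) * 10 ^+ 3 + 383) * 10 ^+ 3 + 674) * s ^+ 3 * k ^+ 8 + ((((5 * 10 ^+ 3 + 399) *
      10 ^+ 3 + 523) * 10 ^+ 3 + 281) * 10 ^+ 3 + 424) * k ^+ 7 - (((514 * 10 ^+ 3 + 258) * 10 ^+ 3
      + 752) * 10 ^+ 3 + 78) * s ^+ 3 * k ^+ 7 - ((((5 * 10 ^+ 3 + 626) * 10 ^+ 3 + 378) * 10 ^+ 3
      + 545) * 10 ^+ 3 + 152) * k ^+ 6 + (((935 * 10 ^+ 3 + 554) * 10 ^+ 3 + 52) * 10 ^+ 3 + 412) *
      s ^+ 3 * k ^+ 6 + ((((4 * 10 ^+ 3 + 721) * 10 ^+ 3 + 969) * 10 ^+ 3 + 728) * 10 ^+ 3 + 208) *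
      k ^+ 5 - ((((1 * 10 ^+ 3 + 242) * 10 ^+ 3 + 971) * 10 ^+ 3 + 665) * 10 ^+ 3 + 524) * s ^+ 3 *
      k ^+ 5 - ((((3 * 10 ^+ 3 + 231) * 10 ^+ 3 + 187) * 10 ^+ 3 + 264) * 10 ^+ 3 + 320) * k ^+ 4 +
      ((((1 * 10 ^+ 3 + 221) * 10 ^+ 3 + 244) * 10 ^+ 3 + 437) * 10 ^+ 3 + 132) * s ^+ 3 * k ^+ 4 +
      ((((1 * 10 ^+ 3 + 693) * 10 ^+ 3 + 479) * 10 ^+ 3 + 502) * 10 ^+ 3 + 488) * k ^+ 3 - (((838 *
      10 ^+ 3 + 578) * 10 ^+ 3 + 369) * 10 ^+ 3 + 60) * s ^+ 3 * k ^+ 3 - (((383 * 10 ^+ 3 + 707) *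
      10 ^+ 3 + 817) * 10 ^+ 3 + 152) * k ^+ 2 + (((379 * 10 ^+ 3 + 743) * 10 ^+ 3 + 318) * 10 ^+ 3
      + 648) * s ^+ 3 * k ^+ 2 - (((279 * 10 ^+ 3 + 851) * 10 ^+ 3 + 620) * 10 ^+ 3 + 304) * k -
      (((82 * 10 ^+ 3 + 18) * 10 ^+ 3 + 776) * 10 ^+ 3 + 312) * s ^+ 3 * k + (((272 * 10 ^+ 3 +
      733) * 10 ^+ 3 + 329) * 10 ^+ 3 + 200) + (((6 * 10 ^+ 3 + 312) * 10 ^+ 3 + 620) * 10 ^+ 3 +
      304) * s ^+ 3))); ring.
Qed.

Lemma val_transvectant : flex_transvectant T1 T2 P1 P2 = 2 ^+ 13 * 3 * t ^+ 6 * s ^+ 2 * (59 * k ^+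
    3 - 12 * k ^+ 2 - 14 * k + 194).
Proof.
  rewrite /flex_transvectant val_f0 val_f1 val_f2 val_f3 val_g0 val_g1 val_g2 val_g3.
  apply: (eq_mod_relations (A := 2 ^+ 13 * 3 * t ^+ 6 * s ^+ 2 * (7 * k ^+ 2 + 15 * k - 39)) (B :=
      0)); ring.
Qed.

Lemma val_disc : b ^+ 2 - a * c = t ^+ 2 * (- (7 * k ^+ 3) - 4 * k ^+ 2 + 14 * k - 38).
Proof.
  rewrite /a /b /c.
  apply: (eq_mod_relations (A := t ^+ 2 * (- (4 * k ^+ 3) + 17 * k ^+ 2 - 31 * k + 27)) (B := 2 ^+
      2 * t ^+ 2 * (- (k ^+ 4) + 3 * k ^+ 3 - 6 * k ^+ 2 + 6 * k - 4))); ring.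
Qed.

End AtSolution.
End Values.

(** * The linear algebra of the base pencil *)

Section Base.
Variable K : numClosedFieldType.
Variables (T1 T2 : 'I_3 -> 'I_3 -> 'I_3 -> K).
Hypothesis T1E : forall i j k,
  T1 i j k = [:: 2; 0; 0; 0; 0; 0; 2; 0; 0; -2]`_(rank_of [:: i; j; k]).
Hypothesis T2E : forall i j k,
  T2 i j k = [:: 0; 1; 0; 0; 0; 1; 0; 1; 0; 0]`_(rank_of [:: i; j; k]).

Let n2 : (2 : K) != 0. Proof. by rewrite Num.Theory.pnatr_eq0. Qed.
(** With [base_r], the two blocks of the inverse contraction. The conics are r = x^2 / 2, y^2 / 2, -
    (z^2 + x y) / 2 and q = (x y + z^2) / 2, (y z + x^2) / 2, (x z + y^2) / 2. *)
Definition base_l : 'M[K]_(3, 6) := \matrix_(k, n)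
  (nth [::] [:: [:: 2^-1; 0; 0; 0; - 4^-1; 0];
                [:: 0; 0; - 4^-1; 2^-1; 0; 0];
                [:: 0; 4^-1; 0; 0; 0; - 2^-1]] k)`_n.

Definition base_r : 'M[K]_(3, 6) := \matrix_(k, n)
  (nth [::] [:: [:: 0; 2^-1; 0; 0; 0; 0];
                [:: 0; 0; 0; 0; 2^-1; 0];
                [:: 0; 0; 2^-1; 0; 0; 0]] k)`_n.

Let mul_contractionE (A : 'M[K]_(3, 6)) T i k :
  (A *m contraction T) i k = \sum_a \sum_b A i (ix2 a b) * T a b k.
Proof.
have -> : (A *m contraction T) i k = (row i A *m contraction T) 0 k.
  by rewrite -row_mul [RHS]mxE.
rewrite mul_contraction; apply: eq_bigr => a _; apply: eq_bigr => b _.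
by rewrite [X in X * _]mxE.
Qed.

Lemma base_mulD : col_mx base_l base_r *m contraction2 T1 T2 = 1%:M.
Proof.
rewrite mul_col_row scalar_mx_block; congr block_mx; apply/matrixP => i k;
  rewrite mul_contractionE !sum3 ?T1E ?T2E !mxE !val_ix2;
  elim/ord3_ind: i; elim/ord3_ind: k => /=; rewrite ?T1E ?T2E /=; by field.
Qed.

Lemma base_unit : contraction2 T1 T2 \in unitmx.
Proof. by case: (mulmx1_unit base_mulD). Qed.

Lemma base_inv : pencil_inv T1 T2 = col_mx base_l base_r.
Proof. by rewrite /pencil_inv -[LHS]mul1mx -base_mulD mulmxK // base_unit. Qed.

Lemma base_conicl : pencil_conicl T1 T2 = conic_of base_l.
Proof. by rewrite /pencil_conicl base_inv col_mxKu. Qed.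

Lemma base_conicr : pencil_conicr T1 T2 = conic_of base_r.
Proof. by rewrite /pencil_conicr base_inv col_mxKd. Qed.


Lemma ix4_swap i j a b : ix4 i j a b = ix4 j i a b.
Proof. by apply: ix4_perm; rewrite (perm_cat2r [:: a; b] [:: i; j] [:: j; i]) (perm_catC [:: i] [::
    j]). Qed.

Lemma slice_base_l phi a b : [/\
  slice phi (conic_of base_l i0) a b = 2^-1 * phi 0 (ix4 i0 i0 a b),
  slice phi (conic_of base_l i1) a b = 2^-1 * phi 0 (ix4 i1 i1 a b) &
  slice phi (conic_of base_l i2) a b = - 2^-1 * (phi 0 (ix4 i2 i2 a b) + phi 0 (ix4 i0 i1 a b))].
Proof.
rewrite /slice !sum3; split; rewrite ![conic_of _ _ _ _]mxE ![base_l _ _]mxE !val_ix2 /=.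
- by rewrite [ix4 i2 i1 _ _]ix4_swap; ring.
- by rewrite [ix4 i2 i0 _ _]ix4_swap; ring.
- by rewrite [ix4 i1 i0 _ _]ix4_swap; field.
Qed.

Lemma cval_base s l : [/\
  s * cval (conic_of base_l i0) l + cval (conic_of base_r i0) l = 2^-1 * (s * l 0 i0 ^+ 2 + l 0 i0
      * l 0 i1 + l 0 i2 ^+ 2),
  s * cval (conic_of base_l i1) l + cval (conic_of base_r i1) l = 2^-1 * (s * l 0 i1 ^+ 2 + l 0 i1
      * l 0 i2 + l 0 i0 ^+ 2) &
  s * cval (conic_of base_l i2) l + cval (conic_of base_r i2) l =
    2^-1 * (- s * (l 0 i2 ^+ 2 + l 0 i0 * l 0 i1) + l 0 i0 * l 0 i2 + l 0 i1 ^+ 2)].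
Proof.
rewrite /cval !sum3; split; rewrite ![conic_of _ _ _ _]mxE ![base_l _ _]mxE ![base_r _ _]mxE
    !val_ix2 /=;
  by field.
Qed.

Lemma pair3_base s eta a : let e i := s *: conic_of base_l i + conic_of base_r i in [/\
  pair3 eta (e i0) a = 2^-1 * (s * eta 0 (ix3 i0 i0 a) + eta 0 (ix3 i0 i1 a) + eta 0 (ix3 i2 i2 a)),
  pair3 eta (e i1) a = 2^-1 * (s * eta 0 (ix3 i1 i1 a) + eta 0 (ix3 i1 i2 a) + eta 0 (ix3 i0 i0 a))
      &
  pair3 eta (e i2) a = 2^-1 * (- s * (eta 0 (ix3 i2 i2 a) + eta 0 (ix3 i0 i1 a))
    + eta 0 (ix3 i0 i2 a) + eta 0 (ix3 i1 i1 a))].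
Proof.
have sw i j : ix3 i j a = ix3 j i a.
  by congr inord; apply: rank_of_perm; rewrite (perm_cat2r [:: a] [:: i; j] [:: j; i]) (perm_catC
      [:: i] [:: j]).
have eE i j k : (s *: conic_of base_l i + conic_of base_r i) j k = s * conic_of base_l i j k +
    conic_of base_r i j k by rewrite [LHS]mxE [X in X + _]mxE.
rewrite /= /pair3 !sum3; split; rewrite !eE ![conic_of _ _ _ _]mxE ![base_l _ _]mxE ![base_r _
    _]mxE !val_ix2 /=;
  rewrite ?[ix3 i1 i0 a]sw ?[ix3 i2 i0 a]sw ?[ix3 i2 i1 a]sw; by field.
Qed.

(** Every quartic lies in the ideal of x^2, y^2 and z^2 + x y: modulo it z^2 = - x y, so x y z^2, x
    z^3, y z^3 and then z^4 vanish. *)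
Lemma base_row_free : row_free (slice_mx (conic_of base_l)).
Proof.
apply: inj_row_free => phi /slice_mx_eq0 E.
have h0 : 2^-1 != 0 :> K by rewrite invr_eq0.
have E0 a b : phi 0 (ix4 i0 i0 a b) = 0.
  have [+ _ _] := slice_base_l phi a b; rewrite E => /esym/eqP.
  by rewrite mulf_eq0 (negbTE h0) => /eqP.
have E1 a b : phi 0 (ix4 i1 i1 a b) = 0.
  have [_ + _] := slice_base_l phi a b; rewrite E => /esym/eqP.
  by rewrite mulf_eq0 (negbTE h0) => /eqP.
have E2 a b : phi 0 (ix4 i2 i2 a b) = - phi 0 (ix4 i0 i1 a b).
  have [_ _ +] := slice_base_l phi a b; rewrite E => /esym/eqP.
  by rewrite mulf_eq0 oppr_eq0 (negbTE h0) addr_eq0 => /eqP.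
have p i j k m i' j' k' m' : perm_eq [:: i; j; k; m] [:: i'; j'; k'; m'] ->
    phi 0 (ix4 i j k m) = phi 0 (ix4 i' j' k' m') by move=> /ix4_perm->.
have E0122 : phi 0 (ix4 i0 i1 i2 i2) = 0.
  by rewrite (p _ _ _ _ i2 i2 i0 i1) // E2 (p _ _ _ _ i0 i0 i1 i1) // E0 oppr0.
have E0222 : phi 0 (ix4 i0 i2 i2 i2) = 0.
  by rewrite (p _ _ _ _ i2 i2 i0 i2) // E2 (p _ _ _ _ i0 i0 i1 i2) // E0 oppr0.
have E1222 : phi 0 (ix4 i1 i2 i2 i2) = 0.
  by rewrite (p _ _ _ _ i2 i2 i1 i2) // E2 (p _ _ _ _ i1 i1 i0 i2) // E1 oppr0.
have E2222 : phi 0 (ix4 i2 i2 i2 i2) = 0 by rewrite E2 E0122 oppr0.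
apply/rowP => c; rewrite mxE; have [i [j [k [m ->]]]] := ix4_surj c.
have Z := (E0, E1, E0122, E0222, E1222, E2222).
elim/ord3_ind: i; elim/ord3_ind: j; elim/ord3_ind: k; elim/ord3_ind: m;
  first [ by rewrite Z | by rewrite (p _ _ _ _ i0 i0 i0 i1) ?Z
        | by rewrite (p _ _ _ _ i0 i0 i0 i2) ?Z | by rewrite (p _ _ _ _ i0 i0 i1 i1) ?Z
        | by rewrite (p _ _ _ _ i0 i0 i1 i2) ?Z | by rewrite (p _ _ _ _ i0 i0 i2 i2) ?Z
        | by rewrite (p _ _ _ _ i1 i1 i1 i0) ?Z | by rewrite (p _ _ _ _ i1 i1 i2 i0) ?Z
        | by rewrite (p _ _ _ _ i1 i1 i1 i1) ?Z | by rewrite (p _ _ _ _ i1 i1 i1 i2) ?Z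
        | by rewrite (p _ _ _ _ i1 i1 i2 i2) ?Z | by rewrite (p _ _ _ _ i0 i1 i2 i2) ?Z
        | by rewrite (p _ _ _ _ i0 i2 i2 i2) ?Z | by rewrite (p _ _ _ _ i1 i2 i2 i2) ?Z
        | by rewrite (p _ _ _ _ i2 i2 i2 i2) ?Z ].
Qed.

End Base.

Section Base.
Variable K : numClosedFieldType.
Lemma coef2_base_l (a b : 'I_3) : [/\
  coef2 (conic_of (base_l K) i0) (ix2 a b) = [:: 2^-1; 0; 0; 0; 0; 0]`_(rank_of [:: a; b]),
  coef2 (conic_of (base_l K) i1) (ix2 a b) = [:: 0; 0; 0; 2^-1; 0; 0]`_(rank_of [:: a; b]) &
  coef2 (conic_of (base_l K) i2) (ix2 a b) = [:: 0; - 2^-1; 0; 0; 0; - 2^-1]`_(rank_of [:: a; b])].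
Proof.
rewrite /coef2 !sum3; split; rewrite -!(inj_eq val_inj) /= ![conic_of _ _ _ _]mxE ![base_l _ _
    _]mxE !val_ix2 /=;
  elim/ord3_ind: a; elim/ord3_ind: b; rewrite /= ?mulr0n ?mulr1n; by field.
Qed.

Lemma mul_delta_koszul (r : 'I_3 -> 'M[K]_3) i u (c : K) t :
  (mxvec (c *: delta_mx i u) *m koszul r) 0 t =
  c * coef2 (r (snd_pair t)) u *+ (fst_pair t == i) - c * coef2 (r (fst_pair t)) u *+ (snd_pair t
      == i).
Proof.
rewrite mul_koszul.
have E j (g : 'I_6 -> K) : \sum_v (c *: delta_mx i u : 'M[K]_(3, 6)) j v * g v = c * g u *+ (j ==
    i).
  rewrite (bigD1 u) //= 2!mxE eqxx andbT big1 ?addr0 => [|v /negbTE vu].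
    by case: (j == i); rewrite ?mulr0 ?mul0r ?mulr1.
  by rewrite 2!mxE vu andbF mulr0 mul0r.
by rewrite !E.
Qed.

(** The left inverse reads off three coefficients, that of y^2 in component 0 and those of z^2 in
    components 0 and 1; each is nonzero in exactly one of the three syzygies. *)
Lemma base_koszul_full : row_full (koszul (conic_of (base_l K))).
Proof.
apply/row_fullP; exists (\matrix_(i < 3) tnth [tuple mxvec (2 *: delta_mx i0 (ix2 i1 i1));
  mxvec (- 2 *: delta_mx i0 (ix2 i2 i2)); mxvec (- 2 *: delta_mx i1 (ix2 i2 i2))] i).
have [c00 c01 c02] := coef2_base_l i1 i1; have [d00 d01 d02] := coef2_base_l i2 i2.
apply/row_matrixP => i; rewrite row_mul rowK; apply/rowP => t; rewrite [RHS]mxE [RHS]mxE.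
by elim/ord3_ind: i; rewrite (tnth_nth 0) /= mul_delta_koszul; elim/ord3_ind: t;
  rewrite /fst_pair /snd_pair !(tnth_nth i0) /= ?c00 ?c01 ?c02 ?d00 ?d01 ?d02 /=; field.
Qed.

(* Selects the quartic monomials other than [x^4], [y^4] and [z^4]. *)
Definition base_J : 'M[K]_(15, 12) :=
  \matrix_(c, j) (c == nth 0%N [:: 1; 2; 3; 4; 5; 6; 7; 8; 9; 11; 12; 13] j :> nat)%:R.

(** Modulo the monomials selected by [base_J], the three minors are - x^4 / 4, - z^4 / 4 and - y^4 /
    4. *)
Lemma base_J_unit :
  (row_mx (minors_mx (conic_of (base_l K)) (conic_of (base_r K))) base_J : 'M_(3 + 12)) \in unitmx.
Proof.
rewrite -row_free_unit; apply: inj_row_free => phi.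
rewrite mul_mx_row -[0](@row_mx0 _ 1 3 12) => /eq_row_mx[phiM phiJ].
have J0 (j : 'I_12) (c : 'I_15) : c = nth 0%N [:: 1; 2; 3; 4; 5; 6; 7; 8; 9; 11; 12; 13] j :> nat
    -> phi 0 c = 0.
  move=> cE; have := congr1 (fun A : 'rV[K]_12 => A 0 j) phiJ; rewrite !mxE => <-.
  rewrite (bigD1 c) //= mxE -cE eqxx mulr1 big1 ?addr0 // => d dc.
  by rewrite mxE -cE (inj_eq val_inj) (negbTE dc) mulr0.
pose x := phi 0 (ix4 i0 i0 i0 i0); pose y := phi 0 (ix4 i1 i1 i1 i1); pose z := phi 0 (ix4 i2 i2 i2
    i2).
have phiE i j k m : phi 0 (ix4 i j k m) =
    [:: x; 0; 0; 0; 0; 0; 0; 0; 0; 0; y; 0; 0; 0; z]`_(rank_of [:: i; j; k; m]).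
  have p i' j' k' m' : perm_eq [:: i; j; k; m] [:: i'; j'; k'; m'] ->
    phi 0 (ix4 i j k m) = phi 0 (ix4 i' j' k' m') by move=> /ix4_perm->.
  have [E|] := boolP (index (rank_of [:: i; j; k; m]) [:: 1; 2; 3; 4; 5; 6; 7; 8; 9; 11; 12; 13]%N
      < 12)%N.
    rewrite (J0 (Ordinal E)) ?val_ix4 ?nth_index -?index_mem //.
    by move: E; elim/ord3_ind: i {p}; elim/ord3_ind: j; elim/ord3_ind: k; elim/ord3_ind: m.
  by elim/ord3_ind: i p; elim/ord3_ind: j; elim/ord3_ind: k; elim/ord3_ind: m.
have M t : (phi *m minors_mx (conic_of (base_l K)) (conic_of (base_r K))) 0 t = 0 by rewrite phiM
    mxE.
have P f s : pair4 phi (conic_of (base_r K) f) (conic_of (base_l K) s) =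
   \sum_a \sum_b conic_of (base_r K) f a b * slice phi (conic_of (base_l K) s) a b.
  by rewrite pair4C pair4_slice.
have sl a b := slice_base_l phi a b.
have s0 a b : slice phi (conic_of (base_l K) i0) a b = 2^-1 * phi 0 (ix4 i0 i0 a b) by case: (sl a
    b).
have s1 a b : slice phi (conic_of (base_l K) i1) a b = 2^-1 * phi 0 (ix4 i1 i1 a b) by case: (sl a
    b).
have s2 a b : slice phi (conic_of (base_l K) i2) a b = - 2^-1 * (phi 0 (ix4 i2 i2 a b) + phi 0 (ix4
    i0 i1 a b)).
  by case: (sl a b).
have D := M; rewrite /minors_mx in D.
have S t : (phi *m (slice_mx (conic_of (base_r K)) *m koszul (conic_of (base_l K)))) 0 t =
   pair4 phi (conic_of (base_r K) (fst_pair t)) (conic_of (base_l K) (snd_pair t))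
  - pair4 phi (conic_of (base_r K) (snd_pair t)) (conic_of (base_l K) (fst_pair t)).
  by rewrite mulmxA; exact: slice_koszul.
have := D i0; have := D i1; have := D i2; rewrite !S !P {S D M P sl}.
rewrite /fst_pair /snd_pair !(tnth_nth i0) /= !sum3 !s0 !s1 !s2 !phiE ![conic_of _ _ _ _]mxE
    ![base_r _ _ _]mxE !val_ix2 /=.
move=> Ey Ez Ex.
have x0 : x = 0 by transitivity (- 4 * 0 : K); [rewrite -Ex; field | exact: mulr0].
have y0 : y = 0 by transitivity (- 4 * 0 : K); [rewrite -Ey; field | exact: mulr0].
have z0 : z = 0 by transitivity (- 4 * 0 : K); [rewrite -Ez; field | exact: mulr0].
rewrite row_mx0; apply/rowP => c; rewrite mxE; have [i [j [k [m ->]]]] := ix4_surj c.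
rewrite phiE x0 y0 z0; by elim/ord3_ind: i; elim/ord3_ind: j; elim/ord3_ind: k; elim/ord3_ind: m.
Qed.

Lemma base_slice_inv : exists S, slice_mx (conic_of (base_l K)) *m S = 1%:M.
Proof. exact/row_freeP/base_row_free. Qed.

End Base.

(** * The eigenvalues of the base pencil *)

Lemma monic_eq_of_roots (K : closedFieldType) (p q : {poly K}) : p \is monic -> q \is monic ->
    size p = size q -> separable_poly p -> (forall a, root p a -> root q a) -> q = p.
Proof.
move=> pm qm spq sp pq; have [rs pE] := closed_field_poly_normal p.
rewrite (monicP pm) scale1r in pE.
have urs : uniq rs by rewrite -separable_prod_XsubC -pE.
rewrite [q](@all_roots_prod_XsubC _ _ rs) ?(monicP qm) ?scale1r -?pE //.
- by rewrite -spq pE size_prod_XsubC.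
- by apply/allP => a ars; apply: pq; rewrite pE root_prod_XsubC.
- by rewrite uniq_rootsE.
Qed.

Lemma divisor_neq0 (R : pzRingType) (x y c : R) : c != 0 -> x * y = c -> x != 0.
Proof. by move=> c0 xy; apply: contra_neq c0 => x0; rewrite -xy x0 mul0r. Qed.

Section Base.
Variable K : numClosedFieldType.
(** With v = s^3 a root of the quartic, k is another generator of the same quartic algebra, in which
    the solution has small coefficients. The long factors are the quotients by the quartic. *)
Lemma base_param (v : K) (k := 3 / 2 - 3 / 2 * v + 5 / 8 * v ^+ 2 - 8^-1 * v ^+ 3) :
    v ^+ 4 - 3 * v ^+ 3 + 10 * v ^+ 2 - 4 * v + 8 = 0 ->
  k ^+ 4 - k ^+ 3 + 2 * k ^+ 2 + 2 = 0 /\ v - (k ^+ 3 - 2 * k ^+ 2 + 2 * k) = 0.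
Proof.
rewrite /k => E; split.
- transitivity ((131 / 128 - 481 / 256 * v + 479 / 256 * v ^+ 2 - 39 / 32 * v ^+ 3 + 1109 / 2048 *
    v ^+ 4
    - 675 / 4096 * v ^+ 5 + 137 / 4096 * v ^+ 6 - 17 / 4096 * v ^+ 7 + v ^+ 8 / 4096)
    * (v ^+ 4 - 3 * v ^+ 3 + 10 * v ^+ 2 - 4 * v + 8)); last by rewrite E mulr0.
  by field.
- transitivity ((- 15 / 64 + 67 / 128 * v - 93 / 256 * v ^+ 2 + 65 / 512 * v ^+ 3 - 3 / 128 * v ^+ 4
    + v ^+ 5 / 512) * (v ^+ 4 - 3 * v ^+ 3 + 10 * v ^+ 2 - 4 * v + 8)); last by rewrite E mulr0.
  by field.
Qed.

(** A polynomial in X^3 because diag(1, w, w^2), with w a primitive cube root of unity, fixes the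
    first base cubic and multiplies the second by w; it permutes the solutions and multiplies s by a
    cube root of unity. *)
Definition base_poly : {poly K} := 'X^12 - 3%:P * 'X^9 + 10%:P * 'X^6 - 4%:P * 'X^3 + 8%:P.

Lemma base_poly_horner (a : K) : base_poly.[a] =
  (a ^+ 3) ^+ 4 - 3 * (a ^+ 3) ^+ 3 + 10 * (a ^+ 3) ^+ 2 - 4 * a ^+ 3 + 8.
Proof. by rewrite /base_poly !hornerE -!exprM. Qed.

Lemma base_poly_deriv (a : K) : base_poly^`().[a] =
  3 * a ^+ 2 * (4 * (a ^+ 3) ^+ 3 - 9 * (a ^+ 3) ^+ 2 + 20 * a ^+ 3 - 4).
Proof.
rewrite /base_poly !(derivD, derivN, derivM, derivC, derivXn, mul0r, add0r, addr0) !hornerE /=.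
rewrite !derivX !hornerE; ring.
Qed.

Lemma base_poly_size : size base_poly = 13%N.
Proof.
rewrite /base_poly -!addrA size_addl ?size_polyXn //.
apply: leq_ltn_trans (_ : 10 < _)%N => //; apply/leq_sizeP => j j10.
rewrite !(coefD, coefN, coefCM, coefXn, coefC).
by case: j j10 => [|[|[|[|[|[|[|[|[|[|?]]]]]]]]]] //= _; rewrite ?(mulr0, oppr0, addr0).
Qed.

Lemma base_poly_monic : base_poly \is monic.
Proof.
rewrite monicE lead_coefE base_poly_size /base_poly.
by rewrite !(coefD, coefN, coefCM, coefXn, coefC) /= !mulr0 !(subr0, addr0).
Qed.

Lemma base_poly_deriv_neq0 (a : K) : root base_poly a -> base_poly^`().[a] != 0.
Proof.
move=> /rootP; rewrite base_poly_horner base_poly_deriv; set v := a ^+ 3 => E.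
have a0 : a != 0.
  apply: contra_eq_neq E => a0; rewrite /v a0 !expr0n /= !mulr0 !(subr0, add0r)
      Num.Theory.pnatr_eq0 //.
rewrite !mulf_neq0 ?expf_neq0 ?Num.Theory.pnatr_eq0 //.
(* (1793 - 1054 v + 296 v^2) p(v) + (602 - 891 v + 319 v^2 - 74 v^3) p'(v) = 2^5 * 373,
   where the base polynomial is p(v) in v = a^3. *)
apply: (@divisor_neq0 _ _ (602 - 891 * v + 319 * v ^+ 2 - 74 * v ^+ 3) (2 ^+ 5 * 373)).
  by rewrite mulf_neq0 ?expf_neq0 ?Num.Theory.pnatr_eq0.
rewrite -[LHS]addr0 -[X in _ + X](mulr0 (1793 - 1054 * v + 296 * v ^+ 2)) -E; ring.
Qed.

Lemma base_poly_separable : separable_poly base_poly.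
Proof.
rewrite unlock; apply/negPn/negP => /closed_rootP[a].
by rewrite root_gcd => /andP[/base_poly_deriv_neq0 d0 /rootP d0']; rewrite d0' eqxx in d0.
Qed.

End Base.

Section Base.
Variable K : numClosedFieldType.
(** A functional on cubics that kills the x_a e_i and vanishes on x^3 is determined by its values on
    x^2 y and x y^2; the two remaining equations successively give (s^3 - 2) times each of these
    values equal to zero. *)
Lemma base_cubic_det (s : K) : s ^+ 3 - 2 != 0 ->
  \det (dsubmx (cubic_mx (pencil_conic (base_l K) (base_r K) s)) : 'M_9) != 0.
Proof.
move=> s2; rewrite -unitfE -unitmxE -row_free_unit; apply: inj_row_free => y yM.
pose eta : 'rV[K]_(1 + 9) := row_mx 0 y.
have : eta *m cubic_mx (pencil_conic (base_l K) (base_r K) s) = 0.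
  rewrite -[cubic_mx _]vsubmxK mul_row_col mul0mx add0r; exact: yM.
rewrite mul_cubic_mx => /(canRL mxvecK)/matrixP P0.
have P i a : pair3 eta (pencil_conic (base_l K) (base_r K) s i) a = 0.
  by have := P0 i a; rewrite [LHS]mxE [RHS]mxE [RHS]mxE.
have h0 : (2^-1 : K) != 0 by rewrite invr_eq0 Num.Theory.pnatr_eq0.
have E1 a : s * eta 0 (ix3 i0 i0 a) + eta 0 (ix3 i0 i1 a) + eta 0 (ix3 i2 i2 a) = 0.
  by have [+ _ _] := pair3_base s eta a; rewrite P => /esym/eqP; rewrite mulf_eq0 (negbTE h0) =>
      /eqP.
have E2 a : s * eta 0 (ix3 i1 i1 a) + eta 0 (ix3 i1 i2 a) + eta 0 (ix3 i0 i0 a) = 0.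
  by have [_ + _] := pair3_base s eta a; rewrite P => /esym/eqP; rewrite mulf_eq0 (negbTE h0) =>
      /eqP.
have E3 a : - s * (eta 0 (ix3 i2 i2 a) + eta 0 (ix3 i0 i1 a)) + eta 0 (ix3 i0 i2 a) + eta 0 (ix3 i1
    i1 a) = 0.
  by have [_ _ +] := pair3_base s eta a; rewrite P => /esym/eqP; rewrite mulf_eq0 (negbTE h0) =>
      /eqP.
pose z (c : nat) := eta 0 (inord c).
have zE i j k : eta 0 (ix3 i j k) = z (rank_of [:: i; j; k]) by [].
have z0 : z 0%N = 0.
  rewrite /z (_ : inord 0 = lshift 9 (0 : 'I_1)); last by apply: ord_inj; rewrite inordK.
  by rewrite row_mxEl mxE.
have := (E1 i0, E1 i1, E1 i2, E2 i0, E2 i1, E2 i2, E3 i0, E3 i1, E3 i2).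
rewrite !zE {zE E1 E2 E3 P P0} /rank_of /mon_rank /= z0 => -[[[[[[[[e10 e11] e12] e20] e21] e22]
    e30] e31] e32].
have z5 : z 5%N = - z 1%N by apply/eqP; rewrite -subr_eq0 -[X in _ == X]e10; apply/eqP; ring.
have z8 : z 8%N = - (s * z 1%N + z 3%N) by apply/eqP; rewrite -subr_eq0 -[X in _ == X]e11;
    apply/eqP; ring.
have z4 : z 4%N = - (s * z 3%N) by apply/eqP; rewrite -subr_eq0 -[X in _ == X]e20; apply/eqP; ring.
have z2 : z 2%N = - z 3%N.
  by apply/eqP; rewrite -subr_eq0 -[X in _ == X]e30 z5; apply/eqP; ring.
have z6 : z 6%N = s * z 3%N - s ^+ 2 * z 1%N.
  by apply/eqP; rewrite -subr_eq0 -[X in _ == X]e31 z8 z4; apply/eqP; ring.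
have z9 : z 9%N = 2 * (s * z 3%N).
  by apply/eqP; rewrite -subr_eq0 -[X in _ == X]e12 z2 z4; apply/eqP; ring.
have z7 : z 7%N = z 1%N + s ^+ 2 * z 3%N.
  by apply/eqP; rewrite -subr_eq0 -[X in _ == X]e32 z9 z4 z5; apply/eqP; ring.
have z3 : z 3%N = 0.
  apply: (mulfI s2); rewrite mulr0 -[RHS]e22 z7 z8 z2; ring.
have z1 : z 1%N = 0.
  apply: (mulfI s2); rewrite mulr0 -[RHS]oppr0 -e21 z6 z7 z3; ring.
have e0 : eta = 0.
  apply/rowP => c; rewrite [RHS]mxE (_ : eta 0 c = z c); last by rewrite /z inord_val.
  have {}z5 : z 5%N = 0 by rewrite z5 z1 oppr0.
  have {}z8 : z 8%N = 0 by rewrite z8 z1 z3 mulr0 addr0 oppr0.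
  have {}z4 : z 4%N = 0 by rewrite z4 z3 mulr0 oppr0.
  have {}z2 : z 2%N = 0 by rewrite z2 z3 oppr0.
  have {}z6 : z 6%N = 0 by rewrite z6 z3 z1 !mulr0 subr0.
  have {}z9 : z 9%N = 0 by rewrite z9 z3 !mulr0.
  have {}z7 : z 7%N = 0 by rewrite z7 z1 z3 mulr0 addr0.
  by case: c => [[|[|[|[|[|[|[|[|[|[|//]]]]]]]]]]] /= _.
by move: e0; rewrite /eta -(@row_mx0 _ 1 1 9) => /eq_row_mx[].
Qed.

Lemma base_solution (k s : K) (l := row3 (s ^+ 2) (- (k ^+ 2) + 2 * k - 2) (s * (k ^+ 2 - k + 2))) :
    k ^+ 4 - k ^+ 3 + 2 * k ^+ 2 + 2 = 0 -> s ^+ 3 - (k ^+ 3 - 2 * k ^+ 2 + 2 * k) = 0 ->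
  forall i, s * cval (conic_of (base_l K) i) l + cval (conic_of (base_r K) i) l = 0.
Proof.
move=> kE sE; have [h0 h1 h2] := cval_base s l; rewrite /l !row3E in h0 h1 h2.
elim/ord3_ind; rewrite /l ?h0 ?h1 ?h2 => {h0 h1 h2}.
- apply: (eq_mod_relations kE sE (A := 2^-1 * s ^+ 2) (B := 2^-1 * s ^+ 2)); ring.
- apply: (eq_mod_relations kE sE (A := 0) (B := 2^-1 * s)); ring.
- apply: (eq_mod_relations kE sE (A := - 2^-1 * (k ^+ 3 - 3 * k ^+ 2 + 4 * k - 2)) (B := - 2^-1 *
    (k ^+ 4 - 2 * k ^+ 3 + 3 * k ^+ 2 - k))); ring.
Qed.
End Base.

(** * Nonvanishing of the discriminants at the base pencil *)

Section Base.
Variable K : numClosedFieldType.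

Section Param.
Variables (T1 T2 : 'I_3 -> 'I_3 -> 'I_3 -> K).
Hypothesis T1E : forall i j k,
  T1 i j k = [:: 2; 0; 0; 0; 0; 0; 2; 0; 0; -2]`_(rank_of [:: i; j; k]).
Hypothesis T2E : forall i j k,
  T2 i j k = [:: 0; 1; 0; 0; 0; 1; 0; 1; 0; 0]`_(rank_of [:: i; j; k]).
Variables (k s : K).
Hypothesis kE : k ^+ 4 - k ^+ 3 + 2 * k ^+ 2 + 2 = 0.
Hypothesis sE : s ^+ 3 - (k ^+ 3 - 2 * k ^+ 2 + 2 * k) = 0.

Let n (m : nat) : m.+1%:R != 0 :> K. Proof. by rewrite Num.Theory.pnatr_eq0. Qed.

(** This and the following elements are shown to be nonzero by an inverse up to a scalar: modulo the
    relations, the product with the given cofactor is a nonzero integer. *)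
Let smooth0 : - ((((1 * 10 ^+ 3 + 32) * 10 ^+ 3 + 553) * 10 ^+ 3 + 97) * k ^+ 3) + ((653 * 10 ^+ 3
    + 428) * 10 ^+ 3 + 900) * k ^+ 2 - ((504 * 10 ^+ 3 + 459) * 10 ^+ 3 + 518) * k - (((2 * 10 ^+ 3
    + 395) * 10 ^+ 3 + 148) * 10 ^+ 3 + 806) != 0.
Proof.
apply: (@divisor_neq0 _ _ ((((1 * 10 ^+ 3 + 513) * 10 ^+ 3 + 663) * 10 ^+ 3 + 932) * k ^+ 3 - (((2
    * 10 ^+ 3 + 583) * 10 ^+ 3 + 600) * 10 ^+ 3 + 529) * k ^+ 2 - (((1 * 10 ^+ 3 + 67) * 10 ^+ 3 +
    712) * 10 ^+ 3 + 125) * k - (((3 * 10 ^+ 3 + 231) * 10 ^+ 3 + 868) * 10 ^+ 3 + 426)) (2 ^+ 12 *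
    3 ^+ 2 * 23 ^+ 2 * 229)); first by rewrite ?mulf_neq0 ?expf_neq0 ?n.
apply: (eq_mod_relations kE sE (A := - (((((((1 * 10 ^+ 3 + 562) * 10 ^+ 3 + 938) * 10 ^+ 3 + 380)
    * 10 ^+ 3 + 803) * 10 ^+ 3 + 797) * 10 ^+ 3 + 404) * k ^+ 2) + ((((((2 * 10 ^+ 3 + 93) * 10 ^+
    3 + 838) * 10 ^+ 3 + 104) * 10 ^+ 3 + 882) * 10 ^+ 3 + 425) * 10 ^+ 3 + 709) * k + ((((((3 * 10
    ^+ 3 + 870) * 10 ^+ 3 + 402) * 10 ^+ 3 + 898) * 10 ^+ 3 + 608) * 10 ^+ 3 + 628) * 10 ^+ 3 +
    766)) (B := 0)); ring.
Qed.

Let trans0 : 59 * k ^+ 3 - 12 * k ^+ 2 - 14 * k + 194 != 0.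
Proof.
apply: (@divisor_neq0 _ _ (- (47 * k ^+ 3) + 203 * k ^+ 2 + 116 * k + 212) (2 ^+ 4 * 23)); first by
    rewrite ?mulf_neq0 ?expf_neq0 ?n.
apply: (eq_mod_relations kE sE (A := - ((2 * 10 ^+ 3 + 773) * k ^+ 2) + (9 * 10 ^+ 3 + 768) * k +
    (20 * 10 ^+ 3 + 380)) (B := 0)); ring.
Qed.

Let disc0 : - (7 * k ^+ 3) - 4 * k ^+ 2 + 14 * k - 38 != 0.
Proof.
apply: (@divisor_neq0 _ _ (- (5 * k ^+ 3) - 20 * k ^+ 2 - 18 * k - 21) (276)); first by rewrite
    ?mulf_neq0 ?expf_neq0 ?n.
apply: (eq_mod_relations kE sE (A := 35 * k ^+ 2 + 195 * k + 261) (B := 0)); ring.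
Qed.

Let Z0 : - (k ^+ 2) + k - 2 != 0.
Proof.
apply: (@divisor_neq0 _ _ (k ^+ 2) (2)); first by rewrite ?mulf_neq0 ?expf_neq0 ?n.
apply: (eq_mod_relations kE sE (A := - (1)) (B := 0)); ring.
Qed.

Let Y0 : - (k ^+ 2) + 2 * k - 2 != 0.
Proof.
apply: (@divisor_neq0 _ _ (- (k ^+ 3) - k) (2)); first by rewrite ?mulf_neq0 ?expf_neq0 ?n.
apply: (eq_mod_relations kE sE (A := k - 1) (B := 0)); ring.
Qed.

Let k0 : k != 0.
Proof.
apply: (@divisor_neq0 _ _ (- (k ^+ 3) + k ^+ 2 - 2 * k) (2)); first by rewrite ?mulf_neq0
    ?expf_neq0 ?n.
apply: (eq_mod_relations kE sE (A := - (1)) (B := 0)); ring.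
Qed.

Let s0 : s != 0.
Proof.
have : s ^+ 3 != 0.
  have -> : s ^+ 3 = - k * (- (k ^+ 2) + 2 * k - 2).
    by apply: (eq_mod_relations kE sE (A := 0) (B := 1)); ring.
  by rewrite mulf_neq0 ?oppr_eq0.
by rewrite expf_eq0.
Qed.

Let s2 : s ^+ 3 - 2 != 0.
Proof.
apply: (@divisor_neq0 _ _ (k ^+ 2 - k) 4); first exact: n.
apply: (eq_mod_relations kE sE (A := k - 2) (B := k ^+ 2 - k)); ring.
Qed.

Lemma base_flex_disc : flex_disc T1 T2 (base_l K) (base_r K) s != 0.
Proof.
pose e := pencil_conic (base_l K) (base_r K) s.
pose xi := row3 (s ^+ 2) (- (k ^+ 2) + 2 * k - 2) (s * (k ^+ 2 - k + 2)).
have d0 := base_cubic_det s2; rewrite -/e in d0.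
have xi0 : xi != 0.
  by apply: contraNneq s0 => /rowP/(_ i0); rewrite /xi row3E mxE => /eqP; rewrite expf_eq0.
have xie i : cval (e i) xi = 0.
  rewrite -[RHS](base_solution kE sE i) /cval mulr_sumr -big_split; apply: eq_bigr => j _ /=.
  rewrite mulr_sumr -big_split; apply: eq_bigr => m _ /=.
  by rewrite [X in X * _]mxE [X in (X + _) * _]mxE mulrDl -mulrA.
have [_ lE] := solution_line_coord xi0 xie d0.
pose t := 4^-1 * (\det (dsubmx (cubic_mx e) : 'M_9) / xi 0 i0).
have t0 : t != 0.
  apply: mulf_neq0; first by rewrite invr_eq0 n.
  by apply: mulf_neq0 => //; rewrite invr_eq0 /xi row3E expf_eq0 /= s0.
have l0 : line_coord e 0 i0 = 4 * t * s ^+ 2.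
  rewrite lE [LHS]mxE /t /xi !row3E; set D := \det _; by field.
have l1 : line_coord e 0 i1 = 4 * t * (- (k ^+ 2) + 2 * k - 2).
  rewrite lE [LHS]mxE /t /xi !row3E; set D := \det _; by field.
have l2 : line_coord e 0 i2 = 4 * t * s * (k ^+ 2 - k + 2).
  rewrite lE [LHS]mxE /t /xi !row3E; set D := \det _; by field.
have yE i j : apolar_conic (base_l K) (base_r K) s 0 (ix2 i j) =
    s * \sum_m line_coord e 0 m * base_l K m (ix2 i j) + \sum_m line_coord e 0 m * base_r K m (ix2
        i j).
  by rewrite [LHS]mxE [X in X + _ = _]mxE; congr (s * _ + _); rewrite [LHS]mxE.
have a_ : apolar_conic (base_l K) (base_r K) s 0 (ix2 i1 i1) = 2 * t * s * (- (k ^+ 2) + 2 * k - 2).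
  rewrite yE !sum3 l0 l1 l2 ![base_l _ _ _]mxE ![base_r _ _ _]mxE !val_ix2 /=; by field.
have b_ : apolar_conic (base_l K) (base_r K) s 0 (ix2 i1 i2) = t * (- (k ^+ 3) + 2 * k - 4).
  rewrite yE !sum3 l0 l1 l2 ![base_l _ _ _]mxE ![base_r _ _ _]mxE !val_ix2 /=.
  by apply: (eq_mod_relations kE sE (A := 0) (B := - t)); field.
have c_ : apolar_conic (base_l K) (base_r K) s 0 (ix2 i2 i2) = 2 * t * s ^+ 2 * (- (k ^+ 2) + k -
    2).
  rewrite yE !sum3 l0 l1 l2 ![base_l _ _ _]mxE ![base_r _ _ _]mxE !val_ix2 /=; by field.
have dE : delta_mx 0 i0 = row3 1 0 0 :> 'rV[K]_3.
  by apply/rowP; elim/ord3_ind; rewrite !mxE.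
rewrite /flex_disc -/e dE a_ b_ c_ l0 l1 l2.
have := val_transvectant T1E T2E t kE sE; rewrite /= => ->.
have := val_smooth T1E T2E t kE sE; rewrite /= => ->.
have := val_disc t kE sE; rewrite /= => ->.
by clearbody t; rewrite !mulf_neq0 ?expf_neq0 ?n.
Qed.
End Param.
End Base.

Section Base.
Variable K : numClosedFieldType.
Variables (T1 T2 : 'I_3 -> 'I_3 -> 'I_3 -> K).
Hypothesis T1E : forall i j k,
  T1 i j k = [:: 2; 0; 0; 0; 0; 0; 2; 0; 0; -2]`_(rank_of [:: i; j; k]).
Hypothesis T2E : forall i j k,
  T2 i j k = [:: 0; 1; 0; 0; 0; 1; 0; 1; 0; 0]`_(rank_of [:: i; j; k]).

Lemma base_root (a : K) : root (base_poly K) a -> exists k,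
  k ^+ 4 - k ^+ 3 + 2 * k ^+ 2 + 2 = 0 /\ a ^+ 3 - (k ^+ 3 - 2 * k ^+ 2 + 2 * k) = 0.
Proof.
by move=> /rootP; rewrite base_poly_horner => /base_param E; eexists; exact: E.
Qed.

(** Each root of [base_poly] yields an explicit solution, hence an eigenvalue. There are twelve
    distinct ones, so the characteristic polynomial is known without computing a determinant of size
    12. *)
Lemma base_char_poly S : slice_mx (conic_of (base_l K)) *m S = 1%:M ->
  char_poly (shift12 (conic_of (base_l K)) (conic_of (base_r K)) S (base_J K)) = base_poly K.
Proof.
move=> SE; apply: monic_eq_of_roots.
- exact: base_poly_monic.
- exact: char_poly_monic.
- by rewrite base_poly_size size_char_poly.
- exact: base_poly_separable.
move=> a /base_root[k [kE aE]].
have a0 : a != 0.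
  have : a ^+ 3 != 0.
    apply: (@divisor_neq0 _ _ (- 2 - 2 * k ^+ 2) (- 4)).
      by rewrite oppr_eq0 Num.Theory.pnatr_eq0.
    apply: (eq_mod_relations kE aE (A := 2 - 2 * k) (B := - 2 - 2 * k ^+ 2)); ring.
  by rewrite expf_eq0.
apply: (solution_root SE (base_J_unit K) _ (base_solution kE aE)).
by apply: contraNneq a0 => /rowP/(_ i0); rewrite row3E mxE => /eqP; rewrite expf_eq0.
Qed.

Lemma generic_pencil_base : exists S, generic_pencil T1 T2 S (base_J K).
Proof.
have [S SE] := base_slice_inv K; exists S.
rewrite /generic_pencil /pencil_shift (base_conicl T1E T2E) (base_conicr T1E T2E) (base_inv T1E
    T2E).
split.
- exact: base_unit T1E T2E.
- exact: SE.
- exact: base_koszul_full.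
- exact: base_J_unit.
move=> a; rewrite (base_char_poly SE) => ra; split; first exact: base_poly_deriv_neq0.
have [k [kE aE]] := base_root ra.
rewrite col_mxKu col_mxKd; exact: (base_flex_disc T1E T2E kE aE).
Qed.

End Base.

(** * Plücker coordinates *)

Lemma mdeg_mnmU3 (i j k : 'I_3) : mdeg (U_(i) + U_(j) + U_(k))%MM = 3%N.
Proof. by rewrite !mdegD !mdeg1. Qed.

Definition cubic_mon (i j k : 'I_3) : cubic_monomial :=
  exist _ (@BMultinom 3 4 (U_(i) + U_(j) + U_(k))%MM (eq_leq (congr1 S (mdeg_mnmU3 i j k))))
    (introT eqP (mdeg_mnmU3 i j k)).

Lemma val_cubic_mon i j k : val (cubic_mon i j k) = (U_(i) + U_(j) + U_(k))%MM :> 'X_{1..3}.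
Proof. by []. Qed.

Section Scaling.
Variables (K : fieldType) (n : nat).
Implicit Types (P d : {mpoly K[n]}) (v : 'I_n -> K).

Lemma meval_homog k P v c : P \is k.-homog -> P.@[fun i => c * v i] = c ^+ k * P.@[v].
Proof.
move=> /dhomogP hP; rewrite !mevalE mulr_sumr big_seq [RHS]big_seq; apply: eq_bigr => m mP.
have <- : mdeg m = k by exact: hP.
rewrite mulrCA; congr (_ * _); rewrite mdegE -prodrXr -big_split.
by apply: eq_bigr => i _; rewrite exprMn.
Qed.

Lemma meval_homog_sum d v c :
  d.@[fun i => c * v i] = \sum_(k < msize d) c ^+ k * (pihomog mdeg k d).@[v].
Proof.
rewrite {1}(@pihomog_partitionE _ _ mdeg (msize d) d) //.
by rewrite raddf_sum; apply: eq_bigr => k _; apply/meval_homog/pihomogP.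
Qed.
End Scaling.

Section Forms.
Variable K : fieldType.

Lemma cubic_coef_inj (F G : cubic_form K) :
  (forall m : cubic_monomial, F@_(val m) = G@_(val m)) -> F = G.
Proof.
move=> FG; apply: val_inj; apply/mpolyP => m.
have [m3|m3] := eqVneq (mdeg m) 3%N; last first.
  by rewrite !(dhomog_nemf_coeff (dhomog_is_dhomog _) m3).
have m4 : (mdeg m < 4)%N by rewrite m3.
exact: (FG (exist _ (BMultinom m4) (introT eqP m3))).
Qed.

Definition cubic_of_coef (c : cubic_monomial -> K) : cubic_form K :=
  indhomog 3 (\sum_(m : cubic_monomial) c m *: 'X_[val m]).

Lemma cubic_of_coefE c (m : cubic_monomial) : (cubic_of_coef c)@_(val m) = c m.
Proof.
rewrite /cubic_of_coef /indhomog /insubd insubT /=.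
  by apply: rpred_sum => a _; apply: rpredZ; rewrite dhomogX; exact: valP a.
move=> _; rewrite linear_sum (bigD1 m) //= mcoeffZ mcoeffX eqxx mulr1 big1 ?addr0 // => a am.
rewrite mcoeffZ mcoeffX (_ : (bmnm (val a) == bmnm (val m)) = false) ?mulr0 //.
by apply/negbTE; rewrite -bmeqP (inj_eq val_inj).
Qed.

End Forms.

Section Plucker.
Variable K : numClosedFieldType.
Local Notation n := #|{: plucker_index}|.
Implicit Types (W : {vspace cubic_form K}) (F G : cubic_form K) (v : 'I_n -> K).

Definition minors F G (k : 'I_n) : K :=
  let: (a, b) := enum_val k in F@_(val a) * G@_(val b) - F@_(val b) * G@_(val a).

Lemma minorsE F G a b :
  minors F G (enum_rank (a, b)) = F@_(val a) * G@_(val b) - F@_(val b) * G@_(val a).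
Proof. by rewrite /minors enum_rankK. Qed.

(* A pencil with given Plücker vector: its members vanishing on the monomials
   [x^2 y] and [x^3]; the factors clear the weights of the base tensors. *)
Definition pencil_fst v : cubic_form K :=
  cubic_of_coef (fun m => 2 * v (enum_rank (m, cubic_mon i0 i0 i1))).
Definition pencil_snd v : cubic_form K :=
  cubic_of_coef (fun m => 3 * v (enum_rank (cubic_mon i0 i0 i0, m))).

(** Fixing one index in the minors of F and G leaves a combination of F and G. So any multiple of
    the Plücker vector of a pencil is sent to members of that pencil. *)
Lemma pencil_fst_minors F G c : pencil_fst (fun i => c * minors F G i) =
  (2 * c * G@_(val (cubic_mon i0 i0 i1))) *: F - (2 * c * F@_(val (cubic_mon i0 i0 i1))) *: G.
Proof.
apply: cubic_coef_inj => m; rewrite cubic_of_coefE minorsE /= mcoeffB !mcoeffZ; ring.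
Qed.

Lemma pencil_snd_minors F G c : pencil_snd (fun i => c * minors F G i) =
  (3 * c * F@_(val (cubic_mon i0 i0 i0))) *: G - (3 * c * G@_(val (cubic_mon i0 i0 i0))) *: F.
Proof.
apply: cubic_coef_inj => m; rewrite cubic_of_coefE minorsE /= mcoeffB !mcoeffZ; ring.
Qed.

Definition base_fst : cubic_form K := cubic_of_coef (fun m =>
  [:: 1; 0; 0; 0; 0; 0; 1; 0; 0; -1]`_(mon_rank (val m i1) (val m i2))).
Definition base_snd : cubic_form K := cubic_of_coef (fun m =>
  [:: 0; 1; 0; 0; 0; 1; 0; 1; 0; 0]`_(mon_rank (val m i1) (val m i2))).
Definition base_vec := minors base_fst base_snd.

Let base_coef (i j k : 'I_3) :
  mon_rank (val (cubic_mon i j k) i1) (val (cubic_mon i j k) i2) = rank_of [:: i; j; k].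
Proof. by rewrite val_cubic_mon !mnmDE !mnm1E /rank_of /= !addn0 !addnA. Qed.

Let base_fstE i j k : base_fst@_(val (cubic_mon i j k)) =
  [:: 1; 0; 0; 0; 0; 0; 1; 0; 0; -1]`_(rank_of [:: i; j; k]).
Proof. by rewrite cubic_of_coefE base_coef. Qed.

Let base_sndE i j k : base_snd@_(val (cubic_mon i j k)) =
  [:: 0; 1; 0; 0; 0; 1; 0; 1; 0; 0]`_(rank_of [:: i; j; k]).
Proof. by rewrite cubic_of_coefE base_coef. Qed.

Lemma base_fst_tensor i j k : tensor (pencil_fst base_vec) i j k =
  [:: 2; 0; 0; 0; 0; 0; 2; 0; 0; -2]`_(rank_of [:: i; j; k]).
Proof.
rewrite /tensor -val_cubic_mon cubic_of_coefE /base_vec minorsE !base_fstE !base_sndE.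
by elim/ord3_ind: i; elim/ord3_ind: j; elim/ord3_ind: k; rewrite /polar_weight /=; field.
Qed.

Lemma base_snd_tensor i j k : tensor (pencil_snd base_vec) i j k =
  [:: 0; 1; 0; 0; 0; 1; 0; 1; 0; 0]`_(rank_of [:: i; j; k]).
Proof.
rewrite /tensor -val_cubic_mon cubic_of_coefE /base_vec minorsE !base_fstE !base_sndE.
by elim/ord3_ind: i; elim/ord3_ind: j; elim/ord3_ind: k; rewrite /polar_weight /=; field.
Qed.

(** Here v is an arbitrary vector of the ambient space of the Plücker embedding; the coefficients of
    the two forms are linear in it. *)
Lemma near_base : near base_vec (fun v => exists S,
  generic_pencil (tensor (pencil_fst v)) (tensor (pencil_snd v)) S (base_J K)).
Proof.
have [S base_generic] := generic_pencil_base base_fst_tensor base_snd_tensor.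
apply: (near_generic_pencil _ _ base_generic) => i j k.
  apply: (@eq_regularC _ _ _ (fun v => polar_weight K i j k * (2 * v (enum_rank (cubic_mon i j k,
      cubic_mon i0 i0 i1))))).
    by move=> v; rewrite /tensor -val_cubic_mon cubic_of_coefE.
  apply: regularC_M; first exact: regularC_const.
  by apply: regularC_M; [exact: regularC_const | exact: regular_coord].
apply: (@eq_regularC _ _ _ (fun v => polar_weight K i j k * (3 * v (enum_rank (cubic_mon i0 i0 i0,
    cubic_mon i j k))))).
  by move=> v; rewrite /tensor -val_cubic_mon cubic_of_coefE.
apply: regularC_M; first exact: regularC_const.
by apply: regularC_M; [exact: regularC_const | exact: regular_coord].
Qed.

Let F1 W := (vbasis W)`_0.
Let G1 W := (vbasis W)`_1.

Lemma pluckerE W : plucker W =1 minors (F1 W) (G1 W).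
Proof. by []. Qed.

Lemma vbasis_pair W : \dim W = 2%N -> vbasis W = [:: F1 W; G1 W] :> seq _.
Proof.
move=> dW; have := size_tuple (vbasis W); rewrite [X in _ = X]dW /F1 /G1.
by case: (tval _) => [|x [|y [|]]].
Qed.

Lemma vbasis_pair_mem W : \dim W = 2%N -> F1 W \in W /\ G1 W \in W.
Proof.
by move=> dW; split; apply: vbasis_mem; apply: mem_nth; rewrite size_tuple [X in (_ < X)%N]dW.
Qed.

(** The scalar is the determinant of the coordinates of F and G in the basis of W. *)
Lemma plucker_mul W F G : \dim W = 2%N -> F \in W -> G \in W ->
  exists c, forall i, minors F G i = c * plucker W i.
Proof.
move=> dW; have E H : H \in W -> exists a b, H = a *: F1 W + b *: G1 W.
  rewrite -{1}(span_basis (vbasisP W)) vbasis_pair // span_cons span_seq1.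
  by case/memv_addP => _ /vlineP[a ->] [_ /vlineP[b ->] ->]; exists a, b.
move=> /E[a [b ->]] /E[c [e ->]]; exists (a * e - b * c) => i.
rewrite pluckerE /minors; case: (enum_val i) => m m' /=.
rewrite !mcoeffD !mcoeffZ; ring.
Qed.

Lemma dim_base_pencil : \dim <<[:: base_fst; base_snd]>> = 2%N.
Proof.
suff /eqP : free [:: base_fst; base_snd] by [].
rewrite free_cons seq1_free span_seq1; apply/andP; split.
  apply/negP => /vlineP[c E]; have := base_fstE i0 i0 i0.
  rewrite E [LHS](mcoeffZ c base_snd) base_sndE /= mulr0 => /eqP.
  by rewrite eq_sym oner_eq0.
apply/negP => /eqP E; have := base_sndE i0 i0 i1; rewrite E [LHS]mcoeff0 /= => /eqP.
by rewrite eq_sym oner_eq0.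
Qed.

End Plucker.

Theorem common_flex_lines_12 (K : numClosedFieldType) :
  exists U : {vspace cubic_form K} -> Prop,
    [/\ zariski_open_Gr2 U,
        exists W : {vspace cubic_form K}, U W
      & forall W : {vspace cubic_form K}, U W ->
          exists s : seq {vspace 'rV[K]_3},
            [/\ uniq s, size s = 12%N
              & forall L : {vspace 'rV[K]_3},
                  L \in s <-> common_flex_line W L]].
Proof.
have [d d0 dP] := near_base K.
(* [d] need not be homogeneous, but if one of its components does not vanish at
   [plucker W], then [d] does not vanish at some multiple of it. *)
pose S P := exists k : 'I_(msize d), P = pihomog mdeg k d.
exists (fun W => \dim W = 2%N /\ exists P, S P /\ P.@[plucker W] != 0); split.
- by exists S; split=> // P [k ->]; exists k; apply: pihomogP.
- exists <<[:: base_fst K; base_snd K]>>%VS; split; first exact: dim_base_pencil.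
  set W := <<_>>%VS; have [c cE] : exists c, forall i, base_vec K i = c * plucker W i.
    by apply: plucker_mul; rewrite ?dim_base_pencil ?memv_span ?inE ?eqxx ?orbT.
  (* [base_vec] is a multiple of the Plücker vector of this pencil, so [d] would vanish at it if all
     components did. *)
  have [k dk|dk] := pickP (fun k : 'I_(msize d) => (pihomog mdeg k d).@[plucker W] != 0).
    by exists (pihomog mdeg k d); split=> //; exists k.
  case/eqP: d0; rewrite (meval_eq _ cE) meval_homog_sum big1 // => k _.
  by have /negbFE/eqP-> := dk k; rewrite mulr0.
move=> W [dW [_ [[k ->] dk0]]].
(* Up to the order of the factors this is c |-> d(c v) for v the Plücker vector, a nonzero
   polynomial; any c that is not a root will do. *)
pose p := \poly_(i < msize d) (pihomog mdeg i d).@[plucker W].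
have p0 : p != 0 by apply: contraNneq dk0 => /polyP/(_ k); rewrite coef_poly ltn_ord coef0 => ->.
have [c pc] : exists c, p.[c] != 0 by have /closed_nonrootP := p0.
have dc : d.@[fun i => c * plucker W i] != 0.
  rewrite meval_homog_sum; move: pc; rewrite horner_poly.
  by under eq_bigr => i _ do rewrite mulrC.
have [S' gen] := dP _ dc; have [FW GW] := vbasis_pair_mem dW.
apply: (generic_pencil_count dW _ _ gen).
  by rewrite pencil_fst_minors memvB ?memvZ.
by rewrite pencil_snd_minors memvB ?memvZ.
Qed.

Theorem theorem1p1 (R : realType) :
  exists U : {vspace cubic_form R[i]} -> Prop,
    [/\ zariski_open_Gr2 U,
        exists W : {vspace cubic_form R[i]}, U W
      & forall W : {vspace cubic_form R[i]}, U W ->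
          exists s : seq {vspace 'rV[R[i]]_3},
            [/\ uniq s, size s = 12%N
              & forall L : {vspace 'rV[R[i]]_3},
                  L \in s <-> common_flex_line W L]].
Proof. exact: common_flex_lines_12. Qed.
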